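(* Let $Q=\left(\begin{array}{cc} q_1 & q\\ \overline{q} & q_2\end{array}\right)$ be a Hermitian $2\times 2$ complex $\pi$-periodic matrix function on $\mathbb{R}$, integrable on $[0,\pi)$ (with $q_1,q_2$ real valued and $q$ complex valued). Let $\Delta(\lambda)$ be the discriminant of $JY'+QY=\lambda Y$, and let $Q_1,Q_2,\tilde Q_1,\tilde Q_2$ be as defined in the context. Then the following hold. (a) If $Q_1$ is a.e. $\frac{\pi}{2}$-anti-periodic and $Q_2$ is a.e. $\frac{\pi}{2}$-periodic, then $\Delta-2e^{-i\int_0^\pi \mathrm{Im}\, q\,dt}$ has only double zeros. (b) If $\Delta-2e^{-i\int_0^\pi \mathrm{Im}\, q\,dt}$ has only double zeros, then $\tilde Q_1$ is a.e. $\frac{\pi}{2}$-anti-periodic and $\tilde Q_2$ is a.e. $\frac{\pi}{2}$-periodic.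
   Context: $J=\left(\begin{array}{cc}0&1\\-1&0\end{array}\right)$, $\sigma_0=\mathbb{I}$ is the $2\times2$ identity matrix, $\sigma_1=\left(\begin{array}{cc}0&1\\1&0\end{array}\right)$, $\sigma_2=\left(\begin{array}{cc}0&i\\-i&0\end{array}\right)=iJ$, $\sigma_3=\left(\begin{array}{cc}1&0\\0&-1\end{array}\right)$. For $\lambda\in\mathbb{C}$, let $\mathbb{Y}(z)=\mathbb{Y}(z,\lambda)$ be the $2\times 2$ matrix solution (locally absolutely continuous in $z\in\mathbb{R}$, equation holding a.e.) of $JY'+QY=\lambda Y$ with $\mathbb{Y}(0)=\mathbb{I}$. The discriminant is the entire function $\Delta(\lambda)=\mathrm{Tr}\,\mathbb{Y}(\pi,\lambda)$. ''$f$ has only double zeros'' means that every zero of the entire function $f$ of $\lambda$ has multiplicity exactly $2$. Decompose $Q=Q_1+Q_2$ with $Q_1=\mathrm{Re}(q)\,\sigma_1+\frac12(q_1-q_2)\sigma_3$ and $Q_2=\frac12(q_1+q_2)\sigma_0+\mathrm{Im}(q)\,\sigma_2$. Put $$R(z)=\exp\Big(J\int_0^z\Big(Q_2(t)-\frac1\pi\int_0^\pi Q_2(\tau)\,d\tau\Big)dt\Big),$$ $\tilde Q_1(z)=R(z)^{-1}Q_1(z)R(z)$ and $\tilde Q_2(z)=\frac1\pi\int_0^\pi Q_2(t)\,dt$ (constant in $z$). (The substitution $Y=R\tilde Y$ transforms $JY'+QY=\lambda Y$ into $J\tilde Y'+(\tilde Q_1+\tilde Q_2)\tilde Y=\lambda\tilde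 Y$.) A function $F$ is a.e. $\frac{\pi}{2}$-periodic (respectively a.e. $\frac\pi2$-anti-periodic) if $F(z+\frac\pi2)=F(z)$ (respectively $F(z+\frac\pi2)=-F(z)$) for a.e. $z\in\mathbb{R}$. *)

(* Defs.v *)
From HB Require Import structures.
From mathcomp Require Import all_boot all_order all_algebra.
From mathcomp Require Import all_classical all_reals all_analysis.
From mathcomp Require Import complex.

Set Implicit Arguments.
Unset Strict Implicit.
Unset Printing Implicit Defensive.

Import Order.TTheory GRing.Theory Num.Theory.
Import numFieldNormedType.Exports.

Local Open Scope classical_set_scope.
Local Open Scope ring_scope.
Local Open Scope complex_scope.

Section OverNumField.
Variable K : numFieldType.

Definition expmx (n : nat) (A : 'M[K]_n.+1) : 'M[K]_n.+1 :=
  limn (series (fun k : nat => (k`!%:R)^-1 *: A ^+ k)).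

(* For K = R[i] the derivatives are complex derivatives. *)
Definition zero_of_order (m : nat) (f : K -> K^o) (l : K) : Prop :=
  (forall k, (k < m)%N -> derive1n k f l = 0) /\ derive1n m f l <> 0.

Definition only_double_zeros (f : K -> K^o) : Prop :=
  forall l, f l = 0 -> zero_of_order 2 f l.

End OverNumField.

Section TwoByTwo.
Variable R : realType.

Definition mx2 (a b c d : R[i]) : 'M[R[i]]_2 :=
  \matrix_(i < 2, j < 2)
    if i == 0 then (if j == 0 then a else b) else (if j == 0 then c else d).

Definition Jmx : 'M[R[i]]_2 := mx2 0 1 (- 1) 0.
Definition sigma0 : 'M[R[i]]_2 := 1%:M.
Definition sigma1 : 'M[R[i]]_2 := mx2 0 1 1 0.
(* The sign is opposite to that of the usual second Pauli matrix, so that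
   sigma2 = 'i *: Jmx. *)
Definition sigma2 : 'M[R[i]]_2 := mx2 0 'i%C (- 'i%C) 0.
Definition sigma3 : 'M[R[i]]_2 := mx2 1 0 0 (- 1).

Definition cexp (z : R[i]) : R[i] :=
  (expR (complex.Re z))%:C * (cos (complex.Im z) +i* sin (complex.Im z)).

End TwoByTwo.

Arguments Jmx {R}.
Arguments sigma0 {R}.
Arguments sigma1 {R}.
Arguments sigma2 {R}.
Arguments sigma3 {R}.

Section Calculus.
Variable R : realType.
Implicit Types (f : R -> R) (F : R -> 'M[R[i]]_2) (a b z T : R).

(* Oriented Lebesgue integral, so that b < a is allowed. *)
Definition oint a b f : R :=
  if a <= b then \int[lebesgue_measure]_(t in `[a, b]) f t
  else - \int[lebesgue_measure]_(t in `[b, a]) f t.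

Definition mxint a b F : 'M[R[i]]_2 :=
  \matrix_(i, j) (oint a b (fun t => complex.Re (F t i j))
                  +i* oint a b (fun t => complex.Im (F t i j))).

Definition mx_integrable (D : set R) F : Prop :=
  forall i j,
    lebesgue_measure.-integrable D (fun t => (complex.Re (F t i j))%:E) /\
    lebesgue_measure.-integrable D (fun t => (complex.Im (F t i j))%:E).

Definition abs_cont_on a b f : Prop :=
  forall e : R, 0 < e -> exists2 d : R, 0 < d &
    forall (n : nat) (l r : 'I_n -> R),
      (forall k, [/\ a <= l k, l k <= r k & r k <= b]) ->
      (forall k m, k != m -> r k <= l m \/ r m <= l k) ->
      \sum_(k < n) (r k - l k) < d ->
      \sum_(k < n) `|f (r k) - f (l k)| < e.

Definition loc_abs_cont f : Prop := forall a b, a < b -> abs_cont_on a b f.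

Definition mx_loc_abs_cont F : Prop :=
  forall i j, loc_abs_cont (fun t => complex.Re (F t i j)) /\
              loc_abs_cont (fun t => complex.Im (F t i j)).

Definition mx_derivable F z : Prop :=
  forall i j, derivable (fun t => complex.Re (F t i j)) z 1 /\
              derivable (fun t => complex.Im (F t i j)) z 1.

Definition mx_derive F z : 'M[R[i]]_2 :=
  \matrix_(i, j) (derive1 (fun t => complex.Re (F t i j)) z
                  +i* derive1 (fun t => complex.Im (F t i j)) z).

Definition ae_periodic T F : Prop :=
  {ae lebesgue_measure, forall z : R, F (z + T) = F z}.

Definition ae_antiperiodic T F : Prop :=
  {ae lebesgue_measure, forall z : R, F (z + T) = - F z}.

End Calculus.

Section DiracSystem.
Variable R : realType.

Definition is_solution (Q : R -> 'M[R[i]]_2) (l : R[i]) (Y : R -> 'M[R[i]]_2) :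
    Prop :=
  mx_loc_abs_cont Y /\
  {ae lebesgue_measure, forall z : R,
    mx_derivable Y z /\ Jmx *m mx_derive Y z + Q z *m Y z = l *: Y z}.

Definition is_fundamental (Q : R -> 'M[R[i]]_2)
    (Y : R -> R[i] -> 'M[R[i]]_2) : Prop :=
  forall l, is_solution Q l (fun z => Y z l) /\ Y 0 l = 1%:M.

Definition discriminant (Y : R -> R[i] -> 'M[R[i]]_2) (l : R[i]) : R[i] :=
  \tr (Y pi l).

Variables (q1 q2 : R -> R) (q : R -> R[i]).

Definition Qmx (z : R) : 'M[R[i]]_2 :=
  mx2 (q1 z)%:C (q z) (q z)^*%C (q2 z)%:C.

Definition Q1mx (z : R) : 'M[R[i]]_2 :=
  (complex.Re (q z))%:C *: sigma1 + ((q1 z - q2 z) / 2)%:C *: sigma3.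

Definition Q2mx (z : R) : 'M[R[i]]_2 :=
  ((q1 z + q2 z) / 2)%:C *: sigma0 + (complex.Im (q z))%:C *: sigma2.

Definition Q2tilde (z : R) : 'M[R[i]]_2 := (pi^-1)%:C *: mxint 0 pi Q2mx.

Definition Rmx (z : R) : 'M[R[i]]_2 :=
  expmx (Jmx *m mxint 0 z (fun t => Q2mx t - Q2tilde t)).

Definition Q1tilde (z : R) : 'M[R[i]]_2 :=
  invmx (Rmx z) *m Q1mx z *m Rmx z.

End DiracSystem.

(* Main.v *)
(** In the eigenbasis of J, after the gauge transformation that removes Q_2 up to a
    constant, the Dirac system becomes the Zakharov-Shabat system
      a' = - i l a + u b,   b' = conj(u) a + i l b,
    with l shifted by the mean of (q_1 + q_2) / 2.  The real and imaginary parts of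
    u are the entries of Q~_1, and Delta is a unimodular constant times the trace D(l)
    of the monodromy over pi, so the question is when D - 2 has only double zeros.

    If u is pi/2-antiperiodic and Phi denotes the fundamental matrix at pi/2 with
    diagonal entries f and k, then D - 2 = (f - k)^2, and f - k has simple zeros,
    all real.

    Conversely, let A and B be the transfer matrices over two consecutive half-periods
    starting at any base point, so that D = tr(BA).  At a double zero of D - 2
    the monodromy is the identity, hence A = B^-1, so that E = A_12 + B_12 and
    E = tr A - tr B vanish at all zeros of D - 2 and E^2 / (D - 2) is entire.  It is
    bounded in strips, since |D - 2| >= c (Im l)^2 there, and tends to 0 as
    |Im l| grows, so E = 0 by Liouville's theorem.  Differentiating
    A_12 + B_12 = 0 with respect to the base point gives
    (u(z + pi/2) + u(z)) (A_11 - B_22) = 0 a.e., where (A_11 - B_22)^2 = D - 2 is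
    nonzero at any nonreal l. *)

Require Import Defs.
From HB Require Import structures.
From mathcomp Require Import all_boot all_order all_algebra.
From mathcomp Require Import all_classical all_reals all_analysis.
From mathcomp Require Import complex.
From mathcomp Require Import measurable_realfun.
From mathcomp Require Import ring lra.

Set Implicit Arguments.
Unset Strict Implicit.
Unset Printing Implicit Defensive.

Import Order.TTheory GRing.Theory Num.Theory.
Import numFieldNormedType.Exports.

Local Open Scope classical_set_scope.
Local Open Scope ring_scope.
Local Open Scope complex_scope.


(** * Primitives of locally integrable functions *)

(** The potential is merely integrable, so the system holds only almost everywhere. Every estimate
    therefore rests on the monotonicity of absolutely continuous functions whose derivative has a
    sign a.e., and the asymptotics in [l] come without a rate. The spectral parameter is handled
    without contour integrals: analyticity means approximation by polynomials with a power
    remainder, obtained for the fundamental matrix by iterating an integral equation. The delicate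
    place is the real axis, where the zeros of [D - 2] lie. There the bound [c (Im l)^2] controls
    [E^2 / (D - 2)] uniformly in [Re l] only by a multiple of [(Im l)^-2]. The Liouville theorem
    used below admits this growth, which is compensated by a factor vanishing at the two real points
    of a large circle. Equality of the traces of A and B is used along with [A_12 + B_12 = 0]: it
    makes [A - B^-1] triangular of trace 0, so that its determinant [2 - D] is minus a square. *)

Section AbsCont.
Variable R : realType.
Implicit Types (f g : R -> R) (a b x y z : R).
Notation mu := (@lebesgue_measure R).

Lemma aeW (P Q : set R) : (forall x, P x -> Q x) ->
  {ae mu, forall x, P x} -> {ae mu, forall x, Q x}.
Proof. exact: (@filterS _ _ (ae_filter_ringOfSetsType mu)). Qed.

Lemma aeI (P Q : set R) : {ae mu, forall x, P x} -> {ae mu, forall x, Q x} ->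
  {ae mu, forall x, P x /\ Q x}.
Proof. exact: (@filterI _ _ (ae_filter_ringOfSetsType mu)). Qed.

Lemma aeE (P : set R) : (forall x, P x) -> {ae mu, forall x, P x}.
Proof. move=> h; apply: (@filterE _ _ (ae_filter_ringOfSetsType mu)) => x; exact: h. Qed.

(** A primitive encoded without an integral: [g] may be altered on a null set, and products and
    compositions reduce to the pointwise rules of differentiation. *)
Definition rprim f g : Prop :=
  loc_abs_cont f /\ {ae mu, forall z, is_derive z 1 f (g z)}.

Lemma is_derive_step f x d e : is_derive x 1 f d -> 0 < e ->
  exists2 r : R, 0 < r & forall h : R, `|h| < r -> `|f (x + h) - f x - d * h| <= e * `|h|.
Proof.
move=> [df dfE] e0.
have : (fun h => h^-1 *: (f (h + x) - f x)) @ 0^' --> d.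
  move/cvg_ex : df => [l Hl]; have := Hl.
  rewrite -dfE /derive (cvg_lim _ Hl)//.
  by under eq_fun do rewrite /= /GRing.scale /= mulr1.
move=> /cvgrPdist_le /(_ _ e0)[r /= r0 Hr]; exists r => // h hr.
have [->|h0] := eqVneq h 0; first by rewrite addr0 subrr mulr0 subr0 normr0 mulr0.
have := Hr h; rewrite /ball_ /= sub0r normrN => /(_ hr h0) {}Hr.
rewrite [x + h]addrC (_ : f (h + x) - f x - d * h =
  - ((d - h^-1 *: (f (h + x) - f x)) * h)); last first.
  by rewrite /GRing.scale /=; field.
by rewrite normrN normrM ler_wpM2r.
Qed.

Lemma loc_abs_contP f x : loc_abs_cont f -> {for x, continuous f}.
Proof.
move=> acf; apply/cvgrPdist_lt => e e0.
have x12 : x - 1 < x + 1 by lra.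
have [d d0 Hd] := acf _ _ x12 _ e0.
have d1 : 0 < Num.min d 1 by rewrite lt_min d0 ltr01.
exists (Num.min d 1) => //= y; rewrite /ball_ /= lt_min => /andP[xyd xy1].
pose l (i : 'I_1) := Num.min x y; pose r (i : 'I_1) := Num.max x y.
have H : `|f (r ord0) - f (l ord0)| < e.
  have := Hd 1%N l r; rewrite !big_ord1; apply.
  - by move=> k; rewrite /l /r; move: xy1; rewrite ltr_norml; case: (leP x y); split; lra.
  - by move=> k m; rewrite !ord1 eqxx.
  - by rewrite /l /r; move: xyd; rewrite ltr_norml; case: (leP x y); lra.
by move: H; rewrite /l /r; case: (leP x y) => _ //; rewrite distrC.
Qed.

Section Chain.
Variables (f : R -> R) (a b e : R) (O : set R).
Hypotheses (ab : a <= b) (e0 : 0 <= e) (oO : open O).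
Hypothesis step : forall x, a <= x <= b ->
  O x \/ exists2 r : R, 0 < r & forall h : R, `|h| < r ->
    (0 <= h -> f (x + h) - f x <= e * h) /\ (h <= 0 -> f x - f (x + h) <= e * - h).

Let link y x := `]y, x] `<=` O \/ f x - f y <= e * (x - y).

(** [s] records the steps made inside [O], the latest at the head. Measuring [O] only within []a,
    x]] leaves room for the length of the next step. *)
Let inv (s : seq (R * R)) x := [/\ all (fun p => (a <= p.1) && (p.1 <= p.2) && (p.2 <= x)) s,
  pairwise (fun p q : R * R => q.2 <= p.1) s,
  ((\sum_(p <- s) (p.2 - p.1))%:E <= mu (O `&` `]a, x]))%E &
  f x - f a <= \sum_(p <- s) `|f p.2 - f p.1| + e * (x - a)].

Let S := [set x | a <= x <= b /\ exists s, inv s x].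

Let mOI y x : measurable (O `&` `]y, x]).
Proof. by apply: measurableI => //; exact: open_measurable. Qed.

Let muOI y x : a <= y -> y <= x ->
  (mu (O `&` `]a, x]) = mu (O `&` `]a, y]) + mu (O `&` `]y, x]))%E.
Proof.
move=> ay yx; rewrite -measureU//; [|exact: mOI|exact: mOI|].
- congr (mu _); rewrite -setIUr; congr (_ `&` _).
  by rewrite (@itv_bndbnd_setU _ _ _ (BRight y)) // bnd_simp.
- rewrite setIACA setIid (_ : `]a, y]%classic `&` `]y, x]%classic = set0) ?setI0//.
  by apply/seteqP; split=> // t /=; rewrite !in_itv/= => -[/andP[_ ty] /andP[yt _]]; move: (lt_le_trans yt ty); rewrite ltxx.
Qed.

Let S_link y x : S y -> y <= x -> x <= b -> link y x -> S x.
Proof.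
move=> [/andP[ay yb] [s [s1 s2 s3 s4]]] yx xb lk; split; first by rewrite (le_trans ay yx).
have s1' : all (fun p => (a <= p.1) && (p.1 <= p.2) && (p.2 <= x)) s.
  by apply: sub_all s1 => p /andP[-> /le_trans]; apply.
case: lk => lk.
- exists ((y, x) :: s); split => /=.
  + by rewrite ay yx lexx s1'.
  + by rewrite s2 andbT; apply: sub_all s1 => p /andP[].
  + rewrite big_cons /= EFinD (muOI ay yx) addeC; apply: leeD => //.
    rewrite (setIidr lk).
    rewrite lebesgue_measure_itv/= lte_fin; case: ltP => // xy.
    by rewrite lee_fin subr_le0.
  + rewrite big_cons /=.
    have := ler_norm (f x - f y).
    have : e * (y - a) <= e * (x - a) by rewrite ler_wpM2l// lerD2r.
    lra.
- exists s; split => //.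
  + apply: (le_trans s3); apply: le_measure; rewrite ?inE; [exact: mOI|exact: mOI|].
    by apply: setIS; apply: subset_itvl; rewrite bnd_simp.
  + lra.
Qed.

Let Sa : S a.
Proof.
split; first by rewrite lexx.
exists [::]; split => //; first by rewrite big_nil measure_ge0.
by rewrite big_nil !subrr mulr0 addr0.
Qed.

Let S_ub : has_ubound S.
Proof. by exists b => x [/andP[]]. Qed.

Let S_sup : has_sup S.
Proof. by split; [exists a; exact: Sa|exact: S_ub]. Qed.

Let c := sup S.

Let ac : a <= c.
Proof. by apply: ub_le_sup => //; exact: Sa. Qed.

Let cb : c <= b.
Proof. by apply: ge_sup; [exists a; exact: Sa|move=> x [/andP[]]]. Qed.

Let link_near : exists2 r : R, 0 < r & forall y, a <= y <= b -> `|y - c| < r ->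
  (y <= c -> link y c) /\ (c <= y -> link c y).
Proof.
have acb : a <= c <= b by rewrite ac cb.
have [Oc|[r r0 Hr]] := step acb.
  have : nbhs c O by apply: open_nbhs_nbhs.
  move=> [r /= r0 Hr]; exists r => // y yab yc; split=> h; left => t /=; rewrite in_itv/= => /andP[t1 t2];
    apply: Hr; rewrite /ball_/= ltr_norml; move: yc; rewrite ltr_norml; lra.
exists r => // y yab yc; split=> h; right.
- have [_] := Hr _ yc; rewrite [c + _]addrC subrK => /(_ _); rewrite opprB; apply.
  by rewrite subr_le0.
- by have [+ _] := Hr _ yc; rewrite [c + _]addrC subrK; apply; rewrite subr_ge0.
Qed.

Let Sb : S b.
Proof.
have [r r0 Hr] := link_near.
have Sc : S c.
  have [y Sy cy] := sup_adherent r0 S_sup.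
  have yc : y <= c by exact: ub_le_sup.
  have [yab _] := Sy.
  apply: (S_link Sy) => //; apply: (proj1 (Hr y yab _)) => //.
  by rewrite ltr_norml; rewrite -/c in cy; lra.
have [<-//|cnb] := eqVneq c b.
have cb' : c < b by rewrite lt_neqAle cnb.
pose y := Num.min b (c + r / 2).
have cy : c < y by rewrite lt_min cb' ltrDl divr_gt0.
have yb : y <= b by rewrite ge_min lexx.
have ycr : y <= c + r / 2 by rewrite ge_min lexx orbT.
have Sy : S y.
  apply: (S_link Sc) => //; first exact: ltW.
  apply: (proj2 (Hr y _ _)); last exact: ltW.
    by rewrite yb (le_trans ac (ltW cy)).
  rewrite ltr_norml; lra.
by have := ub_le_sup S_ub Sy; rewrite leNgt cy.
Qed.

(** Continuous induction: the set [S] of points reached by a chain contains [a], and links exist on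
    both sides near its supremum, so the supremum belongs to [S] and equals [b]. A link inside [O]
    is recorded with its full variation; any other link has slope at most [e]. *)
Lemma chain_exists : exists n (l r : 'I_n -> R),
  [/\ forall k, [/\ a <= l k, l k <= r k & r k <= b],
      forall k m, k != m -> r k <= l m \/ r m <= l k,
      ((\sum_(k < n) (r k - l k))%:E <= mu O)%E &
      f b - f a <= \sum_(k < n) `|f (r k) - f (l k)| + e * (b - a)].
Proof.
have [_ [s [s1 s2 s3 s4]]] := Sb.
exists (size s), (fun k => (nth (0, 0) s k).1), (fun k => (nth (0, 0) s k).2); split.
- by move=> k; move/all_nthP : s1 => /(_ (0, 0) k (ltn_ord k)) /andP[/andP[-> ->] ->].
- move/(pairwiseP (0, 0)) : s2 => s2 k m km.
  have [h|h] := ltnP k m; first by right; apply: s2 => //; rewrite inE ltn_ord.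
  by left; apply: s2; rewrite ?inE ?ltn_ord// ltn_neqAle h andbT eq_sym.
- apply: (@le_trans _ _ (mu (O `&` `]a, b]))).
    by move: s3; rewrite (big_nth (0, 0)) big_mkord.
  apply: le_measure; rewrite ?inE; [exact: mOI|exact: open_measurable|exact: subIsetl].
- by move: s4; rewrite (big_nth (0, 0)) big_mkord.
Qed.

End Chain.

(** Stands in for the fundamental theorem of calculus. The exceptional null set is covered by an
    open [V] so small that, by absolute continuity, the variation of [f] over disjoint intervals of
    that total length is below [e / 2]. At every other point [f] grows locally with slope at most
    [eta], which contributes at most another [e / 2] along [[a, b]]. *)
Lemma rprim_le f g a b : rprim f g -> a <= b ->
  {ae mu, forall z, a <= z <= b -> g z <= 0} -> f b <= f a.
Proof.
move=> [acf df] ab g0.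
have [->//|anb] := eqVneq a b.
have {anb}ab' : a < b by rewrite lt_neqAle anb.
apply/ler_addgt0Pr => e e0.
have e20 : 0 < e / 2 by rewrite divr_gt0.
have [d d0 Hd] := acf _ _ ab' _ e20.
pose N := ~` [set z : R | is_derive z (1 : R) f (g z) /\ (a <= z <= b -> g z <= 0)].
have N0 : mu.-negligible N.
  exact: (aeI df g0).
have d20 : 0 < d / 2 by rewrite divr_gt0.
have [V [oV NV]] := outer_measure_open_le N d20.
rewrite (proj1 (negligible_outer_measure N) N0) add0e => muV.
pose eta := e / 2 / (b - a).
have eta0 : 0 < eta by rewrite divr_gt0// subr_gt0.
have [x axb|n [l [r [H1 H2 H3 H4]]]] := @chain_exists f a b eta V ab (ltW eta0) oV.
- have [Nx|] := pselect (N x); first by left; exact: NV.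
  rewrite /N /setC /= notK => -[dfx /(_ axb) gx0]; right.
  have [r r0 Hr] := is_derive_step dfx eta0; exists r => // h hr.
  have := Hr _ hr; rewrite ler_norml => /andP[H1 H2]; split=> h0.
  + rewrite ger0_norm// in H1 H2.
    have : g x * h <= 0 by rewrite mulr_le0_ge0.
    lra.
  + rewrite ler0_norm// in H1 H2.
    have : 0 <= g x * h by rewrite mulr_le0.
    lra.
- have : \sum_(k < n) `|f (r k) - f (l k)| < e / 2.
    apply: Hd => //; have := le_trans H3 muV.
    by rewrite lee_fin => /le_lt_trans; apply; lra.
  have : eta * (b - a) = e / 2 by rewrite /eta; field; lra.
  lra.
Qed.

End AbsCont.

(** * Closure properties of primitives *)

Section RprimAlgebra.
Variable R : realType.
Implicit Types (f g h : R -> R) (a b c x y z : R).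
Notation mu := (@lebesgue_measure R).

Lemma continuous_itv_bounded f a b : continuous f ->
  exists2 M, 0 <= M & forall x, a <= x <= b -> `|f x| <= M.
Proof.
move=> cf; have [ab|ba] := leP a b; last first.
  by exists 0 => // x /andP[ax xb]; move: (le_trans ax xb); rewrite leNgt ba.
have [|c _ Hc] := @EVT_max R (fun x => `|f x|) a b ab.
  by apply: continuous_subspaceT => x; apply: continuous_comp; [exact: cf|exact: norm_continuous].
exists `|f c| => // x axb; apply: Hc; by rewrite in_itv.
Qed.

Lemma rprim_continuous f g : rprim f g -> continuous f.
Proof. by move=> [/loc_abs_contP]. Qed.

(** Common source of the closure under sums, products and smooth compositions. *)
Lemma loc_abs_cont_dom f g h : loc_abs_cont g -> loc_abs_cont h ->
  (forall a b, a < b -> exists2 C, 0 <= C & forall x y, a <= x <= b -> a <= y <= b ->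
     `|f x - f y| <= C * (`|g x - g y| + `|h x - h y|)) ->
  loc_abs_cont f.
Proof.
move=> acg ach H a b ab e e0; have [C C0 HC] := H _ _ ab.
pose e' := e / 2 / (C + 1).
have e'0 : 0 < e' by rewrite !divr_gt0// ltr_wpDl.
have [d1 d10 H1] := acg _ _ ab _ e'0; have [d2 d20 H2] := ach _ _ ab _ e'0.
exists (Num.min d1 d2); first by rewrite lt_min d10.
move=> n l r lr dis; rewrite lt_min => /andP[s1 s2].
have {}H1 := H1 n l r lr dis s1; have {}H2 := H2 n l r lr dis s2.
apply: (@le_lt_trans _ _ (C * (\sum_(k < n) `|g (r k) - g (l k)| + \sum_(k < n) `|h (r k) - h (l k)|))).
  rewrite -big_split /= mulr_sumr; apply: ler_sum => k _.
  by have [h1 h2 h3] := lr k; apply: HC; rewrite ?h3 ?h1 ?(le_trans h1 h2) ?(le_trans h2 h3).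
have Ce : (C + 1) * e' = e / 2 by rewrite /e'; field; rewrite gt_eqF// ltr_wpDl.
set A := \sum_(k < n) _ in H1 *; set B := \sum_(k < n) _ in H2 *.
have A0 : 0 <= A by apply: sumr_ge0.
have B0 : 0 <= B by apply: sumr_ge0.
have : C * (A + B) <= C * (e' + e') by rewrite ler_wpM2l// lerD// ltW.
lra.
Qed.

Lemma rprim_ae f g h : rprim f g -> {ae mu, forall z, g z = h z} -> rprim f h.
Proof.
by move=> [acf df] gh; split => //; apply: aeW (aeI df gh) => z [+ <-].
Qed.

Lemma rprim_cst c : rprim (fun=> c) (fun=> 0).
Proof.
split; last by apply: aeE => z; exact: is_derive_cst.
move=> a b ab e e0; exists 1 => // n l r _ _ _.
by rewrite big1 // => k _; rewrite subrr normr0.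
Qed.

Lemma rprim_id : rprim (fun x => x) (fun=> 1).
Proof.
split; last by apply: aeE => z; exact: is_derive_id.
move=> a b ab e e0; exists e => // n l r lr _.
apply: le_lt_trans; apply: ler_sum => k _.
by have [_ h _] := lr k; rewrite ger0_norm// subr_ge0.
Qed.

Lemma rprimD f f' g g' : rprim f f' -> rprim g g' ->
  rprim (fun x => f x + g x) (fun x => f' x + g' x).
Proof.
move=> [acf df] [acg dg]; split.
  apply: (loc_abs_cont_dom acf acg) => a b _; exists 1 => // x y _ _.
  by rewrite mul1r [f x + _ - _](_ : _ = (f x - f y) + (g x - g y)) ?ler_normD//; ring.
by apply: aeW (aeI df dg) => z [h1 h2]; exact: is_deriveD.
Qed.

Lemma rprimM f f' g g' : rprim f f' -> rprim g g' ->
  rprim (fun x => f x * g x) (fun x => f' x * g x + f x * g' x).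
Proof.
move=> pf pg; have [acf df] := pf; have [acg dg] := pg; split.
  apply: (loc_abs_cont_dom acf acg) => a b _.
  have [M1 M10 H1] := continuous_itv_bounded a b (rprim_continuous pf).
  have [M2 M20 H2] := continuous_itv_bounded a b (rprim_continuous pg).
  exists (M1 + M2); first exact: addr_ge0.
  move=> x y xab yab.
  rewrite [f x * _ - _](_ : _ = (f x - f y) * g x + f y * (g x - g y)); last by ring.
  apply: (le_trans (ler_normD _ _)); rewrite !normrM.
  have := H1 _ yab; have := H2 _ xab => h2 h1.
  have : `|f x - f y| * `|g x| <= `|f x - f y| * M2 by rewrite ler_wpM2l.
  have : `|f y| * `|g x - g y| <= M1 * `|g x - g y| by rewrite ler_wpM2r.
  have : 0 <= M1 * `|f x - f y| by rewrite mulr_ge0.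
  have : 0 <= M2 * `|g x - g y| by rewrite mulr_ge0.
  lra.
apply: aeW (aeI df dg) => z [h1 h2].
apply: (@is_derive_eq _ _ _ _ _ _ _ _ (is_deriveM h1 h2)).
by rewrite /GRing.scale /=; ring.
Qed.

Lemma rprimZ c f g : rprim f g -> rprim (fun x => c * f x) (fun x => c * g x).
Proof.
move=> pf; apply: rprim_ae (rprimM (rprim_cst c) pf) _.
by apply: aeE => z; rewrite mul0r add0r.
Qed.

Lemma rprimN f g : rprim f g -> rprim (fun x => - f x) (fun x => - g x).
Proof.
move=> pf; have := rprimZ (- 1) pf.
by under eq_fun do rewrite mulN1r; under [X in rprim _ X]eq_fun do rewrite mulN1r.
Qed.

Lemma rprimB f f' g g' : rprim f f' -> rprim g g' ->
  rprim (fun x => f x - g x) (fun x => f' x - g' x).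
Proof. by move=> pf /rprimN; apply: rprimD. Qed.

Lemma rprim_comp (phi dphi : R -> R) f g : (forall x, is_derive x 1 phi (dphi x)) ->
  continuous dphi -> rprim f g ->
  rprim (fun x => phi (f x)) (fun x => dphi (f x) * g x).
Proof.
move=> dp cdp pf; have [acf df] := pf; split; last first.
  by apply: aeW df => z h; exact: is_derive1_comp.
apply: (loc_abs_cont_dom acf acf) => a b _.
have [M M0 HM] := continuous_itv_bounded a b (rprim_continuous pf).
have [C C0 HC] := continuous_itv_bounded (- M) M cdp.
exists C => // x y xab yab.
(* The range of [f] over [[a, b]] lies in [[- M, M]], where the mean value theorem makes [phi]
   Lipschitz. *)
have lip s t : - M <= s <= M -> - M <= t <= M -> `|phi s - phi t| <= C * `|s - t|.
  wlog st : s t / t <= s.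
    by move=> W sM tM; case: (leP t s) => st; [|rewrite distrC [`|s - t|]distrC]; apply: W => //; exact: ltW.
  move=> sM tM; have [|c + ->] := @MVT_segment R phi dphi t s st (fun x _ => dp x).
    by apply: continuous_subspaceT => u; exact/differentiable_continuous/derivable1_diffP/ex_derive.
  rewrite in_itv /= => /andP[tc cs]; rewrite normrM ler_wpM2r//; apply: HC; lra.
have := lip (f x) (f y); rewrite -!ler_norml => /(_ (HM _ xab) (HM _ yab)) /le_trans; apply.
by rewrite ler_wpM2l// lerDl.
Qed.

Lemma rprim_expR f g : rprim f g -> rprim (fun x => expR (f x)) (fun x => expR (f x) * g x).
Proof.
apply: (@rprim_comp expR expR); exact: continuous_expR.
Qed.

Lemma rprim_cos f g : rprim f g -> rprim (fun x => cos (f x)) (fun x => - sin (f x) * g x).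
Proof.
apply: (@rprim_comp cos (fun x => - sin x)).
by move=> x; apply: continuousN; exact: continuous_sin.
Qed.

Lemma rprim_sin f g : rprim f g -> rprim (fun x => sin (f x)) (fun x => cos (f x) * g x).
Proof.
apply: (@rprim_comp sin cos); exact: continuous_cos.
Qed.

Lemma rprim_ge f g a b : rprim f g -> a <= b ->
  {ae mu, forall z, a <= z <= b -> 0 <= g z} -> f a <= f b.
Proof.
move=> /rprimN pf ab g0; rewrite -lerN2; apply: (rprim_le pf ab).
by apply: aeW g0 => z H /H; rewrite oppr_le0.
Qed.

Lemma rprim_const f g : rprim f g -> {ae mu, forall z, g z = 0} -> forall a b, f a = f b.
Proof.
move=> pf g0 a b; wlog ab : a b / a <= b.
  by move=> W; case: (leP a b) => [/W//|/ltW/W].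
apply/eqP; rewrite eq_le; apply/andP; split.
  by apply: (rprim_ge pf ab); apply: aeW g0 => z -> _.
by apply: (rprim_le pf ab); apply: aeW g0 => z -> _.
Qed.

End RprimAlgebra.

(** * Translation invariance and periodic functions *)

Section LebesgueShift.
Variable R : realType.
Implicit Types (f g : R -> R) (a b c x y z : R).
Notation mu := (@lebesgue_measure R).

Let measurable_shift c : measurable_fun [set: measurableTypeR R] (fun x : measurableTypeR R => x + c).
Proof. by apply: measurable_funD; [exact: measurable_id|exact: measurable_cst]. Qed.

Lemma lebesgue_measure_shift c (A : set R) : measurable A ->
  mu [set x | A (x + c)] = mu A.
Proof.
move=> mA; apply/esym.
apply: (@lebesgue_measure_unique R (pushforward mu (fun x : measurableTypeR R => x + c : measurableTypeR R))) => //.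
  exact: measurable_shift.
move=> mphi X /ocitvP [->|[[a b] /= ab ->]].
  by rewrite !measure0.
rewrite /= /pushforward.
rewrite (_ : _ @^-1` _ = `]a - c, b - c]%classic); last first.
  by apply/seteqP; split => x /=; rewrite !in_itv/= ltrBlDr lerBrDr.
rewrite !lebesgue_measure_itv/= !lte_fin ltrD2r; case: ifP => // _.
by rewrite -!EFinB; congr (_%:E); ring.
Qed.

Lemma ae_shift c (P : set R) : {ae mu, forall x, P x} -> {ae mu, forall x, P (x + c)}.
Proof.
move=> [A [mA A0 PA]]; exists [set x | A (x + c)]; split.
- by rewrite -[X in measurable X]setTI; exact: measurable_shift.
- by rewrite lebesgue_measure_shift.
- by move=> x /= nP; exact: PA.
Qed.

Lemma rprim_shift c f g : rprim f g -> rprim (fun x => f (x + c)) (fun x => g (x + c)).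
Proof.
move=> [acf df]; split.
  move=> a b ab e e0.
  have acbc : a + c < b + c by rewrite ltrD2r.
  have [d d0 Hd] := acf _ _ acbc _ e0.
  exists d => // n l r lr dis s; apply: (Hd n (fun k => l k + c) (fun k => r k + c)).
  - by move=> k; have [? ? ?] := lr k; rewrite !lerD2r.
  - by move=> k m /dis; rewrite !lerD2r.
  - by under eq_bigr do rewrite opprD addrACA subrr addr0.
apply: aeW (ae_shift c df) => z h.
have := @is_derive1_comp R f (shift c) z (g (z + c)) 1 h (is_derive_shift z 1 c).
by rewrite mulr1.
Qed.

Lemma integrable_shift c (D : set R) g : measurable D -> mu.-integrable D (EFin \o g) ->
  mu.-integrable [set x | D (x + c)] (EFin \o (fun x => g (x + c))).
Proof.
move=> mD /integrableP[mg ig].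
have mD' : measurable [set x | D (x + c)].
  by rewrite -[X in measurable X]setTI; exact: measurable_shift.
apply/integrableP; split.
  apply: (measurable_comp mD _ mg).
    by move=> _ [x Dx <-].
  by apply: (measurable_funS measurableT) => //; exact: measurable_shift.
apply: le_lt_trans ig.
pose phi (x : measurableTypeR R) : measurableTypeR R := x + c.
rewrite (_ : [set x | D (x + c)] = phi @^-1` D)//.
rewrite -(@ge0_integral_pushforward _ _ _ _ _ phi (measurable_shift c) mu D (fun x => `|(g x)%:E|)%E)//=; last 1 first.
  apply/measurable_EFinP/measurableT_comp => //; exact/measurable_EFinP.
rewrite le_eqVlt; apply/orP; left; apply/eqP.
apply: eq_measure_integral; first exact: measurable_shift.
move=> mphi A mA _; exact: (lebesgue_measure_shift c mA).
Qed.

Definition loc_integrable g := forall a b, mu.-integrable `[a, b] (EFin \o g).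

Lemma loc_integrable_periodic c g : 0 < c -> (forall x, g (x + c) = g x) ->
  mu.-integrable `[0, c[ (EFin \o g) -> loc_integrable g.
Proof.
move=> c0 gc ig.
have gnc n x : g (x + c *+ n) = g x.
  by elim: n x => [|n IH] x; rewrite ?mulr0n ?addr0// mulrS addrA IH gc.
have gnc' n x : g (x - c *+ n) = g x by rewrite -(gnc n (x - c *+ n)) subrK.
have int_piece n : mu.-integrable `[c *+ n, c *+ n.+1[ (EFin \o g).
  have := integrable_shift (- (c *+ n)) _ ig => /(_ (measurable_itv _)).
  have -> : [set x | `[0, c[%classic (x - c *+ n)] = `[c *+ n, c *+ n.+1[%classic.
    by apply/seteqP; split => x /=; rewrite !in_itv/= subr_ge0 ltrBlDr -mulrS.
  by under [X in _.-integrable _ (_ \o X)]eq_fun do rewrite gnc'.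
have int_n n : mu.-integrable `[0, c *+ n[ (EFin \o g).
  elim: n => [|n IH].
    by rewrite mulr0n set_itvE; exact: integrable_set0.
  have /integrableP[m1 i1] := IH; have /integrableP[m2 i2] := int_piece n.
  have le1 : 0 <= c *+ n by rewrite mulrn_wge0// ltW.
  have le2 : c *+ n <= c *+ n.+1 by rewrite mulrS lerDr ltW.
  have e : `[0, c *+ n.+1[%classic = `[0, c *+ n[%classic `|` `[c *+ n, c *+ n.+1[%classic.
    by rewrite (@itv_bndbnd_setU _ _ _ (BLeft (c *+ n))) // bnd_simp.
  have mU : measurable_fun (`[0, c *+ n[%classic `|` `[c *+ n, c *+ n.+1[%classic) (EFin \o g).
    by apply/measurable_funU.
  rewrite e; apply/integrableP; split => //.
  rewrite ge0_integral_setU//.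
  - by rewrite lte_add_pinfty.
  - exact: measurableT_comp.
  - by apply/disj_setPS => x [/=]; rewrite !in_itv/= => /andP[_ +] /andP[]; rewrite leNgt => ->.
move=> a b.
have arch t : exists n, t < c *+ n.
  exists (Num.Def.archi_bound `|t / c|).
  have := archi_boundP (normr_ge0 (t / c)).
  by move=> /(le_lt_trans (ler_norm _)); rewrite ltr_pdivrMr// mulrC mulr_natr.
(* Integrability is assembled on [[0, c m[] only: [n] periods carry [[a, b]] to the right of 0, and
   [m] periods bound the result. *)
have [n na] := arch (- a); have [m bm] := arch (b + c *+ n).
have := integrable_shift (c *+ n) (measurable_itv _) (int_n m).
under [X in _.-integrable _ (_ \o X)]eq_fun do rewrite gnc.
apply: integrableS => //.
- by rewrite -[X in measurable X]setTI; apply: measurable_shift.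
- move=> x /=; rewrite !in_itv/= => /andP[ax xb]; apply/andP; split; lra.
Qed.

End LebesgueShift.

(** * The oriented integral as a primitive *)

Section Primitive.
Variable R : realType.
Implicit Types (f g : R -> R) (a b c x y z : R).
Notation mu := (@lebesgue_measure R).

Lemma continuous_loc_integrable g : continuous g -> loc_integrable g.
Proof.
move=> cg a b; apply: continuous_compact_integrable; first exact: segment_compact.
exact: continuous_subspaceT.
Qed.

Lemma eq_loc_integrable f g : f =1 g -> loc_integrable f -> loc_integrable g.
Proof. by move=> /funext ->. Qed.

Lemma loc_integrableD f g : loc_integrable f -> loc_integrable g ->
  loc_integrable (fun x => f x + g x).
Proof. by move=> hf hg a b; exact: (integrableD _ (hf a b) (hg a b)). Qed.

Lemma loc_integrableZ c f : loc_integrable f -> loc_integrable (fun x => c * f x).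
Proof. by move=> hf a b; exact: (integrableZl _ _ (hf a b)). Qed.

Lemma loc_integrable_norm f : loc_integrable f -> loc_integrable (fun x => `|f x|).
Proof. by move=> hf a b; exact: (integrable_norm (hf a b)). Qed.

Lemma loc_integrable_cst c : loc_integrable (fun=> c).
Proof. by apply: continuous_loc_integrable => x; exact: cvg_cst. Qed.

Lemma loc_integrable_locally g : loc_integrable g -> locally_integrable setT g.
Proof.
move=> ig; split; [|exact: openT|].
- have -> : [set: R] = \bigcup_n `[- n%:R, n%:R]%classic.
    apply/seteqP; split=> // x _; exists (Num.Def.archi_bound `|x|) => //=.
    rewrite in_itv/= -ler_norml; apply/ltW/archi_boundP/normr_ge0.
  apply/measurable_fun_bigcup => // n.
  by have /integrableP[/measurable_EFinP] := ig (- n%:R) n%:R.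
- move=> K _ cK.
  have [M [_ HM]] := compact_bounded cK.
  pose M' := `|M| + 1.
  have KM : K `<=` `[- M', M'].
    move=> x Kx; have /HM : M < M' by rewrite /M' (le_lt_trans (ler_norm M))// ltrDl.
    by move=> /(_ x Kx); rewrite /= ler_norml in_itv.
  have /integrableP[mg ig'] := ig (- M') M'.
  apply: le_lt_trans ig'; apply: ge0_subset_integral => //.
  - exact: compact_measurable.
  - by apply/measurable_EFinP/measurableT_comp => //; exact/measurable_EFinP.
Qed.

Let RintegralB_oc g a z w : loc_integrable g -> a <= z -> z <= w ->
  \int[mu]_(t in `[a, w]) g t - \int[mu]_(t in `[a, z]) g t = \int[mu]_(t in `]z, w]) g t.
Proof. by move=> ig az zw; apply: Rintegral_itvB; rewrite ?bnd_simp. Qed.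

Lemma ointE g a c z : loc_integrable g -> a <= c -> a <= z ->
  oint c z g = \int[mu]_(t in `[a, z]) g t - \int[mu]_(t in `[a, c]) g t.
Proof.
move=> ig ac az; rewrite /oint; case: leP => cz.
  rewrite RintegralB_oc// Rintegral_itv_obnd_cbnd//; apply: integrableS (ig c z) => //.
  by apply: subset_itvr; rewrite bnd_simp.
rewrite -(Rintegral_itv_obnd_cbnd (r := z)); last first.
  apply: integrableS (ig z c) => //.
  by apply: subset_itvr; rewrite bnd_simp.
by rewrite -(RintegralB_oc ig az) ?opprB//; exact: ltW.
Qed.

Lemma ointB g c x y : loc_integrable g -> x <= y ->
  oint c y g - oint c x g = \int[mu]_(t in `]x, y]) g t.
Proof.
move=> ig xy; pose a := Num.min c x.
have ac : a <= c by rewrite ge_min lexx.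
have ax : a <= x by rewrite ge_min lexx orbT.
rewrite (ointE ig ac (le_trans ax xy)) (ointE ig ac ax) -(RintegralB_oc ig ax)//; ring.
Qed.

(** Absolute continuity of the integral, applied to the union of the given disjoint intervals and to
    [g] cut off outside [[a, b]], gives the first half. Lebesgue's differentiation theorem gives the
    second. *)
Lemma rprim_oint c g : loc_integrable g -> rprim (fun z => oint c z g) g.
Proof.
move=> ig; split.
  move=> a b ab e e0.
  pose h := g \_ `[a, b].
  have ih : mu.-integrable setT (EFin \o h).
    by rewrite -restrict_EFin; apply/integrable_restrict => //=; rewrite setTI.
  have [d [d0 Hd]] := integral_normr_continuous ih e0; exists d => // n l r lr dis s.
  have oE k : `|oint c (r k) g - oint c (l k) g| <= \int[mu]_(t in `]l k, r k]) `|h t|.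
    have [h1 h2 h3] := lr k.
    rewrite ointB// (_ : \int[mu]_(t in `]l k, r k]) g t = \int[mu]_(t in `]l k, r k]) h t).
      apply: le_normr_Rintegral => //.
      exact: integrableS ih.
    apply: eq_Rintegral => t; rewrite inE/= in_itv/= => /andP[t1 t2].
    rewrite /h patchE ifT// inE/= in_itv/=; apply/andP; split; [exact: le_trans h1 (ltW t1)|exact: le_trans t2 h3].
  apply: le_lt_trans (ler_sum _ (fun k _ => oE k)) _.
  pose F (k : 'I_n) : set R := `]l k, r k]%classic.
  have tF : trivIset setT F.
    apply/trivIsetP => i j _ _ ij; apply/seteqP; split=> // t []; rewrite /F /= !in_itv/= => /andP[t1 t2] /andP[t3 t4].
    by have [h'|h'] := dis i j ij; [have := le_trans t2 h'|have := le_trans t4 h']; rewrite leNgt ?t3 ?t1.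
  have mF k : measurable (F k) by exact: measurable_itv.
  pose D := \big[setU/set0]_(k <- index_enum 'I_n) F k.
  have mD : measurable D by apply: bigsetU_measurable.
  have muD : (mu D < d%:E)%E.
    rewrite /D measure_bigsetU_ord_cond; [|by move=> i _; exact: mF|by apply: sub_trivIset tF].
    rewrite (eq_bigr (fun k => (r k - l k)%:E)); first by rewrite sumEFin lte_fin.
    move=> k _; have [h1 h2 h3] := lr k; change (mu `]l k, r k]%classic = (r k - l k)%:E); rewrite lebesgue_measure_itv/= lte_fin.
    move: h2; rewrite le_eqVlt => /predU1P[->|->]; last by rewrite EFinB.
    by rewrite ltxx subrr.
  have := Hd D mD muD.
  apply: le_lt_trans; rewrite /Rintegral.
  rewrite (@ge0_integral_bigsetU _ _ _ mu _ F (fun x => `|h x|%:E) _ mF (index_enum_uniq _)) //.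
  - rewrite sum_fine// => k _; apply: integrable_fin_num => //.
    have ihk : mu.-integrable (F k) (EFin \o h).
      by apply: integrableS ih => //; exact: mF.
    exact: (integrable_norm ihk).
  - by apply: sub_trivIset tF.
  - apply/measurable_EFinP/measurableT_comp => //; apply: measurable_funTS.
    by have /integrableP[/measurable_EFinP] := ih.
have := lebesgue_differentiation (loc_integrable_locally ig).
apply: aeW => x Lx.
(* A base point strictly to the left of both [c] and [x] covers the two orientations of [oint] near
   [x] at once. *)
pose a := Num.min c x - 1.
have ac : a < c.
  rewrite /a; have : Num.min c x <= c by rewrite ge_min lexx.
  lra.
have ax : a < x.
  rewrite /a; have : Num.min c x <= x by rewrite ge_min lexx orbT.
  lra.
have xx1 : x < x + 1 by rewrite ltrDl.
have [dF dFE] := @FTC1_lebesgue_pt R g (BLeft a) x (x + 1) xx1 (ig _ _) ax Lx.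
have D1 : is_derive x (1 : R) (fun z => \int[mu]_(t in `[a, z]) g t - \int[mu]_(t in `[a, c]) g t) (g x).
  rewrite -[X in is_derive _ _ _ X]subr0 -dFE derive1E.
  by apply: is_deriveB; exact: derivableP.
apply: near_eq_is_derive D1.
near=> z.
have az : a < z by near: z; exact: lt_nbhsr.
by rewrite (ointE ig (ltW ac) (ltW az)).
Unshelve. all: by end_near. Qed.

End Primitive.

(** * Complex-valued primitives *)

Section ComplexFacts.
Variable R : realType.
Implicit Types (x y z w : R[i]) (a b : R).

Local Notation Re := complex.Re.
Local Notation Im := complex.Im.
Local Notation nm := (@ComplexField.Normc.normc R).

Lemma ReD x y : Re (x + y) = Re x + Re y. Proof. by case: x y => [? ?] []. Qed.
Lemma ImD x y : Im (x + y) = Im x + Im y. Proof. by case: x y => [? ?] []. Qed.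
Lemma ReN x : Re (- x) = - Re x. Proof. by case: x. Qed.
Lemma ImN x : Im (- x) = - Im x. Proof. by case: x. Qed.
Lemma ReM x y : Re (x * y) = Re x * Re y - Im x * Im y.
Proof. by case: x y => [? ?] []. Qed.
Lemma ImM x y : Im (x * y) = Re x * Im y + Im x * Re y.
Proof. by case: x y => [? ?] []. Qed.
Lemma ReJ x : Re x^*%C = Re x. Proof. by case: x. Qed.
Lemma ImJ x : Im x^*%C = - Im x. Proof. by case: x. Qed.

Definition cE := (ReD, ImD, ReN, ImN, ReM, ImM, ReJ, ImJ).

Lemma complex_eq x y : Re x = Re y -> Im x = Im y -> x = y.
Proof. by case: x y => [? ?] [? ?] /= -> ->. Qed.

Lemma sqr_nm x : nm x ^+ 2 = Re x ^+ 2 + Im x ^+ 2.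
Proof. by case: x => a b /=; rewrite sqr_sqrtr// addr_ge0// sqr_ge0. Qed.

Lemma nm_ge0 x : 0 <= nm x. Proof. by case: x => a b; exact: sqrtr_ge0. Qed.

Lemma nmM x y : nm (x * y) = nm x * nm y. Proof. exact: ComplexField.Normc.normcM. Qed.

Lemma nmD x y : nm (x + y) <= nm x + nm y. Proof. exact: le_normcD. Qed.

Lemma nmN x : nm (- x) = nm x. Proof. exact: normcN. Qed.

Lemma nm0 : nm 0 = 0. Proof. exact: ComplexField.Normc.normc0. Qed.

Lemma nm1 : nm 1 = 1. Proof. exact: ComplexField.Normc.normc1. Qed.

Lemma nmB x y : nm (x - y) <= nm x + nm y. Proof. by rewrite -(nmN y) nmD. Qed.

Lemma nmBC x y : nm (x - y) = nm (y - x). Proof. by rewrite -nmN opprB. Qed.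

Lemma nm_eq0 x : (nm x == 0) = (x == 0).
Proof. by apply/eqP/eqP => [/ComplexField.Normc.eq0_normc|->]; rewrite ?nm0. Qed.

Lemma nm_gt0 x : (0 < nm x) = (x != 0).
Proof. by rewrite lt_neqAle nm_ge0 andbT eq_sym nm_eq0. Qed.

Lemma nmX x n : nm (x ^+ n) = nm x ^+ n.
Proof. by elim: n => [|n IH]; rewrite ?expr0 ?nm1// !exprS nmM IH. Qed.

Lemma nmV x : nm x^-1 = (nm x)^-1. Proof. exact: ComplexField.Normc.normcV. Qed.

Lemma nmJ x : nm x^*%C = nm x. Proof. by case: x => a b /=; rewrite sqrrN. Qed.

Lemma nmR a : nm a%:C = `|a|.
Proof. by rewrite /= expr0n addr0 sqrtr_sqr. Qed.

Lemma nm_i : nm 'i%C = 1. Proof. by rewrite /= expr0n add0r expr1n sqrtr1. Qed.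

Lemma nm_Re x : `|Re x| <= nm x.
Proof.
by case: x => a b /=; rewrite -sqrtr_sqr ler_wsqrtr// lerDl sqr_ge0.
Qed.

Lemma nm_Im x : `|Im x| <= nm x.
Proof.
by case: x => a b /=; rewrite -sqrtr_sqr ler_wsqrtr// lerDr sqr_ge0.
Qed.

Lemma nm_le_ReIm x : nm x <= `|Re x| + `|Im x|.
Proof.
rewrite -[leLHS]ger0_norm ?nm_ge0// -ler_sqr ?nnegrE ?addr_ge0// ger0_norm ?nm_ge0// sqr_nm.
rewrite -(real_normK (num_real (Re x))) -(real_normK (num_real (Im x))); have := mulr_ge0 (normr_ge0 (Re x)) (normr_ge0 (Im x)).
nra.
Qed.

Lemma nm_norm x : `|x| = (nm x)%:C.
Proof. by case: x => a b; rewrite normc_def. Qed.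

Lemma nm_sum n (F : 'I_n -> R[i]) : nm (\sum_(k < n) F k) <= \sum_(k < n) nm (F k).
Proof.
elim: n F => [|n IH] F; first by rewrite !big_ord0 nm0.
by rewrite !big_ord_recr /=; apply: (le_trans (nmD _ _)); rewrite lerD2r.
Qed.

End ComplexFacts.

Section ComplexPrim.
Variable R : realType.
Implicit Types (f g : R -> R[i]) (a b z : R) (c : R[i]).
Notation mu := (@lebesgue_measure R).

Local Notation Re := complex.Re.
Local Notation Im := complex.Im.
Local Notation nm := (@ComplexField.Normc.normc R).

Definition cprim f g : Prop :=
  rprim (fun t => Re (f t)) (fun t => Re (g t)) /\
  rprim (fun t => Im (f t)) (fun t => Im (g t)).

Lemma eq_rprim (p p' q q' : R -> R) : p =1 p' -> q =1 q' -> rprim p q -> rprim p' q'.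
Proof. by move=> /funext -> /funext ->. Qed.

Lemma cprim_ae f g h : cprim f g -> {ae mu, forall z, g z = h z} -> cprim f h.
Proof.
by move=> [rf jf] gh; split; [apply: rprim_ae rf _|apply: rprim_ae jf _]; apply: aeW gh => z ->.
Qed.

Lemma eq_cprim f f' g g' : f =1 f' -> g =1 g' -> cprim f g -> cprim f' g'.
Proof. by move=> /funext -> /funext ->. Qed.

Lemma cprim_cst c : cprim (fun=> c) (fun=> 0).
Proof. by split; exact: rprim_cst. Qed.

Lemma cprimD f f' g g' : cprim f f' -> cprim g g' ->
  cprim (fun x => f x + g x) (fun x => f' x + g' x).
Proof.
move=> [rf jf] [rg jg]; split.
  by apply: eq_rprim (rprimD rf rg) => t; rewrite !cE.
by apply: eq_rprim (rprimD jf jg) => t; rewrite !cE.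
Qed.

Lemma cprimN f f' : cprim f f' -> cprim (fun x => - f x) (fun x => - f' x).
Proof.
move=> [rf jf]; split.
  by apply: eq_rprim (rprimN rf) => t; rewrite !cE.
by apply: eq_rprim (rprimN jf) => t; rewrite !cE.
Qed.

Lemma cprimB f f' g g' : cprim f f' -> cprim g g' ->
  cprim (fun x => f x - g x) (fun x => f' x - g' x).
Proof. by move=> pf /cprimN; exact: cprimD. Qed.

Lemma cprimM f f' g g' : cprim f f' -> cprim g g' ->
  cprim (fun x => f x * g x) (fun x => f' x * g x + f x * g' x).
Proof.
move=> [rf jf] [rg jg]; split.
  by apply: eq_rprim (rprimB (rprimM rf rg) (rprimM jf jg)) => t; rewrite !cE; ring.
by apply: eq_rprim (rprimD (rprimM rf jg) (rprimM jf rg)) => t; rewrite !cE; ring.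
Qed.

Lemma cprimZ c f f' : cprim f f' -> cprim (fun x => c * f x) (fun x => c * f' x).
Proof. by move=> pf; apply: eq_cprim (cprimM (cprim_cst c) pf) => // t; rewrite mul0r add0r. Qed.

Lemma cprim_conj f f' : cprim f f' -> cprim (fun x => (f x)^*%C) (fun x => (f' x)^*%C).
Proof.
move=> [rf jf]; split.
  by apply: eq_rprim rf => t; rewrite !cE.
by apply: eq_rprim (rprimN jf) => t; rewrite !cE.
Qed.

Lemma cprim_shift d f f' : cprim f f' -> cprim (fun x => f (x + d)) (fun x => f' (x + d)).
Proof. by move=> [rf jf]; split; [exact: (rprim_shift d rf)|exact: (rprim_shift d jf)]. Qed.

Lemma cprim_real (p q : R -> R) : rprim p q -> cprim (fun t => (p t)%:C) (fun t => (q t)%:C).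
Proof. by move=> pq; split => //; exact: rprim_cst. Qed.

Definition cis (x : R) : R[i] := cos x +i* sin x.

Lemma cisD x y : cis (x + y) = cis x * cis y.
Proof. by apply: complex_eq; rewrite !cE /= ?cosD ?sinD//; ring. Qed.

Lemma cis0 : cis 0 = 1. Proof. by rewrite /cis cos0 sin0. Qed.

Lemma nm_cis x : nm (cis x) = 1.
Proof. by rewrite /= cos2Dsin2 sqrtr1. Qed.

Lemma cprim_cis (p q : R -> R) : rprim p q ->
  cprim (fun t => cis (p t)) (fun t => 'i%C * (q t)%:C * cis (p t)).
Proof.
move=> pq; split.
  by apply: eq_rprim (rprim_cos pq) => t //; rewrite !cE /=; ring.
by apply: eq_rprim (rprim_sin pq) => t //; rewrite !cE /=; ring.
Qed.

Lemma cprim_const f f' : cprim f f' -> {ae mu, forall z, f' z = 0} -> forall a b, f a = f b.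
Proof.
move=> [rf jf] f0 a b; apply: complex_eq.
  by apply: (rprim_const rf); apply: aeW f0 => z ->.
by apply: (rprim_const jf); apply: aeW f0 => z ->.
Qed.

Lemma rprim_sqnm f f' : cprim f f' ->
  rprim (fun t => nm (f t) ^+ 2) (fun t => 2 * (Re (f t) * Re (f' t) + Im (f t) * Im (f' t))).
Proof.
move=> [rf jf]; apply: eq_rprim (rprimD (rprimM rf rf) (rprimM jf jf)) => t.
  by rewrite sqr_nm; ring.
by ring.
Qed.

Lemma Re_mul_le c z : Re (c * z%:C) = Re c * z.
Proof. by rewrite !cE /=; ring. Qed.

(** Mean value inequality for complex values: a unimodular factor [u] turns the increment into its
    modulus, and the real inequality applies to [Re (u f) - p]. *)
Lemma cprim_le f f' (p q : R -> R) a b : cprim f f' -> rprim p q -> a <= b ->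
  {ae mu, forall z, a <= z <= b -> nm (f' z) <= q z} -> nm (f b - f a) <= p b - p a.
Proof.
move=> cf pq ab H.
have [->|d0] := eqVneq (f b - f a) 0.
  rewrite nm0 subr_ge0; apply: (rprim_ge pq ab); apply: aeW H => z Hz /Hz.
  exact: le_trans (nm_ge0 _).
move dE : (f b - f a) d0 => d d0.
have nd : 0 < nm d by rewrite nm_gt0.
pose u : R[i] := d^*%C * (nm d)^-1%:C.
have nu : nm u = 1.
  by rewrite nmM nmJ nmR ger0_norm ?invr_ge0 ?nm_ge0// mulfV// gt_eqF.
have Rud : Re (u * d) = nm d.
  have -> : u * d = (d * d^*%C) * (nm d)^-1%:C by rewrite /u; ring.
  rewrite Re_mul_le !cE (_ : _ - _ = nm d ^+ 2); last by rewrite sqr_nm; ring.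
  by field; rewrite gt_eqF.
have [ruf _] := cprimZ u cf.
have := rprim_le (rprimB ruf pq) ab; rewrite lerBlDr => W.
have {}W := W _; rewrite -Rud -dE mulrBr !cE.
suff : Re (u * f b) <= Re (u * f a) - p a + p b by rewrite !cE; lra.
apply: W; apply: aeW H => z Hz /Hz h.
rewrite subr_le0; apply: le_trans h; apply: (le_trans (ler_norm _)).
by apply: (le_trans (nm_Re _)); rewrite nmM nu mul1r.
Qed.

Lemma cprim_continuous f f' : cprim f f' ->
  continuous (fun t => Re (f t)) /\ continuous (fun t => Im (f t)).
Proof. by move=> [rf jf]; split; [exact: rprim_continuous rf|exact: rprim_continuous jf]. Qed.

End ComplexPrim.

(** * Zakharov-Shabat systems *)

Section ZakharovShabat.
Variable R : realType.
Implicit Types (u a b c d : R -> R[i]) (x y z : R) (l : R[i]).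
Notation mu := (@lebesgue_measure R).

Local Notation Re := complex.Re.
Local Notation Im := complex.Im.
Local Notation nm := (@ComplexField.Normc.normc R).

Definition zs u l a b : Prop :=
  cprim a (fun z => - 'i%C * l * a z + u z * b z) /\
  cprim b (fun z => (u z)^*%C * a z + 'i%C * l * b z).

(** A majorant [w] of [|u|] with a known primitive [om], so that estimates involve increments of
    [om] instead of integrals of [|u|]. *)
Definition dominated u (om w : R -> R) : Prop :=
  rprim om w /\ forall z, nm (u z) <= w z.

Lemma zs_lin u l a b c d (s t : R[i]) : zs u l a b -> zs u l c d ->
  zs u l (fun z => s * a z + t * c z) (fun z => s * b z + t * d z).
Proof.
move=> [pa pb] [pc pd]; split.
  by apply: eq_cprim (cprimD (cprimZ s pa) (cprimZ t pc)) => // z; ring.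
by apply: eq_cprim (cprimD (cprimZ s pb) (cprimZ t pd)) => // z; ring.
Qed.

Lemma zs_ae u v l a b : {ae mu, forall z, u z = v z} -> zs u l a b -> zs v l a b.
Proof.
by move=> uv [pa pb]; split; [apply: cprim_ae pa _|apply: cprim_ae pb _]; apply: aeW uv => z ->.
Qed.

Lemma zs_conj u l a b : zs u l a b ->
  zs u l^*%C (fun z => (b z)^*%C) (fun z => (a z)^*%C).
Proof.
move=> [pa pb]; split.
  apply: eq_cprim (cprim_conj pb) => // z.
  by apply: complex_eq; rewrite !cE /=; ring.
apply: eq_cprim (cprim_conj pa) => // z.
by apply: complex_eq; rewrite !cE /=; ring.
Qed.

Lemma zs_shift (s : R) u l a b : zs u l a b ->
  zs (fun z => u (z + s)) l (fun z => a (z + s)) (fun z => b (z + s)).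
Proof. by move=> [pa pb]; split; [exact: (cprim_shift s pa)|exact: (cprim_shift s pb)]. Qed.

Lemma zs_opp u l a b : zs u l a b -> zs (fun z => - u z) l a (fun z => - b z).
Proof.
move=> [pa pb]; split; first by apply: eq_cprim pa => // z; ring.
apply: eq_cprim (cprimN pb) => // z.
by apply: complex_eq; rewrite !cE /=; ring.
Qed.

Lemma cprim_wronskian u l a b c d : zs u l a b -> zs u l c d ->
  forall x y, a x * d x - b x * c x = a y * d y - b y * c y.
Proof.
move=> [pa pb] [pc pd] x y.
apply: (cprim_const (cprimB (cprimM pa pd) (cprimM pb pc))).
by apply: aeE => z; ring.
Qed.

Lemma rprim_energy u l a b : zs u l a b ->
  rprim (fun z => nm (a z) ^+ 2 + nm (b z) ^+ 2)
    (fun z => 2 * Im l * (nm (a z) ^+ 2 - nm (b z) ^+ 2) + 4 * Re ((a z)^*%C * u z * b z)).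
Proof.
move=> [pa pb]; apply: eq_rprim (rprimD (rprim_sqnm pa) (rprim_sqnm pb)) => // z.
by rewrite !sqr_nm !cE /=; ring.
Qed.

(** The potential cancels because the off-diagonal part of the system preserves the indefinite form
    [|a|^2 - |b|^2]. *)
Lemma rprim_defect u l a b : zs u l a b ->
  rprim (fun z => nm (a z) ^+ 2 - nm (b z) ^+ 2)
    (fun z => 2 * Im l * (nm (a z) ^+ 2 + nm (b z) ^+ 2)).
Proof.
move=> [pa pb]; apply: eq_rprim (rprimB (rprim_sqnm pa) (rprim_sqnm pb)) => // z.
by rewrite !sqr_nm !cE /=; ring.
Qed.

Lemma gronwall (n n' q r : R -> R) x y : rprim n n' -> rprim q r -> x <= y ->
  (forall z, n' z <= r z * n z) -> n y <= n x * expR (q y - q x).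
Proof.
move=> pn pq xy H.
have := rprim_le (rprimM pn (rprim_expR (rprimN pq))) xy.
have exq s : expR (- q s) = (expR (q s))^-1 by rewrite expRN.
move=> /(_ (aeE _))/= W.
have {W} : n y * expR (- q y) <= n x * expR (- q x).
  apply: W => z _.
  rewrite (_ : _ + _ = (n' z - r z * n z) * expR (- q z)); last by ring.
  by rewrite mulr_le0_ge0 ?subr_le0 ?expR_ge0.
rewrite expRD !exq => W.
have := ler_wpM2r (expR_ge0 (q y)) W; rewrite mulfVK ?gt_eqF ?expR_gt0//.
by rewrite [expR (q y) * _]mulrC mulrA.
Qed.

Lemma energy_rate u om w l (p q : R[i]) z : dominated u om w ->
  `|2 * Im l * (nm p ^+ 2 - nm q ^+ 2) + 4 * Re (p^*%C * u z * q)| <=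
  (2 * w z + 2 * `|Im l|) * (nm p ^+ 2 + nm q ^+ 2).
Proof.
move=> [_ uw]; apply: (le_trans (ler_normD _ _)).
have h1 : `|2 * Im l * (nm p ^+ 2 - nm q ^+ 2)| <= 2 * `|Im l| * (nm p ^+ 2 + nm q ^+ 2).
  rewrite !normrM ger0_norm//; apply: ler_pM; rewrite ?mulr_ge0 ?normr_ge0//.
  by rewrite ler_norml; have := sqr_ge0 (nm p); have := sqr_ge0 (nm q); lra.
have h2 : `|Re (p^*%C * u z * q)| <= w z * (nm p * nm q).
  apply: (le_trans (nm_Re _)); rewrite !nmM nmJ mulrAC mulrC.
  by rewrite ler_wpM2r ?mulr_ge0 ?nm_ge0.
have h3 : 2 * (nm p * nm q) <= nm p ^+ 2 + nm q ^+ 2.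
  by have := sqr_ge0 (nm p - nm q); rewrite sqrrB; lra.
have w0 : 0 <= w z := le_trans (nm_ge0 _) (uw z).
rewrite [`|4 * _|]normrM (@ger0_norm _ 4)//.
have : w z * (2 * (nm p * nm q)) <= w z * (nm p ^+ 2 + nm q ^+ 2) by rewrite ler_wpM2l.
lra.
Qed.

Lemma energy_le u om w l a b x y : dominated u om w -> zs u l a b -> x <= y ->
  nm (a y) ^+ 2 + nm (b y) ^+ 2 <= (nm (a x) ^+ 2 + nm (b x) ^+ 2) *
    expR (2 * (om y - om x) + 2 * `|Im l| * (y - x)).
Proof.
move=> D Z xy; have [po _] := D.
have pq := rprimD (rprimZ 2 po) (rprimZ (2 * `|Im l|) (rprim_id R)).
rewrite [X in expR X](_ : _ = (2 * om y + 2 * `|Im l| * y) - (2 * om x + 2 * `|Im l| * x)); last by ring.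
apply: (gronwall (rprim_energy Z) pq xy) => z.
rewrite mulr1; apply: le_trans (ler_norm _) _; exact: energy_rate D.
Qed.

Lemma energy_ge u om w l a b x y : dominated u om w -> zs u l a b -> x <= y ->
  nm (a x) ^+ 2 + nm (b x) ^+ 2 <= (nm (a y) ^+ 2 + nm (b y) ^+ 2) *
    expR (2 * (om y - om x) + 2 * `|Im l| * (y - x)).
Proof.
move=> D Z xy; have [po _] := D.
have pq := rprimN (rprimD (rprimZ 2 po) (rprimZ (2 * `|Im l|) (rprim_id R))).
(* Gronwall's inequality for the negated energy, with the negated rate, bounds the decay. *)
have := gronwall (rprimN (rprim_energy Z)) pq xy.
rewrite [X in expR X](_ : _ = - (2 * (om y - om x) + 2 * `|Im l| * (y - x))); last by ring.
rewrite expRN !mulNr lerN2 -ler_pdivlMr ?invr_gt0 ?expR_gt0// invrK.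
apply => z; rewrite mulr1 mulrNN; have := energy_rate l (a z) (b z) z D.
by rewrite ler_norml => /andP[+ _]; lra.
Qed.

Lemma zs_unique u om w l a b c d : dominated u om w -> zs u l a b -> zs u l c d ->
  a 0 = c 0 -> b 0 = d 0 -> forall z, a z = c z /\ b z = d z.
Proof.
move=> D Z1 Z2 ac bd z.
have Z := zs_lin 1 (- 1) Z1 Z2.
have : nm (a z - c z) ^+ 2 + nm (b z - d z) ^+ 2 <= 0.
  have [z0|/ltW z0] := leP 0 z.
    by have := energy_le D Z z0; rewrite !mul1r !mulN1r ac bd !subrr nm0 expr0n addr0 mul0r.
  by have := energy_ge D Z z0; rewrite !mul1r !mulN1r ac bd !subrr nm0 expr0n addr0 mul0r.
have := sqr_ge0 (nm (a z - c z)); have := sqr_ge0 (nm (b z - d z)) => h1 h2 h3.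
have /eqP : nm (a z - c z) ^+ 2 = 0 by lra.
have /eqP : nm (b z - d z) ^+ 2 = 0 by lra.
by rewrite !sqrf_eq0 !nm_eq0 !subr_eq0 => /eqP -> /eqP ->.
Qed.

(* The four functions are the entries of the fundamental matrix with columns
   (f, g) and (h, k). *)
Definition fund u (f g h k : R[i] -> R -> R[i]) : Prop := forall l,
  [/\ zs u l (f l) (g l), zs u l (h l) (k l), f l 0 = 1 /\ g l 0 = 0 & h l 0 = 0 /\ k l 0 = 1].

Lemma fund_det u f g h k : fund u f g h k -> forall l z, f l z * k l z - g l z * h l z = 1.
Proof.
move=> F l z; have [Z1 Z2 [f0 g0] [h0 k0]] := F l.
by rewrite (cprim_wronskian Z1 Z2 z 0) f0 g0 h0 k0; ring.
Qed.

(** The system is invariant under conjugation combined with the exchange of the two components and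
    [l] going to its conjugate. For real [l] the fundamental matrix thus lies in SU(1,1). *)
Lemma fund_conj u om w f g h k : dominated u om w -> fund u f g h k ->
  forall l z, h l z = (g l^*%C z)^*%C /\ k l z = (f l^*%C z)^*%C.
Proof.
move=> D F l z; have [_ Z2 _ [h0 k0]] := F l.
have [Z1 _ [f0 g0] _] := F l^*%C.
have := zs_conj Z1; rewrite conjcK => Z3.
by apply: (zs_unique D Z2 Z3); rewrite ?h0 ?k0 ?f0 ?g0 ?conjc0 ?conjc1.
Qed.

(** The entries are those of [Phi(z + s) Phi(s)^-1], the inverse being the adjugate since the
    determinant is 1. *)
Lemma fund_shift (s : R) u f g h k : fund u f g h k ->
  fund (fun z => u (z + s))
    (fun l z => f l (z + s) * k l s - h l (z + s) * g l s)
    (fun l z => g l (z + s) * k l s - k l (z + s) * g l s)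
    (fun l z => h l (z + s) * f l s - f l (z + s) * h l s)
    (fun l z => k l (z + s) * f l s - g l (z + s) * h l s).
Proof.
move=> F l; have [Z1 Z2 _ _] := F l; have dt := fund_det F l s.
have [P1 P2] := zs_lin (k l s) (- g l s) (zs_shift s Z1) (zs_shift s Z2).
have [P3 P4] := zs_lin (f l s) (- h l s) (zs_shift s Z2) (zs_shift s Z1).
split; [split|split|rewrite !add0r|rewrite !add0r].
- by apply: eq_cprim P1 => z /=; ring.
- by apply: eq_cprim P2 => z /=; ring.
- by apply: eq_cprim P3 => z /=; ring.
- by apply: eq_cprim P4 => z /=; ring.
- by split; [rewrite -[RHS]dt|]; ring.
- by split; [|rewrite -[RHS]dt]; ring.
Qed.

Lemma dominated_shift (s : R) u om w : dominated u om w ->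
  dominated (fun z => u (z + s)) (fun z => om (z + s)) (fun z => w (z + s)).
Proof. by move=> [po uw]; split=> // ; exact: (rprim_shift s po). Qed.

End ZakharovShabat.

(** * Asymptotics far from the real axis *)

Section Asymptotics.
Variable R : realType.
Implicit Types (u a b : R -> R[i]) (x y z e : R) (l : R[i]).
Notation mu := (@lebesgue_measure R).

Local Notation Re := complex.Re.
Local Notation Im := complex.Im.
Local Notation nm := (@ComplexField.Normc.normc R).

(* [wave l z] is the exponential of [- i l z]. *)
Definition wave l z : R[i] := (expR (Im l * z))%:C * cis (- (Re l * z)).

Lemma nm_wave l z : nm (wave l z) = expR (Im l * z).
Proof. by rewrite nmM nm_cis nmR mulr1 ger0_norm ?expR_ge0. Qed.

Lemma waveN l z : wave l z * wave (- l) z = 1.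
Proof.
rewrite /wave mulrACA -cisD -rmorphM/= -expRD !cE.
by rewrite !mulNr opprK subrr addNr cis0 expR0 mulr1.
Qed.

Lemma wave_conj l z : (wave l^*%C z)^*%C = wave (- l) z.
Proof.
apply: complex_eq; rewrite /wave /cis !cE /= !mulNr opprK cosN sinN; ring.
Qed.

Lemma cprim_wave l : cprim (wave l) (fun z => - 'i%C * l * wave l z).
Proof.
have p1 := cprim_real (rprim_expR (rprimZ (Im l) (rprim_id R))).
have p2 := cprim_cis (rprimN (rprimZ (Re l) (rprim_id R))).
apply: eq_cprim (cprimM p1 p2) => // z.
by apply: complex_eq; rewrite /wave /cis !cE /=; ring.
Qed.

Lemma wave0 l : wave l 0 = 1.
Proof. by rewrite /wave !mulr0 oppr0 cis0 expR0 mulr1. Qed.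

Lemma expRN_small e : 0 < e -> exists2 T, 0 < T & forall x, T <= x -> expR (- x) <= e.
Proof.
move=> e0; exists e^-1; first by rewrite invr_gt0.
move=> x ex; rewrite expRN; have x0 : 0 < x by rewrite (lt_le_trans _ ex)// invr_gt0.
rewrite -[e]invrK lef_pV2 ?posrE ?expR_gt0 ?invr_gt0//.
by apply: (le_trans ex); have := expR_ge1Dx x; lra.
Qed.

Section Column.
Variables (u : R -> R[i]) (om w : R -> R) (L : R).
Hypotheses (D : dominated u om w) (L0 : 0 < L).

Let w_ge0 z : 0 <= w z.
Proof. by have [_ uw] := D; exact: le_trans (nm_ge0 _) (uw z). Qed.

Let om_le x y : x <= y -> om x <= om y.
Proof. by have [po _] := D => xy; apply: (rprim_ge po xy); apply: aeE. Qed.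

Let Om := om L - om 0.
Let C := expR Om.

Let Om_ge0 : 0 <= Om. Proof. by rewrite subr_ge0 om_le// ltW. Qed.
Let C_ge0 : 0 <= C. Proof. exact: expR_ge0. Qed.

Lemma zs_bound l a b z : zs u l a b -> nm (a 0) ^+ 2 + nm (b 0) ^+ 2 <= 1 ->
  0 <= z <= L ->
  nm (a z) <= C * expR (`|Im l| * z) /\ nm (b z) <= C * expR (`|Im l| * z).
Proof.
move=> Z n0 /andP[z0 zL].
have := energy_le D Z z0; rewrite subr0.
set E := expR _ => H.
have HE : E <= (C * expR (`|Im l| * z)) ^+ 2.
  rewrite /C -expRD expr2 -expRD ler_expR; have := om_le zL; rewrite /Om; lra.
have E0 : 0 <= E by exact: expR_ge0.
have {}H : nm (a z) ^+ 2 + nm (b z) ^+ 2 <= (C * expR (`|Im l| * z)) ^+ 2.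
  by apply: le_trans H _; apply: le_trans HE; rewrite ler_piMl.
have := sqr_ge0 (nm (a z)); have := sqr_ge0 (nm (b z)) => h1 h2.
by split; rewrite -ler_sqr ?nnegrE ?nm_ge0 ?mulr_ge0 ?expR_ge0//; lra.
Qed.

Let om_unif e : 0 < e -> exists2 d, 0 < d <= L &
  forall t, 0 <= t - d -> t <= L -> om t - om (t - d) <= e.
Proof.
move=> e0; have [[aco _] _] := D; have [d d0 H] := aco _ _ L0 _ e0.
have dd : 0 < Num.min (d / 2) L by rewrite lt_min L0 divr_gt0.
have d2 : Num.min (d / 2) L <= d / 2 by rewrite ge_min lexx.
exists (Num.min (d / 2) L); first by rewrite dd ge_min lexx orbT.
move=> t t0 tL; apply: (le_trans (ler_norm _)); apply: ltW.
have := H 1%N (fun=> t - Num.min (d / 2) L) (fun=> t); rewrite !big_ord1; apply.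
- by move=> _; split => //; lra.
- by move=> k m; rewrite !ord1 eqxx.
- by rewrite opprB addrC subrK; lra.
Qed.

(** With [tau = Im l], the function [wave l * b] has derivative [wave l * conj(u) * a], of size at
    most [C w exp(2 tau z)]. Over a window [[t - d, t]], what came before is damped by
    [exp(- 2 tau d)], small for large [tau], and what is added is small because [om] varies little
    over a length [d]; so [b] is negligible from [d] on. Then [wave (- l) * a], whose derivative is
    [wave (- l) * u * b], is nearly constant: on [[0, d]] because [om] varies little, on [[d, L]]
    because [b] is negligible. *)
Lemma zs_asym e : 0 < e -> exists2 T, 0 < T & forall l a b, zs u l a b ->
  nm (a 0) ^+ 2 + nm (b 0) ^+ 2 <= 1 -> T <= Im l ->
  nm (a L - wave l L * a 0) <= e * expR (Im l * L) /\ nm (b L) <= e * expR (Im l * L).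
Proof.
move=> e0.
pose e1 := e / (2 * (1 + Om)).
have e10 : 0 < e1 by rewrite divr_gt0// mulr_gt0// ltr_pwDl.
have e1E : 2 * e1 + 2 * (e1 * Om) = e by rewrite /e1; field; rewrite gt_eqF// ltr_pwDl.
have C0 : 0 < C by exact: expR_gt0.
have eC : 0 < e1 / C by rewrite divr_gt0.
have [d /andP[d0 dL] Hd] := om_unif eC.
have [T T0 HT] := expRN_small eC.
exists (T / (2 * d)); first by rewrite divr_gt0// mulr_gt0.
move=> l a b Z n0; set tau := Im l => Tl.
have tau0 : 0 < tau by rewrite (lt_le_trans _ Tl)// divr_gt0// mulr_gt0.
have ntau : `|Im l| = tau by rewrite gtr0_norm.
have Ced : C * expR (- (2 * tau * d)) <= e1.
  rewrite mulrC -ler_pdivlMr//; apply: HT; move: Tl; rewrite ler_pdivrMr ?mulr_gt0//; lra.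
have bd z : 0 <= z <= L -> nm (a z) <= C * expR (tau * z) /\ nm (b z) <= C * expR (tau * z).
  by move=> zL; rewrite -ntau; exact: zs_bound.
have [pa pb] := Z.
have bsmall t : d <= t <= L -> nm (b t) <= 2 * e1 * expR (tau * t).
  move=> /andP[dt tL].
  have td0 : 0 <= t - d by lra.
  have pc := cprimM (cprim_wave l) pb.
  have tdt : t - d <= t by lra.
  have W : nm (wave l t * b t - wave l (t - d) * b (t - d)) <=
      (C * expR (2 * tau * t)) * om t - (C * expR (2 * tau * t)) * om (t - d).
    apply: (cprim_le pc (rprimZ (C * expR (2 * tau * t)) (proj1 D)) tdt).
    apply: aeE => z /andP[z1 z2].
    rewrite (_ : _ + _ = wave l z * ((u z)^*%C * a z)); last by ring.
    rewrite nmM nm_wave nmM nmJ -/tau.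
    have zL : 0 <= z <= L by apply/andP; split; lra.
    have [az _] := bd z zL.
    have -> : expR (2 * tau * t) = expR (tau * t) * expR (tau * t).
      by rewrite -expRD; congr expR; ring.
    have h1 : expR (tau * z) <= expR (tau * t) by rewrite ler_expR ler_wpM2l// ltW.
    rewrite [leRHS](_ : _ = expR (tau * t) * (w z * (C * expR (tau * t)))); last by ring.
    have [_ uw] := D.
    apply: ler_pM; rewrite ?expR_ge0 ?mulr_ge0 ?nm_ge0//.
    apply: ler_pM; rewrite ?nm_ge0 ?uw//.
    by apply: (le_trans az); rewrite ler_wpM2l.
  have c1 : nm (wave l (t - d) * b (t - d)) <= C * expR (2 * tau * (t - d)).
    rewrite nmM nm_wave -/tau.
    have [|_ bz] := bd (t - d); first by apply/andP; split; lra.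
    apply: (le_trans (ler_wpM2l (expR_ge0 _) bz)).
    by rewrite mulrCA -expRD ler_wpM2l// ler_expR; lra.
  have {W} W : nm (wave l t * b t) <= 2 * e1 * expR (2 * tau * t).
    have -> : wave l t * b t = (wave l t * b t - wave l (t - d) * b (t - d)) + wave l (t - d) * b (t - d).
      by ring.
    apply: (le_trans (nmD _ _)).
    have : C * expR (2 * tau * (t - d)) <= e1 * expR (2 * tau * t).
      have -> : 2 * tau * (t - d) = - (2 * tau * d) + 2 * tau * t by ring.
      by rewrite expRD mulrA ler_wpM2r// expR_ge0.
    have : (C * expR (2 * tau * t)) * (om t - om (t - d)) <= e1 * expR (2 * tau * t).
      rewrite mulrAC ler_wpM2r ?expR_ge0// mulrC -ler_pdivlMr//.
      exact: Hd.
    lra.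
  move: W; rewrite nmM nm_wave -/tau.
  have -> : expR (2 * tau * t) = expR (tau * t) * expR (tau * t).
    by rewrite -expRD; congr expR; ring.
  by rewrite mulrCA ler_pM2l ?expR_gt0.
split; last first.
  apply: (le_trans (bsmall L _)); first by rewrite dL lexx.
  rewrite ler_wpM2r ?expR_ge0//; have : 0 <= e1 * Om by rewrite mulr_ge0// ltW.
  lra.
have pA := cprimM (cprim_wave (- l)) pa.
have A0 : nm (wave (- l) d * a d - wave (- l) 0 * a 0) <= C * om d - C * om 0.
  apply: (cprim_le pA (rprimZ C (proj1 D)) (ltW d0)).
  apply: aeE => z /andP[z1 z2].
  rewrite (_ : _ + _ = wave (- l) z * (u z * b z)); last by ring.
  have zL : 0 <= z <= L by apply/andP; split; lra.
  have [_ bz] := bd z zL; have [_ uw] := D.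
  rewrite nmM nm_wave nmM ImN -/tau.
  have -> : C * w z = expR (- tau * z) * (w z * (C * expR (tau * z))).
    rewrite mulrCA mulrA -[RHS]mulrCA; rewrite mulNr expRN.
    by field; rewrite gt_eqF// expR_gt0.
  apply: ler_wpM2l; first exact: expR_ge0.
  by apply: ler_pM; rewrite ?nm_ge0 ?uw.
have A1 : nm (wave (- l) L * a L - wave (- l) d * a d) <= 2 * e1 * om L - 2 * e1 * om d.
  apply: (cprim_le pA (rprimZ (2 * e1) (proj1 D)) dL).
  apply: aeE => z zL.
  rewrite (_ : _ + _ = wave (- l) z * (u z * b z)); last by ring.
  have bz := bsmall z zL; have [_ uw] := D.
  rewrite nmM nm_wave nmM ImN -/tau.
  have -> : 2 * e1 * w z = expR (- tau * z) * (w z * (2 * e1 * expR (tau * z))).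
    rewrite mulNr expRN.
    by field; rewrite gt_eqF// expR_gt0.
  apply: ler_wpM2l; first exact: expR_ge0.
  by apply: ler_pM; rewrite ?nm_ge0 ?uw.
have -> : a L - wave l L * a 0 = wave l L * ((wave (- l) L * a L - wave (- l) d * a d)
    + (wave (- l) d * a d - wave (- l) 0 * a 0)).
  rewrite wave0 mul1r addrA subrK.
  by rewrite mulrBr mulrA waveN mul1r.
rewrite nmM nm_wave -/tau mulrC ler_wpM2r ?expR_ge0//.
apply: (le_trans (nmD _ _)).
have h1 : C * (om d - om 0) <= e1.
  by rewrite mulrC -ler_pdivlMr//; have := Hd d; rewrite subrr; apply.
have h2 : e1 * (om L - om d) <= e1 * Om.
  by rewrite (ler_wpM2l (ltW e10))// /Om; have := om_le (ltW d0); lra.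
lra.
Qed.

End Column.

(** In the upper half plane [wave (- l)] is itself within the error, so the claim on [k] only asks
    that [k] be small. The lower half plane follows from [fund_conj]. *)
Lemma fund_asym u om w (L : R) (f g h k : R[i] -> R -> R[i]) e :
  dominated u om w -> 0 < L -> fund u f g h k -> 0 < e ->
  exists2 T, 0 < T & forall l, T <= `|Im l| ->
   [/\ nm (f l L - wave l L) <= e * expR (`|Im l| * L),
       nm (g l L) <= e * expR (`|Im l| * L),
       nm (h l L) <= e * expR (`|Im l| * L) &
       nm (k l L - wave (- l) L) <= e * expR (`|Im l| * L)].
Proof.
move=> D L0 F e0.
have e20 : 0 < e / 2 by rewrite divr_gt0.
have [T1 T10 H1] := zs_asym D L0 e20.
have [T2 T20 H2] := expRN_small e20.
exists (Num.max T1 (T2 / L)); first by rewrite lt_max T10.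
have up l : Num.max T1 (T2 / L) <= Im l ->
   [/\ nm (f l L - wave l L) <= e * expR (Im l * L),
       nm (g l L) <= e * expR (Im l * L),
       nm (h l L) <= e * expR (Im l * L) &
       nm (k l L - wave (- l) L) <= e * expR (Im l * L)].
  rewrite ge_max => /andP[l1 l2]; have [Z1 Z2 [f0 g0] [h0 k0]] := F l.
  have n1 : nm (f l 0) ^+ 2 + nm (g l 0) ^+ 2 <= 1 by rewrite f0 g0 nm0 nm1; lra.
  have n2 : nm (h l 0) ^+ 2 + nm (k l 0) ^+ 2 <= 1 by rewrite h0 k0 nm0 nm1; lra.
  have [a1 a2] := H1 l _ _ Z1 n1 l1; have [b1 b2] := H1 l _ _ Z2 n2 l1.
  have E0 := expR_ge0 (Im l * L).
  have half : e / 2 * expR (Im l * L) <= e * expR (Im l * L).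
    by rewrite ler_wpM2r//; lra.
  rewrite f0 mulr1 in a1; rewrite h0 mulr0 subr0 in b1.
  split; try exact: (le_trans _ half).
  apply: (le_trans (nmB _ _)); rewrite nm_wave ImN mulNr.
  have : expR (- (Im l * L)) <= e / 2 * expR (Im l * L).
    have lL : T2 <= Im l * L by rewrite -ler_pdivrMr.
    apply: (le_trans (H2 _ lL)); rewrite ler_peMr ?ltW//.
    by rewrite expR_gt1 (lt_le_trans T20 lL).
  lra.
move=> l; rewrite ler_normr => /orP[lT|lT].
  have l0 : 0 <= Im l by apply: le_trans lT; rewrite le_max (ltW T10).
  by rewrite ger0_norm//; exact: up.
have l0 : 0 <= - Im l by apply: le_trans lT; rewrite le_max (ltW T10).
have := up l^*%C; rewrite ImJ => /(_ lT) [u1 u2 u3 u4].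
rewrite -normrN ger0_norm//.
have [-> ->] := fund_conj D F l L.
have [hc kc] := fund_conj D F l^*%C L; rewrite conjcK in hc kc.
rewrite hc nmJ in u3; rewrite kc in u4.
split; rewrite ?nmJ//.
  by move: u4; rewrite -(nmJ (f l L - wave l L)) rmorphB /= -[wave (- l^*%C) L]wave_conj conjcK.
rewrite -wave_conj -rmorphB nmJ; exact: u1.
Qed.

End Asymptotics.

(** * Bounds off the real axis and Taylor expansions in the spectral parameter *)

Section Resolvent.
Variable R : realType.
Implicit Types (x y z e : R) (l : R[i]).
Notation mu := (@lebesgue_measure R).

Local Notation Re := complex.Re.
Local Notation Im := complex.Im.
Local Notation nm := (@ComplexField.Normc.normc R).

Variables (u : R -> R[i]) (om w : R -> R) (L : R) (f g h k : R[i] -> R -> R[i]).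
Hypotheses (D : dominated u om w) (L0 : 0 < L) (F : fund u f g h k).

(* The defect |a|^2 - |b|^2 grows at rate 2 (Im l) (|a|^2 + |b|^2), so the
   transfer matrix minus the identity is bounded below off the real axis. *)
Lemma fund_sub1_ge T : 0 <= T -> exists2 c, 0 < c & forall l (s t : R[i]), `|Im l| <= T ->
  c * Im l ^+ 2 * (nm s ^+ 2 + nm t ^+ 2) <=
  nm ((f l L - 1) * s + h l L * t) ^+ 2 + nm (g l L * s + (k l L - 1) * t) ^+ 2.
Proof.
move=> T0.
pose Om := om L - om 0.
(* The least factor by which the energy can shrink on [[0, L]] while [|Im l| <= T]. *)
pose c0 := expR (- (2 * Om + 2 * T * L)).
have c00 : 0 < c0 by exact: expR_gt0.
have cL0 : 0 < c0 * L by rewrite mulr_gt0.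
have den0 : 0 < T * (c0 * L) + 1 by rewrite ltr_wpDl// mulr_ge0// ltW.
exists ((c0 * L) ^+ 2 / (T * (c0 * L) + 1)).
  by rewrite divr_gt0// exprn_gt0.
move=> l s t lT.
have [Z1 Z2 [f0 g0] [h0 k0]] := F l.
have Z := zs_lin s t Z1 Z2.
set a := fun z => _ in Z; set b := fun z => s * g l z + _ in Z.
pose n := nm s ^+ 2 + nm t ^+ 2.
have n0 : 0 <= n by rewrite addr_ge0 ?sqr_ge0.
have as0 : a 0 = s by rewrite /a f0 h0; ring.
have bt0 : b 0 = t by rewrite /b g0 k0; ring.
have om_le (x y : R) : x <= y -> om x <= om y.
  by have [po uw] := D => xy; apply: (rprim_ge po xy); apply: aeE => z _; exact: le_trans (nm_ge0 _) (uw z).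
have low z : 0 <= z <= L -> c0 * n <= nm (a z) ^+ 2 + nm (b z) ^+ 2.
  move=> /andP[z0 zL]; have := energy_ge D Z z0; rewrite as0 bt0 -/n subr0 => H.
  rewrite /c0 expRN mulrC ler_pdivrMr ?expR_gt0//; apply: (le_trans H).
  rewrite ler_wpM2l ?addr_ge0 ?sqr_ge0// ler_expR.
  have := om_le _ _ zL; have : `|Im l| * z <= T * L by apply: ler_pM.
  rewrite /Om; lra.
pose w1 := (f l L - 1) * s + h l L * t; pose w2 := g l L * s + (k l L - 1) * t.
have aL : a L = s + w1 by rewrite /a /w1; ring.
have bL : b L = t + w2 by rewrite /b /w2; ring.
pose d := (nm (a L) ^+ 2 - nm (b L) ^+ 2) - (nm s ^+ 2 - nm t ^+ 2).
have pd := rprim_defect Z.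
have dlow : 2 * `|Im l| * (c0 * n * L) <= `|d|.
  have [il0|/ltW il0] := leP 0 (Im l).
    have pc := rprimB pd (rprimZ (2 * Im l * (c0 * n)) (rprim_id R)).
    have := rprim_ge pc (ltW L0) => /(_ _)/=.
    rewrite as0 bt0 mulr0 subr0 => W.
    apply: le_trans (ler_norm _); rewrite ger0_norm// /d.
    suff : nm s ^+ 2 - nm t ^+ 2 <= nm (a L) ^+ 2 - nm (b L) ^+ 2 - 2 * Im l * (c0 * n) * L by lra.
    apply: W; apply: aeE => z zL; rewrite mulr1 -mulrBr mulr_ge0 ?mulr_ge0// subr_ge0.
    exact: low.
  have pc := rprimB pd (rprimZ (2 * Im l * (c0 * n)) (rprim_id R)).
  have := rprim_le pc (ltW L0) => /(_ _)/=.
  rewrite as0 bt0 mulr0 subr0 => W.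
  rewrite -[`|d|]normrN; apply: le_trans (ler_norm _); rewrite ler0_norm// /d.
  suff : nm (a L) ^+ 2 - nm (b L) ^+ 2 - 2 * Im l * (c0 * n) * L <= nm s ^+ 2 - nm t ^+ 2 by lra.
  apply: W; apply: aeE => z zL; rewrite mulr1 -mulrBr mulr_le0_ge0 ?mulr_ge0_le0// subr_ge0.
  exact: low.
rewrite -/w1 -/w2 -/n.
set r := nm w1 ^+ 2 + nm w2 ^+ 2.
have r0 : 0 <= r by rewrite addr_ge0 ?sqr_ge0.
have sqd (p q : R[i]) : `|nm (p + q) ^+ 2 - nm p ^+ 2| <= 2 * (nm p * nm q) + nm q ^+ 2.
  have h1 := nmD p q; have h2 : nm p <= nm (p + q) + nm q by have := nmB (p + q) q; rewrite addrK.
  have h3 := nm_ge0 p; have h4 := nm_ge0 q; have h5 := nm_ge0 (p + q).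
  rewrite ler_norml; apply/andP; split; first by nra.
  by nra.
have dup : `|d| <= 2 * (nm s * nm w1) + 2 * (nm t * nm w2) + r.
  rewrite /d aL bL (_ : _ - _ = (nm (s + w1) ^+ 2 - nm s ^+ 2) - (nm (t + w2) ^+ 2 - nm t ^+ 2)); last by ring.
  apply: (le_trans (ler_normB _ _)); have := sqd s w1; have := sqd t w2; rewrite /r; lra.
have [il0|il0] := eqVneq (Im l) 0.
  by rewrite il0 expr0n mulr0 mul0r.
(* Since [2 th n <= |d| <= 2 (|s| |w1| + |t| |w2|) + r], the inequality of arithmetic and geometric
   means with weight [th] lets half of the left side absorb the terms in [s] and [t]. *)
pose th := `|Im l| * (c0 * L).
have th0 : 0 < th by rewrite mulr_gt0// normr_gt0.
have thT : th <= T * (c0 * L) by rewrite ler_wpM2r// ltW.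
have amgm (p q : R) : 2 * (p * q) <= th * p ^+ 2 + q ^+ 2 / th.
  have -> : q ^+ 2 / th = (q / th) ^+ 2 * th by field; rewrite gt_eqF.
  have -> : p * q = th * (p * (q / th)) by field; rewrite gt_eqF.
  have := sqr_ge0 (p - q / th); rewrite sqrrB => H.
  have := ler_wpM2l (ltW th0) H; lra.
have key : th * n <= r / th + r.
  have := amgm (nm s) (nm w1); have := amgm (nm t) (nm w2).
  have : 2 * (th * n) <= `|d| by apply: le_trans dlow; rewrite /th; lra.
  have -> : r / th = nm w1 ^+ 2 / th + nm w2 ^+ 2 / th by rewrite /r mulrDl.
  rewrite /n; lra.
have key2 : th ^+ 2 * n <= r * (th + 1).
  have := ler_wpM2l (ltW th0) key.
  have -> : th * (r / th + r) = r + th * r by field; rewrite gt_eqF.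
  rewrite mulrA -expr2; lra.
rewrite [leLHS](_ : _ = th ^+ 2 * n / (T * (c0 * L) + 1)); last first.
  by rewrite /th [in RHS]exprMn real_normK ?num_real//; ring.
rewrite ler_pdivrMr//.
by apply: (le_trans key2); rewrite ler_wpM2l//; lra.
Qed.

(** The determinant of [Phi(L) - 1] is [2 - tr Phi(L)]. Applied to the unit vectors, the preceding
    bound makes the entries of [Phi(L) - 1] large; applied to the columns of its adjugate, which it
    maps to multiples of unit vectors by the determinant, the bound makes the determinant large in
    terms of the entries. *)
Lemma fund_trace_ge T : 0 <= T -> exists2 c, 0 < c & forall l, `|Im l| <= T ->
  c * Im l ^+ 2 <= nm (f l L + k l L - 2).
Proof.
move=> /fund_sub1_ge[c c0 H]; exists c => // l lT.
pose m11 := f l L - 1; pose m12 := h l L; pose m21 := g l L; pose m22 := k l L - 1.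
pose q := c * Im l ^+ 2.
have q0 : 0 <= q by rewrite mulr_ge0 ?sqr_ge0// ltW.
have dE : m11 * m22 - m21 * m12 = - (f l L + k l L - 2).
  have := fund_det F l L => dt.
  rewrite [LHS](_ : _ = (f l L * k l L - g l L * h l L) - f l L - k l L + 1); last first.
    by rewrite /m11 /m22 /m21 /m12; ring.
  by rewrite dt; ring.
rewrite -nmN -dE -/q.
have h1 := H l 1 0 lT; have h2 := H l 0 1 lT.
have h3 := H l m22 (- m21) lT; have h4 := H l (- m12) m11 lT.
rewrite -/m11 -/m12 -/m21 -/m22 -/q in h1 h2 h3 h4.
rewrite !mulr1 !mulr0 !addr0 !add0r nm0 nm1 expr1n expr0n in h1 h2.
rewrite !nmN in h3 h4.
rewrite (_ : m21 * m22 + m22 * - m21 = 0) in h3; last by ring.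
rewrite (_ : m11 * m22 + m12 * - m21 = m11 * m22 - m21 * m12) in h3; last by ring.
rewrite (_ : m11 * - m12 + m12 * m11 = 0) in h4; last by ring.
rewrite (_ : m21 * - m12 + m22 * m11 = m11 * m22 - m21 * m12) in h4; last by ring.
rewrite !nm0 expr0n /= !addr0 ?add0r in h1 h2 h3 h4.
set dd := m11 * m22 - m21 * m12 in h3 h4 *.
rewrite -ler_sqr ?nnegrE ?nm_ge0//.
rewrite !mulr1 in h1 h2.
have : q * (q + q) <= q * ((nm m11 ^+ 2 + nm m21 ^+ 2) + (nm m12 ^+ 2 + nm m22 ^+ 2)).
  by rewrite ler_wpM2l// lerD.
lra.
Qed.

End Resolvent.

Section Taylor.
Variable R : realType.
Implicit Types (z : R) (l eta x y : R[i]) (a b G H : R -> R[i]).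
Notation mu := (@lebesgue_measure R).

Local Notation Re := complex.Re.
Local Notation Im := complex.Im.
Local Notation nm := (@ComplexField.Normc.normc R).

Definition cint (G : R -> R[i]) z : R[i] :=
  oint 0 z (fun t => Re (G t)) +i* oint 0 z (fun t => Im (G t)).

Lemma oint_xx (G : R -> R) z : oint z z G = 0.
Proof. by rewrite /oint lexx set_itv1 Rintegral_set1. Qed.

Lemma cint0 G : cint G 0 = 0. Proof. by rewrite /cint !oint_xx. Qed.

Lemma cprim_cint (G G' : R -> R[i]) : cprim G G' -> cprim (cint G) G.
Proof.
move=> /cprim_continuous[cr ci]; split.
  exact: rprim_oint (continuous_loc_integrable cr).
exact: rprim_oint (continuous_loc_integrable ci).
Qed.

Variables (u : R -> R[i]) (om w : R -> R) (L : R) (f g h k : R[i] -> R -> R[i]).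
Hypotheses (D : dominated u om w) (L0 : 0 < L) (F : fund u f g h k).

(** [(P, Q)] and [(S, - P)] are the rows of [Phi^-1 sigma Phi], with [sigma = diag(1, -1)] and [Phi]
    the fundamental matrix at [l]. By variation of constants, a solution at [l + eta], multiplied by
    [Phi^-1], satisfies a system whose matrix is [- i eta] times this one. *)
Let P l z := f l z * k l z + g l z * h l z.
Let Q l z := 2 * h l z * k l z.
Let S l z := - 2 * f l z * g l z.

(** Picard iteration for that system: [X l x0 y0 n] is the coefficient of [eta ^+ n] in [Phi^-1]
    times the solution at [l + eta] that starts from [(x0, y0)]. *)
Let step l (X : (R -> R[i]) * (R -> R[i])) : (R -> R[i]) * (R -> R[i]) :=
  (cint (fun t => - 'i%C * (P l t * X.1 t + Q l t * X.2 t)),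
   cint (fun t => - 'i%C * (S l t * X.1 t - P l t * X.2 t))).

Let X l (x0 y0 : R[i]) n := iter n (step l) (fun=> x0, fun=> y0).

Let cprimable (G : R -> R[i]) := exists G', cprim G G'.

Let cprimableM G H : cprimable G -> cprimable H -> cprimable (fun t => G t * H t).
Proof. by move=> [G' pG] [H' pH]; eexists; exact: cprimM pG pH. Qed.

Let cprimableD G H : cprimable G -> cprimable H -> cprimable (fun t => G t + H t).
Proof. by move=> [G' pG] [H' pH]; eexists; exact: cprimD pG pH. Qed.

Let cprimableB G H : cprimable G -> cprimable H -> cprimable (fun t => G t - H t).
Proof. by move=> [G' pG] [H' pH]; eexists; exact: cprimB pG pH. Qed.

Let cprimable_cst c : cprimable (fun=> c).
Proof. by eexists; exact: cprim_cst. Qed.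

Let cprimable_fund l : [/\ cprimable (f l), cprimable (g l), cprimable (h l) & cprimable (k l)].
Proof. by have [[? ?] [? ?] _ _] := F l; split; eexists; eassumption. Qed.

Let cprimable_PQS l : [/\ cprimable (P l), cprimable (Q l) & cprimable (S l)].
Proof.
have [pf pg ph pk] := cprimable_fund l; split.
- by apply: cprimableD; exact: cprimableM.
- by do 2! apply: cprimableM => //; exact: cprimable_cst.
- by do 2! apply: cprimableM => //; exact: cprimable_cst.
Qed.

Let cprim_X l x0 y0 n : [/\ cprimable (X l x0 y0 n).1, cprimable (X l x0 y0 n).2,
  cprim (X l x0 y0 n.+1).1
    (fun t => - 'i%C * (P l t * (X l x0 y0 n).1 t + Q l t * (X l x0 y0 n).2 t)) &
  cprim (X l x0 y0 n.+1).2
    (fun t => - 'i%C * (S l t * (X l x0 y0 n).1 t - P l t * (X l x0 y0 n).2 t))].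
Proof.
have [pP pQ pS] := cprimable_PQS l.
have st n' : cprimable (X l x0 y0 n').1 -> cprimable (X l x0 y0 n').2 ->
  cprim (X l x0 y0 n'.+1).1
    (fun t => - 'i%C * (P l t * (X l x0 y0 n').1 t + Q l t * (X l x0 y0 n').2 t)) /\
  cprim (X l x0 y0 n'.+1).2
    (fun t => - 'i%C * (S l t * (X l x0 y0 n').1 t - P l t * (X l x0 y0 n').2 t)).
  move=> c1 c2; split.
    have [G' pG] : cprimable (fun t => - 'i%C * (P l t * (X l x0 y0 n').1 t + Q l t * (X l x0 y0 n').2 t)).
      by apply: cprimableM; [exact: cprimable_cst|apply: cprimableD; exact: cprimableM].
    exact: cprim_cint pG.
  have [G' pG] : cprimable (fun t => - 'i%C * (S l t * (X l x0 y0 n').1 t - P l t * (X l x0 y0 n').2 t)).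
    by apply: cprimableM; [exact: cprimable_cst|apply: cprimableB; exact: cprimableM].
  exact: cprim_cint pG.
suff [c1 c2] : cprimable (X l x0 y0 n).1 /\ cprimable (X l x0 y0 n).2.
  by have [? ?] := st n c1 c2.
elim: n => [|n [c1 c2]]; first by split; exact: cprimable_cst.
by have [? ?] := st n c1 c2; split; eexists; eassumption.
Qed.

Let X0 l x0 y0 n : (X l x0 y0 n.+1).1 0 = 0 /\ (X l x0 y0 n.+1).2 0 = 0.
Proof. by split; exact: cint0. Qed.

Lemma fund_bound rho : exists2 M, 1 <= M & forall l z, nm l <= rho -> 0 <= z <= L ->
  [/\ nm (f l z) <= M, nm (g l z) <= M, nm (h l z) <= M & nm (k l z) <= M].
Proof.
have om_le (x y : R) : x <= y -> om x <= om y.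
  by have [po uw] := D => xy; apply: (rprim_ge po xy); apply: aeE => z _; exact: le_trans (nm_ge0 _) (uw z).
exists (expR (om L - om 0) * expR (`|rho| * L)).
  rewrite -expRD -expR0 ler_expR; have := om_le _ _ (ltW L0) => ?.
  by rewrite addr_ge0 ?subr_ge0// mulr_ge0// ltW.
move=> l z lr zL; have [Z1 Z2 [f0 g0] [h0 k0]] := F l.
have n1 : nm (f l 0) ^+ 2 + nm (g l 0) ^+ 2 <= 1 by rewrite f0 g0 nm0 nm1; lra.
have n2 : nm (h l 0) ^+ 2 + nm (k l 0) ^+ 2 <= 1 by rewrite h0 k0 nm0 nm1; lra.
have [b1 b2] := zs_bound D Z1 n1 zL; have [b3 b4] := zs_bound D Z2 n2 zL.
have le : expR (om L - om 0) * expR (`|Im l| * z) <= expR (om L - om 0) * expR (`|rho| * L).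
  rewrite ler_wpM2l ?expR_ge0// ler_expR; have /andP[z0 zL'] := zL.
  by apply: ler_pM => //; apply: (le_trans (nm_Im _)); apply: (le_trans lr); exact: ler_norm.
by split; apply: le_trans le.
Qed.

(** The remainder after [n + 1] terms is the integral of [- i eta] times the matrix, whose entries
    are at most [2 M^2], applied to the remainder after [n] terms. The resulting geometric bound,
    cruder than the factorial one, suffices because [n] stays fixed. *)
Let remainder M l eta a b x0 y0 n :
  (forall z, 0 <= z <= L -> [/\ nm (f l z) <= M, nm (g l z) <= M, nm (h l z) <= M & nm (k l z) <= M]) ->
  (forall z, 0 <= z <= L -> nm (a z) <= M /\ nm (b z) <= M) -> 0 <= M ->
  zs u (l + eta) a b -> a 0 = x0 -> b 0 = y0 -> forall z, 0 <= z <= L ->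
  nm (k l z * a z - h l z * b z - \sum_(j < n) eta ^+ j * (X l x0 y0 j).1 z) <=
     2 * M ^+ 2 * (4 * M ^+ 2 * L * nm eta) ^+ n /\
  nm (f l z * b z - g l z * a z - \sum_(j < n) eta ^+ j * (X l x0 y0 j).2 z) <=
     2 * M ^+ 2 * (4 * M ^+ 2 * L * nm eta) ^+ n.
Proof.
move=> HM Hab M0 Z a0 b0.
have MM (p q : R[i]) : nm p <= M -> nm q <= M -> nm (p * q) <= M ^+ 2.
  by move=> p1 q1; rewrite nmM expr2 ler_pM ?nm_ge0.
have M20 : 0 <= M ^+ 2 by exact: sqr_ge0.
elim: n => [|n IH] z zL.
  rewrite !big_ord0 !subr0 expr0 mulr1.
  have [f1 g1 h1 k1] := HM z zL; have [a1 b1] := Hab z zL.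
  split; apply: (le_trans (nmB _ _)).
    by have := MM _ _ k1 a1; have := MM _ _ h1 b1; lra.
  by have := MM _ _ f1 b1; have := MM _ _ g1 a1; lra.
have [Z1 Z2 [f0 g0] [h0 k0]] := F l.
set K := 4 * M ^+ 2 * L * nm eta in IH *.
pose Dn z := k l z * a z - h l z * b z - \sum_(j < n) eta ^+ j * (X l x0 y0 j).1 z.
pose En z := f l z * b z - g l z * a z - \sum_(j < n) eta ^+ j * (X l x0 y0 j).2 z.
pose xt z := k l z * a z - h l z * b z.
pose yt z := f l z * b z - g l z * a z.
have [pa pb] := Z; have [pf pg] := Z1; have [ph pk] := Z2.
have aE z' : a z' = f l z' * xt z' + h l z' * yt z'.
  have := fund_det F l z' => dt; rewrite /xt /yt -[LHS]mul1r -dt; ring.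
have bE z' : b z' = g l z' * xt z' + k l z' * yt z'.
  have := fund_det F l z' => dt; rewrite /xt /yt -[LHS]mul1r -dt; ring.
have px : cprim xt (fun z => - 'i%C * eta * (P l z * xt z + Q l z * yt z)).
  apply: eq_cprim (cprimB (cprimM pk pa) (cprimM ph pb)) => // z'.
  rewrite (_ : P l z' * xt z' + Q l z' * yt z' = k l z' * a z' + h l z' * b z'); last first.
    by rewrite [in RHS]aE [in RHS]bE /P /Q; ring.
  by ring.
have py : cprim yt (fun z => - 'i%C * eta * (S l z * xt z - P l z * yt z)).
  apply: eq_cprim (cprimB (cprimM pf pb) (cprimM pg pa)) => // z'.
  rewrite (_ : S l z' * xt z' - P l z' * yt z' = - (g l z' * a z' + f l z' * b z')); last first.
    by rewrite [in RHS]aE [in RHS]bE /P /S; ring.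
  by ring.
have xt0 : xt 0 = x0 by rewrite /xt k0 h0 a0; ring.
have yt0 : yt 0 = y0 by rewrite /yt f0 g0 b0; ring.
have psum m : cprim (fun z => \sum_(j < m.+1) eta ^+ j * (X l x0 y0 j).1 z)
    (fun z => - 'i%C * eta * (P l z * (\sum_(j < m) eta ^+ j * (X l x0 y0 j).1 z)
        + Q l z * (\sum_(j < m) eta ^+ j * (X l x0 y0 j).2 z))) /\
   cprim (fun z => \sum_(j < m.+1) eta ^+ j * (X l x0 y0 j).2 z)
    (fun z => - 'i%C * eta * (S l z * (\sum_(j < m) eta ^+ j * (X l x0 y0 j).1 z)
        - P l z * (\sum_(j < m) eta ^+ j * (X l x0 y0 j).2 z))).
  elim: m => [|m [IH1 IH2]].
    split.
      by apply: eq_cprim (cprim_cst x0) => z'; rewrite ?big_ord1 ?big_ord0 /X/=; ring.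
    by apply: eq_cprim (cprim_cst y0) => z'; rewrite ?big_ord1 ?big_ord0 /X/=; ring.
  have [_ _ p1 p2] := cprim_X l x0 y0 m.
  split.
    apply: eq_cprim (cprimD IH1 (cprimZ (eta ^+ m.+1) p1)) => z'; first by rewrite [RHS]big_ord_recr.
    by rewrite [in RHS]big_ord_recr [in X in _ = _ * (_ + _ * X)]big_ord_recr /= exprS; ring.
  apply: eq_cprim (cprimD IH2 (cprimZ (eta ^+ m.+1) p2)) => z'; first by rewrite [RHS]big_ord_recr.
  by rewrite [in RHS]big_ord_recr [in X in _ = _ * (_ - _ * X)]big_ord_recr /= exprS; ring.
have sum0 m : \sum_(j < m.+1) eta ^+ j * (X l x0 y0 j).1 0 = x0 /\
              \sum_(j < m.+1) eta ^+ j * (X l x0 y0 j).2 0 = y0.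
  elim: m => [|m [IH1 IH2]]; first by rewrite !big_ord1 /X/= !expr0 !mul1r.
  have [e1 e2] := X0 l x0 y0 m; split; rewrite big_ord_recr.
    apply: etrans (addr0 x0); congr (_ + _); first exact: IH1.
    by apply: etrans (mulr0 (eta ^+ m.+1)); congr (_ * _); exact: e1.
  apply: etrans (addr0 y0); congr (_ + _); first exact: IH2.
  by apply: etrans (mulr0 (eta ^+ m.+1)); congr (_ * _); exact: e2.
have [ps1 ps2] := psum n; have [s01 s02] := sum0 n.
have /andP[z0 zL'] := zL.
have PQS z' : 0 <= z' <= L -> [/\ nm (P l z') <= 2 * M ^+ 2, nm (Q l z') <= 2 * M ^+ 2 & nm (S l z') <= 2 * M ^+ 2].
  move=> zL''; have [f1 g1 h1 k1] := HM z' zL''.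
  have n2 : nm 2 = 2 by rewrite (_ : 2 = 2%:C :> R[i]) ?nmR ?ger0_norm// rmorphMn.
  split.
  - by apply: (le_trans (nmD _ _)); have := MM _ _ f1 k1; have := MM _ _ g1 h1; lra.
  - by rewrite /Q -mulrA nmM n2 ler_wpM2l// MM.
  - by rewrite /S -mulrA nmM nmN n2 ler_wpM2l// MM.
have bound (A B dA dB : R[i]) : nm A <= 2 * M ^+ 2 -> nm B <= 2 * M ^+ 2 ->
    nm dA <= 2 * M ^+ 2 * K ^+ n -> nm dB <= 2 * M ^+ 2 * K ^+ n ->
    nm (- 'i%C * eta * (A * dA + B * dB)) <= (2 * M ^+ 2 * K ^+ n) * (4 * M ^+ 2 * nm eta).
  move=> A1 B1 dA1 dB1; rewrite nmM [nm (_ * eta)]nmM nmN nm_i mul1r mulrC.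
  rewrite [leRHS]mulrA ler_wpM2r ?nm_ge0//; apply: (le_trans (nmD _ _)); rewrite !nmM.
  have m1 := ler_pM (nm_ge0 _) (nm_ge0 _) A1 dA1.
  have m2 := ler_pM (nm_ge0 _) (nm_ge0 _) B1 dB1.
  lra.
have fin : (2 * M ^+ 2 * K ^+ n * (4 * M ^+ 2 * nm eta)) * z <= 2 * M ^+ 2 * K ^+ n.+1.
  have -> : 2 * M ^+ 2 * K ^+ n.+1 = 2 * M ^+ 2 * K ^+ n * (4 * M ^+ 2 * nm eta) * L.
    have KE : K = 4 * M ^+ 2 * L * nm eta by [].
    by rewrite [K ^+ n.+1]exprSr {2}KE; ring.
  have K0 : 0 <= K by rewrite !mulr_ge0 ?nm_ge0// ltW.
  by rewrite ler_wpM2l// !mulr_ge0 ?exprn_ge0 ?nm_ge0.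
split; apply: le_trans fin.
- have := cprim_le (cprimB px ps1) (rprimZ (2 * M ^+ 2 * K ^+ n * (4 * M ^+ 2 * nm eta)) (rprim_id R)) z0.
  rewrite xt0 s01 subrr subr0 mulr0 subr0; apply; apply: aeE => z' zz'.
  have zL'' : 0 <= z' <= L by apply/andP; split; lra.
  rewrite mulr1 -mulrBr (_ : _ - _ = P l z' * Dn z' + Q l z' * En z'); last by rewrite /Dn /En /xt /yt; ring.
  by have [? ? _] := PQS z' zL''; have [? ?] := IH z' zL''; apply: bound.
- have := cprim_le (cprimB py ps2) (rprimZ (2 * M ^+ 2 * K ^+ n * (4 * M ^+ 2 * nm eta)) (rprim_id R)) z0.
  rewrite yt0 s02 subrr subr0 mulr0 subr0; apply; apply: aeE => z' zz'.
  have zL'' : 0 <= z' <= L by apply/andP; split; lra.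
  rewrite mulr1 -mulrBr (_ : _ - _ = S l z' * Dn z' + (- P l z') * En z'); last by rewrite /Dn /En /xt /yt; ring.
  by have [? _ ?] := PQS z' zL''; have [? ?] := IH z' zL''; apply: bound; rewrite ?nmN.
Qed.

(** Multiplication by [Phi(L)] leads back from the variables of [remainder] to the solution, at the
    price of a factor [2 M]. *)
Let column M l eta a b x0 y0 n :
  (forall z, 0 <= z <= L -> [/\ nm (f l z) <= M, nm (g l z) <= M, nm (h l z) <= M & nm (k l z) <= M]) ->
  (forall z, 0 <= z <= L -> nm (a z) <= M /\ nm (b z) <= M) -> 0 <= M ->
  zs u (l + eta) a b -> a 0 = x0 -> b 0 = y0 ->
  nm (a L - \sum_(j < n) (f l L * (X l x0 y0 j).1 L + h l L * (X l x0 y0 j).2 L) * eta ^+ j) <=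
     2 * M * (2 * M ^+ 2 * (4 * M ^+ 2 * L) ^+ n) * nm eta ^+ n /\
  nm (b L - \sum_(j < n) (g l L * (X l x0 y0 j).1 L + k l L * (X l x0 y0 j).2 L) * eta ^+ j) <=
     2 * M * (2 * M ^+ 2 * (4 * M ^+ 2 * L) ^+ n) * nm eta ^+ n.
Proof.
move=> HM Hab M0 Z a0 b0.
have LL : 0 <= L <= L by rewrite lexx ltW.
have [] := remainder n HM Hab M0 Z a0 b0 LL.
set dx := _ - \sum_(j < n) _; set dy := _ - \sum_(j < n) eta ^+ j * (X l x0 y0 j).2 L.
set B := 2 * M ^+ 2 * _ => hx hy.
have BE : 2 * M * (2 * M ^+ 2 * (4 * M ^+ 2 * L) ^+ n) * nm eta ^+ n = M * B + M * B.
  by rewrite /B [in RHS]exprMn; ring.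
have [f1 g1 h1 k1] := HM L LL; have dt := fund_det F l L.
have bd (p q : R[i]) : nm p <= M -> nm q <= M -> nm (p * dx + q * dy) <= M * B + M * B.
  by move=> p1 q1; apply: (le_trans (nmD _ _)); rewrite !nmM lerD// ler_pM ?nm_ge0.
have sumE (p q : R[i]) : \sum_(j < n) (p * (X l x0 y0 j).1 L + q * (X l x0 y0 j).2 L) * eta ^+ j =
   p * (\sum_(j < n) eta ^+ j * (X l x0 y0 j).1 L) + q * (\sum_(j < n) eta ^+ j * (X l x0 y0 j).2 L).
  rewrite !mulr_sumr -big_split; apply: eq_bigr => j _ /=.
  by move: (eta ^+ j) ((X l x0 y0 j).1 L) ((X l x0 y0 j).2 L) => s1 s2 s3; ring.
have aE : a L = f l L * (k l L * a L - h l L * b L) + h l L * (f l L * b L - g l L * a L).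
  by rewrite -[LHS]mul1r -dt; ring.
have bE : b L = g l L * (k l L * a L - h l L * b L) + k l L * (f l L * b L - g l L * a L).
  by rewrite -[LHS]mul1r -dt; ring.
rewrite BE !sumE; split.
  rewrite (_ : _ - _ = f l L * dx + h l L * dy); first exact: bd.
  by rewrite /dx /dy {1}aE; ring.
rewrite (_ : _ - _ = g l L * dx + k l L * dy); first exact: bd.
by rewrite /dx /dy {1}bE; ring.
Qed.

Let shifted_bounds rho : exists2 M, 0 <= M & forall l eta, nm l <= rho -> nm eta <= 1 ->
  forall z, 0 <= z <= L ->
  [/\ nm (f l z) <= M, nm (g l z) <= M, nm (h l z) <= M & nm (k l z) <= M] /\
  [/\ nm (f (l + eta) z) <= M, nm (g (l + eta) z) <= M,
      nm (h (l + eta) z) <= M & nm (k (l + eta) z) <= M].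
Proof.
have [M M1 HM] := fund_bound (rho + 1).
exists M; first exact: le_trans M1.
move=> l eta lr e1 z zL; split; apply: HM => //; first by lra.
by apply: (le_trans (nmD _ _)); lra.
Qed.

(** [C] depends on [rho] but not on the centre [l]; this uniformity is what allows second
    derivatives to be read off the expansion. *)
Lemma fund_taylor n rho : exists2 C, 0 <= C & forall l, nm l <= rho ->
  exists pf pg ph pk : {poly R[i]},
  [/\ size pf <= n, size pg <= n, size ph <= n & size pk <= n]%N /\ forall eta, nm eta <= 1 ->
  [/\ nm (f (l + eta) L - pf.[eta]) <= C * nm eta ^+ n,
      nm (g (l + eta) L - pg.[eta]) <= C * nm eta ^+ n,
      nm (h (l + eta) L - ph.[eta]) <= C * nm eta ^+ n &
      nm (k (l + eta) L - pk.[eta]) <= C * nm eta ^+ n].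
Proof.
have [M M0 HM] := shifted_bounds rho.
exists (2 * M * (2 * M ^+ 2 * (4 * M ^+ 2 * L) ^+ n)).
  by rewrite !mulr_ge0 ?sqr_ge0// exprn_ge0// !mulr_ge0 ?sqr_ge0// ltW.
move=> l lr.
pose poly x0 y0 (p q : R[i]) := \poly_(j < n) (p * (X l x0 y0 j).1 L + q * (X l x0 y0 j).2 L).
exists (poly 1 0 (f l L) (h l L)), (poly 1 0 (g l L) (k l L)),
  (poly 0 1 (f l L) (h l L)), (poly 0 1 (g l L) (k l L)); split.
  by split; exact: size_poly.
move=> eta e1.
rewrite !horner_poly.
have [Z1 Z2 [f0 g0] [h0 k0]] := F (l + eta).
have b1 z : 0 <= z <= L -> [/\ nm (f l z) <= M, nm (g l z) <= M, nm (h l z) <= M & nm (k l z) <= M].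
  by move=> zL; have [] := HM l eta lr e1 z zL.
have b2 z : 0 <= z <= L -> nm (f (l + eta) z) <= M /\ nm (g (l + eta) z) <= M.
  by move=> zL; have [_ [? ? ? ?]] := HM l eta lr e1 z zL.
have b3 z : 0 <= z <= L -> nm (h (l + eta) z) <= M /\ nm (k (l + eta) z) <= M.
  by move=> zL; have [_ [? ? ? ?]] := HM l eta lr e1 z zL.
have [? ?] := column n b1 b2 M0 Z1 f0 g0.
by have [? ?] := column n b1 b3 M0 Z2 h0 k0.
Qed.

(* For real l the conjugated matrix Phi^-1 sigma Phi has diagonal |f|^2 + |g|^2 and
   off-diagonal 2 (f g)^*, whose modulus is strictly smaller since |f|^2 - |g|^2 = 1. *)
Lemma fund_diff_real l : l^*%C = l -> exists p q C, nm q < p /\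
  forall eta, nm eta <= 1 ->
  nm (f (l + eta) L - (f l L - 'i%C * eta * (f l L * p%:C - h l L * q^*%C))) <= C * nm eta ^+ 2 /\
  nm (k (l + eta) L - (k l L - 'i%C * eta * (g l L * q - k l L * p%:C))) <= C * nm eta ^+ 2.
Proof.
move=> lreal.
have [M M0 HM] := shifted_bounds (nm l).
have [Z1 Z2 [f0 g0] [h0 k0]] := F l.
have hk z : h l z = (g l z)^*%C /\ k l z = (f l z)^*%C.
  by have := fund_conj D F l z; rewrite lreal.
pose P' z := nm (f l z) ^+ 2 + nm (g l z) ^+ 2.
have PE z : P l z = (P' z)%:C.
  have [hz kz] := hk z.
  by apply: complex_eq; rewrite /P /P' hz kz !sqr_nm !cE /=; ring.
have SE z : S l z = - (Q l z)^*%C.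
  have [hz kz] := hk z.
  by apply: complex_eq; rewrite /S /Q hz kz !cE /=; ring.
have [[P1 pP] [Q1 pQ] _] := cprimable_PQS l.
have pcP := cprim_cint pP; have pcQ := cprim_cint pQ.
pose p := Re (cint (P l) L); pose q := cint (Q l) L.
have ip z : Im (cint (P l) z) = 0.
  have := rprim_const pcP.2 _ z 0 => ->; last by apply: aeE => t; rewrite PE.
  by rewrite cint0.
have pE : cint (P l) L = p%:C by apply: complex_eq => //=; exact: ip.
have qp : nm q < p.
  (* A gap uniform in [z] keeps the inequality strict after integration. With [A = |f|] and
     [B = |g|], the relation [A^2 - B^2 = 1] gives [2 A B = A^2 + B^2 - (A + B)^-2], and
     [A + B <= 2 (M + 1)]. *)
  have M1 : 0 < 2 * (M + 1) by lra.
  have c0 : 0 < (2 * (M + 1)) ^- 2 by rewrite invr_gt0 exprn_gt0.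
  have pint := rprimB pcP.1 (rprimZ ((2 * (M + 1)) ^- 2) (rprim_id R)).
  have := cprim_le pcQ pint (ltW L0); rewrite !cint0 mulr0 !subr0 -/p -/q => W.
  have : 0 < (2 * (M + 1)) ^- 2 * L by rewrite mulr_gt0.
  suff : nm q <= p - (2 * (M + 1)) ^- 2 * L by lra.
  apply: W; apply: aeE => z zL; rewrite mulr1 PE /=.
  have [hz kz] := hk z.
  have n2 : nm 2 = 2 by rewrite (_ : 2 = 2%:C :> R[i]) ?nmR ?ger0_norm// rmorphMn.
  rewrite /Q hz kz !nmM !nmJ n2 /P'.
  have dt : nm (f l z) ^+ 2 - nm (g l z) ^+ 2 = 1.
    have := fund_det F l z; rewrite hz kz => /(congr1 (@complex.Re R)).
    by rewrite !cE !sqr_nm /=; lra.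
  have nl0 : nm (0 : R[i]) <= 1 by rewrite nm0.
  have [[fM gM _ _] _] := HM l 0 (lexx _) nl0 z zL.
  have := nm_ge0 (f l z); have := nm_ge0 (g l z); move: dt fM gM.
  set A := nm (f l z); set B := nm (g l z) => dt fM gM B0 A0.
  have AB : (A - B) * (A + B) = 1 by rewrite -subr_sqr.
  have AB0 : 0 < A + B.
    rewrite lt_neqAle addr_ge0// andbT eq_sym; apply/eqP => e; move: AB; rewrite e mulr0.
    by move/eqP; rewrite eq_sym oner_eq0.
  have -> : 2 * B * A = A ^+ 2 + B ^+ 2 - (A - B) ^+ 2 by ring.
  rewrite lerD2l lerN2.
  have -> : A - B = (A + B)^-1 by rewrite -[LHS](mulfK (lt0r_neq0 AB0)) AB mul1r.
  rewrite exprVn lef_pV2 ?posrE ?exprn_gt0// ler_sqr ?nnegrE ?(ltW AB0) ?(ltW M1)//; lra.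
have x1E : (X l 1 0 1).1 L = - 'i%C * p%:C.
  have [_ _ p1 _] := cprim_X l 1 0 0.
  have := cprim_const (cprimB p1 (cprimZ (- 'i%C) pcP)) _ L 0.
  rewrite (X0 l 1 0 0).1 cint0 mulr0 subr0 pE => W; apply/eqP; rewrite -subr_eq0; apply/eqP; apply: W.
  by apply: aeE => z; rewrite /X /=; ring.
have y1E : (X l 1 0 1).2 L = 'i%C * q^*%C.
  have [_ _ _ p1] := cprim_X l 1 0 0.
  have := cprim_const (cprimB p1 (cprimZ 'i%C (cprim_conj pcQ))) _ L 0.
  rewrite (X0 l 1 0 0).2 cint0 conjc0 mulr0 subr0 -/q => W; apply/eqP; rewrite -subr_eq0; apply/eqP; apply: W.
  by apply: aeE => z; rewrite /X /= SE; ring.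
have x2E : (X l 0 1 1).1 L = - 'i%C * q.
  have [_ _ p1 _] := cprim_X l 0 1 0.
  have := cprim_const (cprimB p1 (cprimZ (- 'i%C) pcQ)) _ L 0.
  rewrite (X0 l 0 1 0).1 cint0 mulr0 subr0 -/q => W; apply/eqP; rewrite -subr_eq0; apply/eqP; apply: W.
  by apply: aeE => z; rewrite /X /=; ring.
have y2E : (X l 0 1 1).2 L = 'i%C * p%:C.
  have [_ _ _ p1] := cprim_X l 0 1 0.
  have := cprim_const (cprimB p1 (cprimZ 'i%C pcP)) _ L 0.
  rewrite (X0 l 0 1 0).2 cint0 mulr0 subr0 pE => W; apply/eqP; rewrite -subr_eq0; apply/eqP; apply: W.
  by apply: aeE => z; rewrite /X /=; ring.
exists p, q, (2 * M * (2 * M ^+ 2 * (4 * M ^+ 2 * L) ^+ 2)); split => // eta e1.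
have [Z3 Z4 [f0' g0'] [h0' k0']] := F (l + eta).
have b1 z : 0 <= z <= L -> [/\ nm (f l z) <= M, nm (g l z) <= M, nm (h l z) <= M & nm (k l z) <= M].
  by move=> zL; have [] := HM l eta (lexx _) e1 z zL.
have b2 z : 0 <= z <= L -> nm (f (l + eta) z) <= M /\ nm (g (l + eta) z) <= M.
  by move=> zL; have [_ [? ? ? ?]] := HM l eta (lexx _) e1 z zL.
have b3 z : 0 <= z <= L -> nm (h (l + eta) z) <= M /\ nm (k (l + eta) z) <= M.
  by move=> zL; have [_ [? ? ? ?]] := HM l eta (lexx _) e1 z zL.
have [c1 _] := column 2 b1 b2 M0 Z3 f0' g0'.
have [_ c2] := column 2 b1 b3 M0 Z4 h0' k0'.
split.
  apply: le_trans c1; rewrite le_eqVlt; apply/orP; left; apply/eqP; congr (nm (_ - _)).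
  transitivity ((f l L * 1 + h l L * 0) + (f l L * (X l 1 0 1).1 L + h l L * (X l 1 0 1).2 L) * eta).
    by rewrite x1E y1E; ring.
  by rewrite !big_ord_recr big_ord0 /= add0r expr0 expr1 !mulr1.
apply: le_trans c2; rewrite le_eqVlt; apply/orP; left; apply/eqP; congr (nm (_ - _)).
transitivity ((g l L * 0 + k l L * 1) + (g l L * (X l 0 1 1).1 L + k l L * (X l 0 1 1).2 L) * eta).
  by rewrite x2E y2E; ring.
by rewrite !big_ord_recr big_ord0 /= add0r expr0 expr1 !mulr1.
Qed.

End Taylor.

(** * Local expansions of functions of a complex variable *)

Section Jets.
Variable R : realType.
Implicit Types (F G H K : R[i] -> R[i]) (l eta : R[i]) (p q : {poly R[i]}) (C : R).

Local Notation Re := complex.Re.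
Local Notation Im := complex.Im.
Local Notation nm := (@ComplexField.Normc.normc R).

Lemma poly_nm_bounded p : exists2 B, 0 <= B & forall eta, nm eta <= 1 -> nm p.[eta] <= B.
Proof.
exists (\sum_(j < size p) nm p`_j); first by apply: sumr_ge0 => j _; exact: nm_ge0.
move=> eta e1; rewrite horner_coef; apply: (le_trans (nm_sum _)).
apply: ler_sum => j _; rewrite nmM nmX ler_piMr ?nm_ge0// exprn_ile1 ?nm_ge0//.
Qed.

(* The polynomial in [jet n F l] is not required to have degree below [n], so
   that jets multiply without truncation. *)
Definition jet n F l := exists p C d, [/\ 0 <= C, 0 < d <= 1 &
  forall eta, nm eta < d -> nm (F (l + eta) - p.[eta]) <= C * nm eta ^+ n].

Lemma jet_cst n c l : jet n (fun=> c) l.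
Proof.
exists c%:P, 0, 1; split => //; first by rewrite ltr01 lexx.
by move=> eta _; rewrite hornerC subrr nm0 mul0r.
Qed.

Lemma jet_id n l : jet n (fun x => x) l.
Proof.
exists (l%:P + 'X), 0, 1; split => //; first by rewrite ltr01 lexx.
by move=> eta _; rewrite hornerD hornerC hornerX subrr nm0 mul0r.
Qed.

Lemma jet_eq n F G l d : 0 < d -> (forall eta, nm eta < d -> F (l + eta) = G (l + eta)) ->
  jet n F l -> jet n G l.
Proof.
move=> d0 FG [p [C [d' [C0 /andP[d'0 d'1] H]]]].
exists p, C, (Num.min d d'); split => //; first by rewrite lt_min d0 d'0 ge_min d'1 orbT.
by move=> eta; rewrite lt_min => /andP[e1 e2]; rewrite -FG// H.
Qed.

Lemma jetD n F G l : jet n F l -> jet n G l -> jet n (fun x => F x + G x) l.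
Proof.
move=> [p [C [d [C0 /andP[d0 d1] H]]]] [p' [C' [d' [C'0 /andP[d'0 d'1] H']]]].
exists (p + p'), (C + C'), (Num.min d d'); split; first exact: addr_ge0.
  by rewrite lt_min d0 d'0 ge_min d'1 orbT.
move=> eta; rewrite lt_min => /andP[e1 e2]; rewrite hornerD.
rewrite (_ : _ - _ = (F (l + eta) - p.[eta]) + (G (l + eta) - p'.[eta])); last by ring.
by apply: (le_trans (nmD _ _)); rewrite mulrDl lerD ?H ?H'.
Qed.

Lemma jetM n F G l : jet n F l -> jet n G l -> jet n (fun x => F x * G x) l.
Proof.
move=> [p [C [d [C0 /andP[d0 d1] H]]]] [p' [C' [d' [C'0 /andP[d'0 d'1] H']]]].
have [B B0 HB] := poly_nm_bounded p; have [B' B'0 HB'] := poly_nm_bounded p'.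
exists (p * p'), ((B + C) * C' + C * B'), (Num.min d d'); split.
- by rewrite addr_ge0 ?mulr_ge0 ?addr_ge0.
- by rewrite lt_min d0 d'0 ge_min d'1 orbT.
move=> eta; rewrite lt_min => /andP[e1 e2]; rewrite hornerM.
have n1 : nm eta <= 1 by rewrite (le_trans (ltW e1)).
have N0 : 0 <= nm eta ^+ n by rewrite exprn_ge0 ?nm_ge0.
have h := H _ e1; have h' := H' _ e2.
have hF : nm (F (l + eta)) <= B + C.
  rewrite -[F _](subrK p.[eta]) addrC; apply: (le_trans (nmD _ _)); rewrite lerD ?HB//.
  by apply: (le_trans h); rewrite ler_piMr// exprn_ile1 ?nm_ge0.
rewrite (_ : _ - _ = F (l + eta) * (G (l + eta) - p'.[eta]) + (F (l + eta) - p.[eta]) * p'.[eta]); last by ring.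
apply: (le_trans (nmD _ _)); rewrite !nmM mulrDl lerD//.
  by rewrite -mulrA ler_pM ?nm_ge0.
by rewrite mulrAC ler_pM ?nm_ge0// HB'.
Qed.

Lemma jetN n F l : jet n F l -> jet n (fun x => - F x) l.
Proof.
move=> jF; apply: (jet_eq ltr01 _ (jetM (jet_cst n (- 1) l) jF)) => eta _.
by rewrite mulN1r.
Qed.

Lemma jetB n F G l : jet n F l -> jet n G l -> jet n (fun x => F x - G x) l.
Proof. by move=> jF /jetN; exact: jetD. Qed.

Lemma jetX n F l m : jet n F l -> jet n (fun x => F x ^+ m) l.
Proof.
move=> jF; elim: m => [|m IH]; first exact: jet_cst.
by apply: (jet_eq ltr01 _ (jetM jF IH)) => eta _; rewrite exprS.
Qed.

Lemma jet_lipschitz n F l : jet n.+1 F l ->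
  exists C d, [/\ 0 <= C, 0 < d <= 1 & forall eta, nm eta < d -> nm (F (l + eta) - F l) <= C * nm eta].
Proof.
move=> [p [C [d [C0 /andP[d0 d1] H]]]].
have p0 : F l = p.[0].
  have := H 0; rewrite nm0 addr0 exprS mul0r mulr0 => /(_ d0) h.
  by apply/eqP; rewrite -subr_eq0 -nm_eq0 eq_le h nm_ge0.
pose q := p %/ 'X.
have pE : p = q * 'X + (p.[0])%:P.
  have := divp_eq p ('X - 0%:P); rewrite modp_XsubC subr0 => {1}->.
  by [].
have [B B0 HB] := poly_nm_bounded q.
exists (C + B), d; split; [exact: addr_ge0|by rewrite d0|] => eta ed.
have e1 : nm eta <= 1 by rewrite (le_trans (ltW ed)).
rewrite p0 (_ : _ - _ = (F (l + eta) - p.[eta]) + q.[eta] * eta); last first.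
  by rewrite [in p.[eta]]pE !hornerE; ring.
apply: (le_trans (nmD _ _)); rewrite mulrDl lerD//.
  apply: (le_trans (H _ ed)); rewrite ler_wpM2l// exprS ler_piMr ?nm_ge0//.
  by rewrite exprn_ile1 ?nm_ge0.
by rewrite nmM ler_wpM2r ?nm_ge0// HB.
Qed.

(** A truncated power series inverse, from Bezout's identity with ['X^n]. *)
Lemma poly_inv_mod p n : p.[0] != 0 -> exists q r : {poly R[i]}, p * q = 1 + r * 'X^n.
Proof.
move=> p0.
have : coprimep p 'X^n by apply: coprimep_expr; rewrite coprimepX.
move=> /Bezout_eq1_coprimepP [[a b] /= ab].
by exists a, (- b); rewrite -ab; ring.
Qed.

Lemma jetV n F l : jet n.+1 F l -> F l != 0 -> jet n.+1 (fun x => (F x)^-1) l.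
Proof.
move=> jF F0; have [C1 [d1 [C10 /andP[d10 d11] H1]]] := jet_lipschitz jF.
have [p [C [d [C0 /andP[d0 d_1] H]]]] := jF.
have p0 : p.[0] = F l.
  have := H 0; rewrite nm0 addr0 exprS mul0r mulr0 => /(_ d0) h.
  by apply/eqP; rewrite eq_sym -subr_eq0 -nm_eq0 eq_le h nm_ge0.
have [q [r pq]] : exists q r : {poly R[i]}, p * q = 1 + r * 'X^(n.+1).
  by apply: poly_inv_mod; rewrite p0.
have [B B0 HB] := poly_nm_bounded q; have [B' B'0 HB'] := poly_nm_bounded r.
have a0 : 0 < nm (F l) by rewrite nm_gt0.
(* A radius within which the Lipschitz bound keeps [|F|] above half of its value at [l]. *)
pose d2 := nm (F l) / (2 * (C1 + 1)).
have d20 : 0 < d2 by rewrite divr_gt0// mulr_gt0// ltr_wpDl.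
exists q, (2 / nm (F l) * (B' + C * B)), (Num.min d2 (Num.min d d1)); split.
- by apply: mulr_ge0; [rewrite divr_ge0// ltW|rewrite addr_ge0 ?mulr_ge0].
- by rewrite !lt_min d20 d0 d10 !ge_min d_1 orbT.
move=> eta; rewrite !lt_min => /and3P[e2 ed e1'].
have e1 : nm eta <= 1 by rewrite (le_trans (ltW ed)).
have low : nm (F l) / 2 <= nm (F (l + eta)).
  have := H1 _ e1'; have : nm (F l) <= nm (F (l + eta)) + nm (F (l + eta) - F l).
    by rewrite nmBC; apply: le_trans (nmD _ _); rewrite addrC subrK.
  have : C1 * nm eta <= nm (F l) / 2.
    apply: (@le_trans _ _ ((C1 + 1) * d2)).
      by apply: ler_pM; rewrite ?nm_ge0 ?(ltW e2)//; lra.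
    by rewrite /d2 le_eqVlt; apply/orP; left; apply/eqP; field; rewrite gt_eqF// ltr_wpDl.
  lra.
have Fn0 : F (l + eta) != 0 by rewrite -nm_gt0; lra.
rewrite (_ : _ - _ = (F (l + eta))^-1 * (- (r.[eta] * eta ^+ n.+1) - (F (l + eta) - p.[eta]) * q.[eta])); last first.
  have : p.[eta] * q.[eta] = 1 + r.[eta] * eta ^+ n.+1.
    by rewrite -hornerM pq !hornerE.
  move=> E; rewrite (_ : - _ - _ = 1 - F (l + eta) * q.[eta]); last first.
    by rewrite mulrBl E; ring.
  by field.
rewrite nmM nmV -[_ * _ * nm eta ^+ _]mulrA ler_pM ?invr_ge0 ?nm_ge0//.
  rewrite -[2 / _]invf_div lef_pV2 ?posrE ?divr_gt0//.
  by rewrite (lt_le_trans _ low)// divr_gt0.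
apply: (le_trans (nmB _ _)); rewrite nmN !nmM nmX mulrDl lerD//.
  by rewrite ler_wpM2r ?exprn_ge0 ?nm_ge0// HB'.
rewrite mulrAC ler_pM ?nm_ge0//; first exact: H.
exact: HB.
Qed.

Lemma le0_of_small (a M d : R) : 0 < d -> (forall t, 0 < t < d -> a <= M * t) -> a <= 0.
Proof.
move=> d0 H; rewrite leNgt; apply/negP => a0.
have M0 : 0 < `|M| + 1 by rewrite ltr_wpDl.
pose t := Num.min (d / 2) (a / (2 * (`|M| + 1))).
have t0 : 0 < t by rewrite lt_min !divr_gt0// mulr_gt0.
have t1 : t <= a / (2 * (`|M| + 1)) by rewrite ge_min lexx orbT.
have t2 : t <= d / 2 by rewrite ge_min lexx.
have : a <= M * t by apply: H; rewrite t0; lra.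
apply/negP; rewrite -ltNge.
apply: (@le_lt_trans _ _ ((`|M| + 1) * (a / (2 * (`|M| + 1))))).
  apply: (@le_trans _ _ ((`|M| + 1) * t)); last by rewrite ler_wpM2l// ltW.
  by rewrite ler_wpM2r ?(ltW t0)//; have := ler_norm M; lra.
have -> : (`|M| + 1) * (a / (2 * (`|M| + 1))) = a / 2 by field; rewrite gt_eqF.
by lra.
Qed.

Lemma poly_divX p : p = (p %/ 'X) * 'X + (p.[0])%:P.
Proof. by have := divp_eq p ('X - 0%:P); rewrite modp_XsubC subr0 => {1}->. Qed.

(** The constant term vanishes by letting [eta] tend to 0, and the bound is then divided by [eta];
    this is why it is asked for nonzero [eta] only. *)
Lemma poly_small p n C (d : R) : 0 < d <= 1 ->
  (forall eta, eta != 0 -> nm eta < d -> nm p.[eta] <= C * nm eta ^+ n) ->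
  exists q, p = q * 'X^n.
Proof.
move=> /andP[d0 d1].
elim: n p C => [|n IH] p C H; first by exists p; rewrite expr0 mulr1.
pose q := p %/ 'X.
have pE : p = q * 'X + (p.[0])%:P := poly_divX p.
have [B B0 HB] := poly_nm_bounded q.
have p0 : p.[0] = 0.
  apply/eqP; rewrite -nm_eq0 eq_le nm_ge0 andbT; apply: (@le0_of_small _ (`|C| + B) d d0) => t /andP[t0 td].
  have t1 : t <= 1 by lra.
  have nt : nm t%:C = t by rewrite nmR gtr0_norm.
  have tn : t ^+ n <= 1 by rewrite exprn_ile1// ltW.
  have tn0 : 0 <= t ^+ n by rewrite exprn_ge0// ltW.
  have := H t%:C _ _; rewrite nt -nm_gt0 nt => /(_ t0 td) h.
  have h2 := HB t%:C; rewrite nt in h2; have {}h2 := h2 t1.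
  have -> : p.[0] = p.[t%:C] - q.[t%:C] * t%:C by rewrite {2}pE !hornerE; ring.
  apply: (le_trans (nmB _ _)); rewrite mulrDl nmM nt lerD//; last by rewrite ler_wpM2r// ltW.
  apply: (le_trans h); rewrite exprS mulrCA mulrC.
  apply: (@le_trans _ _ (`|C| * t ^+ n * t)).
    by rewrite ler_wpM2r ?(ltW t0)// ler_wpM2r// ler_norm.
  by rewrite ler_wpM2r ?(ltW t0)// ler_piMr.
have [r qE] : exists r, q = r * 'X^n.
  apply: (IH _ C) => eta e0 e1.
  have := H eta e0 e1; rewrite pE p0 hornerD hornerC addr0 hornerMX nmM exprSr mulrA.
  by rewrite ler_pM2r// nm_gt0.
by exists r; rewrite pE p0 addr0 qE exprSr mulrA.
Qed.

Lemma taylor_coef_eq n F G l p q C C' d : 0 < d <= 1 ->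
  (forall eta, nm eta < d -> F (l + eta) = G (l + eta)) ->
  (forall eta, nm eta < d -> nm (F (l + eta) - p.[eta]) <= C * nm eta ^+ n) ->
  (forall eta, nm eta < d -> nm (G (l + eta) - q.[eta]) <= C' * nm eta ^+ n) ->
  forall j, (j < n)%N -> p`_j = q`_j.
Proof.
move=> d01 FG HF HG j jn.
have [r E] : exists r, p - q = r * 'X^n.
  apply: (@poly_small _ n (C + C') d d01) => eta _ ed.
  rewrite hornerD hornerN (_ : _ - _ = (G (l + eta) - q.[eta]) - (F (l + eta) - p.[eta])); last first.
    by rewrite FG//; ring.
  by apply: (le_trans (nmB _ _)); rewrite mulrDl addrC lerD ?HF ?HG.
have := congr1 (fun s : {poly R[i]} => s`_j) E.
by rewrite coefB coefMXn jn => /eqP; rewrite subr_eq0 => /eqP.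
Qed.

Lemma jetW n F l : jet n.+1 F l -> jet n F l.
Proof.
move=> [p [C [d [C0 /andP[d0 d1] H]]]]; exists p, C, d; split; rewrite ?d0//.
move=> eta ed; apply: (le_trans (H _ ed)); rewrite ler_wpM2l// exprS ler_piMl ?exprn_ge0 ?nm_ge0//.
by rewrite (le_trans (ltW ed)).
Qed.

(** [v] is the value that fills the removable singularity. *)
Lemma jet_div1 n F l : jet n.+1 F l -> F l = 0 ->
  exists v, jet n (fun x => if x == l then v else F x / (x - l)) l.
Proof.
move=> [p [C [d [C0 /andP[d0 d1] H]]]] F0.
have p0 : p.[0] = 0.
  have := H 0; rewrite nm0 addr0 exprS mul0r mulr0 F0 sub0r nmN => /(_ d0) h.
  by apply/eqP; rewrite -nm_eq0 eq_le h nm_ge0.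
have pE := poly_divX p; rewrite p0 addr0 in pE.
exists (p %/ 'X).[0], (p %/ 'X), C, d; split; rewrite ?d0// => eta ed.
case: ifPn => [/eqP e|en0].
  have -> : eta = 0 by apply: (addrI l); rewrite e addr0.
  by rewrite subrr nm0 mulr_ge0// exprn_ge0.
have e0 : eta != 0 by apply: contra_neq en0 => ->; rewrite addr0.
have ne0 : 0 < nm eta by rewrite nm_gt0.
rewrite -(ler_pM2r ne0) -nmM -mulrA -exprSr; apply: le_trans (H _ ed).
rewrite le_eqVlt; apply/orP; left; apply/eqP; congr nm.
rewrite [in RHS]pE hornerMX [l + eta]addrC addrK; field.
exact: e0.
Qed.

(** Division by [(x - l) ^+ 2] costs two orders, hence the jet of order 5. Uniqueness of Taylor
    coefficients identifies its first three with those of [p]. *)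
Lemma jet_div2 F l p C : jet 5 F l ->
  (forall eta, nm eta <= 1 -> nm (F (l + eta) - p.[eta]) <= C * nm eta ^+ 3) ->
  p`_0 = 0 -> p`_1 = 0 ->
  jet 3 (fun x => if x == l then p`_2 else F x / (x - l) ^+ 2) l.
Proof.
move=> [q [C' [d [C'0 /andP[d0 d1] H]]]] Hp p0 p1.
have qp : forall j, (j < 3)%N -> q`_j = p`_j.
  apply: (@taylor_coef_eq 3 F F l q p C' C d) => //; first by rewrite d0.
    move=> eta ed; apply: (le_trans (H _ ed)); rewrite ler_wpM2l// (exprD _ 2 3) ler_piMl ?exprn_ge0 ?nm_ge0//.
    by rewrite exprn_ile1 ?nm_ge0// (le_trans (ltW ed)).
  by move=> eta ed; apply: Hp; rewrite (le_trans (ltW ed)).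
pose r := drop_poly 2 q.
have qE : q = r * 'X^2.
  rewrite -[LHS](poly_take_drop 2) (_ : take_poly 2 q = 0) ?add0r//.
  apply/polyP => j; rewrite coef_take_poly coef0.
  by case: ltnP => // j2; rewrite qp; [case: j j2 => [|[]]|rewrite (ltn_trans j2)].
have r0 : r.[0] = p`_2 by rewrite horner_coef0 coef_drop_poly qp.
exists r, C', d; split; rewrite ?d0// => eta ed.
case: ifPn => [/eqP e|en0].
  have -> : eta = 0 by apply: (addrI l); rewrite e addr0.
  by rewrite r0 subrr nm0 mulr_ge0// exprn_ge0.
have e0 : eta != 0 by apply: contra_neq en0 => ->; rewrite addr0.
have ne0 : 0 < nm eta ^+ 2 by rewrite exprn_gt0 ?nm_gt0.
rewrite -(ler_pM2r ne0) -[in leLHS]nmX -nmM -mulrA -exprD; apply: le_trans (H _ ed).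
rewrite le_eqVlt; apply/orP; left; apply/eqP; congr nm.
rewrite [in RHS]qE hornerM hornerXn [l + eta]addrC addrK; field.
exact: e0.
Qed.

End Jets.

(** * Liouville's theorem *)

Section Derivatives.
Variable R : realType.
Implicit Types (F G : R[i] -> R[i]) (l eta : R[i]) (p q : {poly R[i]}) (C : R).

Local Notation Re := complex.Re.
Local Notation Im := complex.Im.
Local Notation nm := (@ComplexField.Normc.normc R).

Lemma nm_nat n : nm n%:R = n%:R.
Proof. by rewrite (_ : n%:R = n%:R%:C :> R[i]) ?nmR ?ger0_norm// rmorphMn. Qed.

Lemma derive1_complex F l (d : R[i]) (C r : R) : 0 < r -> 0 <= C ->
  (forall eta, nm eta <= r -> nm (F (l + eta) - F l - d * eta) <= C * nm eta ^+ 2) ->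
  derive1 (F : R[i] -> R[i]^o) l = d.
Proof.
move=> r0 C0 H; rewrite /derive1; apply/cvg_lim; first exact: norm_hausdorff.
apply/cvgrPdist_le => e e0.
have er : e = (Re e)%:C by rewrite RRe_real// gtr0_real.
have re0 : 0 < Re e by move: e0; rewrite {1}er ltcR.
have C10 : 0 < C + 1 by lra.
exists (Num.min r (Re e / (C + 1)))%:C.
  by rewrite /= ltcR lt_min r0 divr_gt0.
move=> eta; rewrite /ball_/= sub0r normrN nm_norm ltcR lt_min => /andP[e1 e2] en0.
rewrite nm_norm er lecR.
have n0 : 0 < nm eta by rewrite nm_gt0.
rewrite (_ : d - _ = - (eta^-1 * (F (l + eta) - F l - d * eta))); last first.
  by rewrite /GRing.scale /= [eta + l]addrC; field.
rewrite nmN nmM nmV ler_pdivrMl//.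
apply: (le_trans (H _ (ltW e1))); rewrite expr2 mulrCA ler_wpM2l ?nm_ge0//.
apply: (@le_trans _ _ ((C + 1) * nm eta)); first by rewrite ler_wpM2r ?nm_ge0//; lra.
by rewrite mulrC -ler_pdivlMr// ltW.
Qed.

(* Taylor expansions of order n with a remainder that is uniform in the centre. *)
Definition ujet n F := forall rho, exists2 C, 0 <= C & forall l, nm l <= rho ->
  exists2 p : {poly R[i]}, (size p <= n)%N &
    forall eta, nm eta <= 1 -> nm (F (l + eta) - p.[eta]) <= C * nm eta ^+ n.

Lemma ujet_jet n F l : ujet n F -> jet n F l.
Proof.
move=> /(_ (nm l))[C C0 H]; have [p _ Hp] := H l (lexx _).
exists p, C, 1; split => //; first by rewrite ltr01 lexx.
by move=> eta /ltW; exact: Hp.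
Qed.

Lemma ujet_affine n F (a b c : R[i]) : ujet n.+1 F -> ujet n.+1 (fun l => a * F (l + b) + c).
Proof.
move=> uF rho; have [C C0 H] := uF (rho + nm b).
exists (nm a * C); first by rewrite mulr_ge0 ?nm_ge0.
move=> l lr; have [|p sp Hp] := H (l + b).
  by apply: (le_trans (nmD _ _)); rewrite lerD2r.
exists (a *: p + c%:P).
  apply: leq_trans (size_polyD _ _) _; rewrite geq_max (leq_trans (size_scale_leq _ _) sp)/=.
  exact: leq_trans (size_polyC_leq1 _) _.
move=> eta e1; rewrite !hornerE [l + eta + b]addrAC.
rewrite (_ : _ - _ = a * (F (l + b + eta) - p.[eta])); last by ring.
by rewrite nmM -mulrA ler_wpM2l ?nm_ge0// Hp.
Qed.

Lemma horner_size3 p eta : (size p <= 3)%N -> p.[eta] = p`_0 + p`_1 * eta + p`_2 * eta ^+ 2.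
Proof.
move=> sp; rewrite (horner_coef_wide _ sp) !big_ord_recr big_ord0 /=.
by rewrite expr0 expr1; ring.
Qed.

(** The derivative at [l + eta] is the coefficient [q_1] of the expansion there. Evaluating that
    expansion at [eta] and [- eta], and the one at [l] at [2 eta] and 0, expresses
    [F (l + 2 eta) - F l] in two ways, so [q_1 - p_1 = 2 p_2 eta + O(eta^2)] thanks to the common
    remainder constant. The errors add up to [10 C |eta|^3], whence [5 * C] after division by
    [2 |eta|]. *)
Lemma ujet3_derive F : ujet 3 F -> forall l, exists p C, [/\ 0 <= C,
  forall eta, nm eta <= 1 -> nm (F (l + eta) - p.[eta]) <= C * nm eta ^+ 3,
  derive1n 0 (F : R[i] -> R[i]^o) l = p`_0, derive1n 1 (F : R[i] -> R[i]^o) l = p`_1 &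
  derive1n 2 (F : R[i] -> R[i]^o) l = 2 * p`_2].
Proof.
move=> uF.
have first_deriv l C p : (size p <= 3)%N -> 0 <= C ->
    (forall eta, nm eta <= 1 -> nm (F (l + eta) - p.[eta]) <= C * nm eta ^+ 3) ->
    F l = p`_0 /\ derive1 (F : R[i] -> R[i]^o) l = p`_1.
  move=> sp C0 H.
  have p0 : F l = p`_0.
    have := H 0; rewrite nm0 ler01 => /(_ isT); rewrite addr0 horner_coef0 expr0n mulr0 => h.
    by apply/eqP; rewrite -subr_eq0 -nm_eq0 eq_le h nm_ge0.
  split => //; apply: (@derive1_complex _ _ _ (C + nm p`_2) 1) => // [|eta e1].
    by rewrite addr_ge0 ?nm_ge0.
  rewrite (_ : _ - _ = (F (l + eta) - p.[eta]) + p`_2 * eta ^+ 2); last first.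
    by rewrite p0 horner_size3//; ring.
  apply: (le_trans (nmD _ _)); rewrite nmM nmX mulrDl lerD2r.
  apply: (le_trans (H _ e1)); rewrite ler_wpM2l// exprS ler_piMl// exprn_ge0 ?nm_ge0//.
move=> l.
have [C C0 H] := uF (nm l + 1).
have [|p sp Hp] := H l; first by rewrite lerDl.
have [p0 p1] := first_deriv l C p sp C0 Hp.
exists p, C; split => //.
rewrite derive1nS derive1n1.
apply: (@derive1_complex _ _ _ (5 * C) (1 / 2)) => // [|eta e2]; first by rewrite mulr_ge0.
have e1 : nm eta <= 1 by lra.
rewrite p1.
have [->|en0] := eqVneq eta 0.
  by rewrite addr0 p1 mulr0 subr0 subrr nm0 expr0n mulr0.
have [|q sq Hq] := H (l + eta); first by apply: (le_trans (nmD _ _)); rewrite lerD2l.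
have [q0 q1] := first_deriv (l + eta) C q sq C0 Hq; rewrite q1.
have e0 : 0 < nm eta by rewrite nm_gt0.
have h1 := Hq eta e1; have h2 := Hq (- eta); rewrite nmN in h2; have {}h2 := h2 e1.
have h3 := Hp (eta + eta); have h4 := Hp 0.
rewrite addr0 nm0 expr0n mulr0 ler01 in h4; have {}h4 := h4 isT.
rewrite -addrA in h1; rewrite addrK in h2.
have n2e : nm (eta + eta) = 2 * nm eta.
  by rewrite (_ : eta + eta = 2 * eta) ?nmM ?nm_nat//; ring.
rewrite n2e in h3; have {}h3 := h3 _.
have {}h3 : nm (F (l + (eta + eta)) - p.[eta + eta]) <= C * (2 * nm eta) ^+ 3 by apply: h3; lra.
rewrite !horner_size3// in h1 h2 h3 h4.
rewrite -(ler_pM2r e0) -nmM -(ler_pM2l (ltr0n R 2)) -nm_nat -nmM.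
rewrite (_ : 2 * _ = (F (l + (eta + eta)) - (p`_0 + p`_1 * (eta + eta) + p`_2 * (eta + eta) ^+ 2))
   - (F l - (p`_0 + p`_1 * 0 + p`_2 * 0 ^+ 2))
   + (F l - (q`_0 + q`_1 * - eta + q`_2 * (- eta) ^+ 2))
   - (F (l + (eta + eta)) - (q`_0 + q`_1 * eta + q`_2 * eta ^+ 2))); last by ring.
apply: (le_trans (nmB _ _)); have := nmD (F (l + (eta + eta)) - (p`_0 + p`_1 * (eta + eta) + p`_2 * (eta + eta) ^+ 2)
   - (F l - (p`_0 + p`_1 * 0 + p`_2 * 0 ^+ 2))) (F l - (q`_0 + q`_1 * - eta + q`_2 * (- eta) ^+ 2)).
have := nmB (F (l + (eta + eta)) - (p`_0 + p`_1 * (eta + eta) + p`_2 * (eta + eta) ^+ 2))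
   (F l - (p`_0 + p`_1 * 0 + p`_2 * 0 ^+ 2)).
have -> : nm 2 * (5 * C * nm eta ^+ 2 * nm eta) = C * (2 * nm eta) ^+ 3 + 2 * (C * nm eta ^+ 3).
  by rewrite nm_nat; ring.
lra.
Qed.

End Derivatives.

Section Liouville.
Variable R : realType.
Implicit Types (F G H K : R[i] -> R[i]) (l eta : R[i]) (p q : {poly R[i]}) (C : R).

Local Notation Re := complex.Re.
Local Notation Im := complex.Im.
Local Notation nm := (@ComplexField.Normc.normc R).

Lemma nm_sqr_add l eta : nm (l + eta) ^+ 2 = nm l ^+ 2 + nm eta ^+ 2 + 2 * (Re l * Re eta + Im l * Im eta).
Proof. by rewrite !sqr_nm !cE; ring. Qed.

Lemma disc_max (v : R[i] -> R) (r : R) : 0 <= r ->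
  (forall l e, 0 < e -> exists2 d, 0 < d & forall eta, nm eta < d -> `|v (l + eta) - v l| < e) ->
  exists2 l, nm l <= r & forall l', nm l' <= r -> v l' <= v l.
Proof.
move=> r0 cv.
pose A : set (R * R) := [set xy | xy.1 ^+ 2 + xy.2 ^+ 2 <= r ^+ 2].
have memA l : A (Re l, Im l) <-> nm l <= r.
  by rewrite /A /= -sqr_nm; split; rewrite ler_sqr ?nnegrE ?nm_ge0.
have c1 : continuous (fun xy : R * R => xy.1 ^+ 2 + xy.2 ^+ 2).
  rewrite (_ : (fun _ => _) = fun xy : R * R => xy.1 * xy.1 + xy.2 * xy.2) => [xy|]; last first.
    by apply/funext => xy; rewrite !expr2.
  by apply: cvgD; apply: cvgM; [exact: cvg_fst|exact: cvg_fst|exact: cvg_snd|exact: cvg_snd].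
have cA : compact A.
  apply: (@subclosed_compact _ _ (`[- r, r]%classic `*` `[- r, r]%classic)).
  - exact: (closed_comp (fun x _ => c1 x) (@closed_le R (r ^+ 2))).
  - by apply: compact_setX; exact: segment_compact.
  - move=> [x y]; rewrite /A /= => xy; rewrite !in_itv /= -!ler_norml.
    have := sqr_ge0 x; have := sqr_ge0 y => y0 x0.
    by split; rewrite -(ler_sqr (normr_nneg _)) ?nnegrE// real_normK ?num_real//; lra.
have A0 : A !=set0 by exists (0, 0); rewrite /A /= expr0n addr0 sqr_ge0.
pose f (xy : R * R) := v (xy.1 +i* xy.2).
have cf : {within A, continuous f}.
  apply: continuous_subspaceT => -[x y]; apply/cvgrPdist_lt => e e0.
  have [d d0 Hd] := cv (x +i* y) e e0.
  have d20 : 0 < d / 2 by rewrite divr_gt0.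
  near=> xy.
  have xy1 : `|x - xy.1| < d / 2.
    by near: xy; exists (ball x (d / 2), setT) => //=; [split; [exact: nbhsx_ballx|exact: filterT]|move=> [? ?] []].
  have xy2 : `|y - xy.2| < d / 2.
    by near: xy; exists (setT, ball y (d / 2)) => //=; [split; [exact: filterT|exact: nbhsx_ballx]|move=> [? ?] []].
  rewrite distrC /f /=.
  have -> : xy.1 +i* xy.2 = (x +i* y) + ((xy.1 - x) +i* (xy.2 - y)).
    by apply: complex_eq; rewrite !cE /=; ring.
  apply: Hd; apply: (le_lt_trans (nm_le_ReIm _)) => /=; rewrite [`|xy.1 - x|]distrC [`|xy.2 - y|]distrC; lra.
have [[x y] Axy Hmax] := compact_EVT_max A0 cA cf.
exists (x +i* y); first by apply/memA; rewrite inE in Axy.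
move=> l' /memA l'r; have := Hmax (Re l', Im l'); rewrite inE => /(_ l'r).
by rewrite /f /=; case: l' {l'r}.
Unshelve. all: by end_near. Qed.

(* At an interior maximum, averaging over the four points l + t, l - t, l + it,
   l - it kills the terms of order 1 and 2 of K while |l|^2 gains t^2. *)
Lemma max_principle K (r B : R) : 0 < r -> 0 <= B ->
  (forall l, exists C d, [/\ 0 <= C, 0 < d <= 1 &
     forall eta, nm eta < d -> nm (K (l + eta) - K l) <= C * nm eta]) ->
  (forall l, K l != 0 -> jet 3 K l) ->
  (forall l, nm l = r -> nm (K l) <= B) ->
  forall l, nm l <= r -> nm (K l) <= B.
Proof.
move=> r0 B0 lipK jK bK l1 l1r.
suff H e : 0 < e -> nm (K l1) <= B + e * r ^+ 2.
  apply/ler_addgt0Pr => e e0.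
  have e'0 : 0 < e / r ^+ 2 by rewrite divr_gt0// exprn_gt0.
  by have := H _ e'0; rewrite divfK ?gt_eqF// exprn_gt0.
move=> e0; pose v l := nm (K l) + e * nm l ^+ 2.
have nmdist (a b : R[i]) : `|nm a - nm b| <= nm (a - b).
  rewrite ler_norml; have := nmD (a - b) b; have := nmD (b - a) a.
  by rewrite !subrK nmBC; lra.
have cv l eps : 0 < eps -> exists2 d, 0 < d & forall eta, nm eta < d -> `|v (l + eta) - v l| < eps.
  move=> eps0; have [C [d [C0 /andP[d0 d1] H]]] := lipK l.
  pose M := C + e * (1 + 2 * nm l) + 1.
  have M0 : 0 < M by rewrite ltr_wpDl// addr_ge0 ?mulr_ge0 ?addr_ge0 ?mulr_ge0 ?nm_ge0 ?(ltW e0).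
  exists (Num.min d (eps / M)); first by rewrite lt_min d0 divr_gt0.
  move=> eta; rewrite lt_min => /andP[ed eM].
  have n0 := nm_ge0 eta; have n1 : nm eta <= 1 by lra.
  rewrite /v (_ : _ - _ = (nm (K (l + eta)) - nm (K l)) + e * (nm (l + eta) ^+ 2 - nm l ^+ 2)); last by ring.
  apply: (le_lt_trans (ler_normD _ _)); rewrite normrM gtr0_norm//.
  have h1 := le_trans (nmdist _ _) (H _ ed).
  have h2 : `|nm (l + eta) ^+ 2 - nm l ^+ 2| <= (1 + 2 * nm l) * nm eta.
    rewrite subr_sqr normrM mulrC.
    have := nmdist (l + eta) l; rewrite addrAC subrr add0r => h.
    rewrite mulrC [leRHS]mulrC ler_pM ?normr_ge0//.
    rewrite ger0_norm ?addr_ge0 ?nm_ge0//; have := nmD l eta; lra.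
  have h3 : M * nm eta < eps by rewrite mulrC -ltr_pdivlMr.
  have := ler_wpM2l (ltW e0) h2; move: h3; rewrite /M; lra.
have [l0 l0r Hmax] := disc_max (ltW r0) cv.
have vl : nm (K l1) <= v l0.
  by apply: le_trans (Hmax _ l1r); rewrite /v lerDl mulr_ge0 ?sqr_ge0// ltW.
apply: (le_trans vl); rewrite /v.
have [l0E|l0n] := eqVneq (nm l0) r; first by rewrite l0E lerD2r bK.
have {l0n} l0lt : nm l0 < r by rewrite lt_neqAle l0n.
exfalso.
suff [C [d [d0 avg]]] : exists C d, 0 < d /\ forall t, 0 < t < d ->
    4 * nm (K l0) - C * t ^+ 3 <= nm (K (l0 + t%:C)) + nm (K (l0 - t%:C)) +
      nm (K (l0 + 'i%C * t%:C)) + nm (K (l0 - 'i%C * t%:C)).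
  have cd0 : 0 < `|C| + 1 by rewrite ltr_wpDl.
  pose t := Num.min (d / 2) (Num.min ((r - nm l0) / 2) (e / (`|C| + 1))).
  have t0 : 0 < t by rewrite !lt_min !divr_gt0// subr_gt0.
  have t1 : t <= d / 2 by rewrite ge_min lexx.
  have t2 : t <= (r - nm l0) / 2 by rewrite !ge_min lexx orbT.
  have t3 : t <= e / (`|C| + 1) by rewrite !ge_min lexx !orbT.
  have := avg t; rewrite t0 => /(_ _)/= W; have {}W := W _.
  have {}W := W ltac:(lra).
  have nt : nm t%:C = t by rewrite nmR gtr0_norm.
  have nit : nm ('i%C * t%:C) = t by rewrite nmM nm_i mul1r.
  have inr eta : nm eta = t -> v (l0 + eta) <= v l0.
    move=> et; apply: Hmax; apply: (le_trans (nmD _ _)); rewrite et; lra.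
  have v1 := inr t%:C nt; have v2 := inr (- t%:C); rewrite nmN in v2; have {}v2 := v2 nt.
  have v3 := inr ('i%C * t%:C) nit; have v4 := inr (- ('i%C * t%:C)); rewrite nmN in v4; have {}v4 := v4 nit.
  rewrite /v !nm_sqr_add !nmN nt nit !cE /= in v1 v2 v3 v4.
  have t20 : 0 < t ^+ 2 by rewrite exprn_gt0.
  have : C * t ^+ 3 <= e * t ^+ 2.
    apply: (@le_trans _ _ ((`|C| + 1) * t ^+ 3)).
      by rewrite ler_wpM2r ?exprn_ge0 ?(ltW t0)//; have := ler_norm C; lra.
    by rewrite exprS mulrA ler_wpM2r ?(ltW t20)// mulrC -ler_pdivlMr.
  have : 0 < e * t ^+ 2 by rewrite mulr_gt0.
  move: W v1 v2 v3 v4; lra.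
(* At a zero of [K] the averaged inequality is trivial, so expansions are used only where [K] does
   not vanish. This admits a [K] that is merely Lipschitz at a zero, as in the proof of Liouville's
   theorem below. *)
have [K0|Kn0] := eqVneq (K l0) 0.
  exists 0, 1; split => // t _; rewrite K0 nm0 mulr0 mul0r subr0.
  by rewrite !addr_ge0 ?nm_ge0.
have [p [C [d [C0 /andP[d0 d1] H]]]] := jK _ Kn0.
pose q := p %/ 'X; pose q2 := q %/ 'X; pose q3 := q2 %/ 'X.
have divX (s : {poly R[i]}) : s = (s %/ 'X) * 'X + (s.[0])%:P.
  by have := divp_eq s ('X - 0%:P); rewrite modp_XsubC subr0 => {1}->.
have [B' B'0 HB] := poly_nm_bounded q3.
have pE eta : p.[eta] = p.[0] + q.[0] * eta + q2.[0] * eta ^+ 2 + q3.[eta] * eta ^+ 3.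
  have h1 : p.[eta] = q.[eta] * eta + p.[0] by rewrite {1}(divX p) hornerMXaddC.
  have h2 : q.[eta] = q2.[eta] * eta + q.[0] by rewrite {1}(divX q) hornerMXaddC.
  have h3 : q2.[eta] = q3.[eta] * eta + q2.[0] by rewrite {1}(divX q2) hornerMXaddC.
  by rewrite h1 h2 h3; ring.
have p0 : K l0 = p.[0].
  have := H 0; rewrite nm0 addr0 expr0n mulr0 => /(_ d0) h.
  by apply/eqP; rewrite -subr_eq0 -nm_eq0 eq_le h nm_ge0.
exists (4 * (C + B')), d; split => // t /andP[t0 td].
have nt : nm t%:C = t by rewrite nmR gtr0_norm.
have nit : nm ('i%C * t%:C) = t by rewrite nmM nm_i mul1r.
have rem eta : nm eta = t ->
    nm (K (l0 + eta) - (p.[0] + q.[0] * eta + q2.[0] * eta ^+ 2)) <= (C + B') * t ^+ 3.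
  move=> et.
  rewrite (_ : _ - _ = (K (l0 + eta) - p.[eta]) + q3.[eta] * eta ^+ 3); last by rewrite (pE eta); ring.
  apply: (le_trans (nmD _ _)); rewrite mulrDl lerD//; first by rewrite -et H// et.
  by rewrite nmM nmX et ler_wpM2r ?exprn_ge0 ?(ltW t0)// HB// et; lra.
have r1 := rem _ nt; have r2 := rem (- t%:C); rewrite nmN in r2; have {}r2 := r2 nt.
have r3 := rem _ nit; have r4 := rem (- ('i%C * t%:C)); rewrite nmN in r4; have {}r4 := r4 nit.
move: r1 r2 r3 r4.
set s1 := K (l0 + t%:C) - _; set s2 := K (l0 - t%:C) - _; set s3 := K (l0 + 'i%C * t%:C) - _;
  set s4 := K (l0 - 'i%C * t%:C) - _ => r1 r2 r3 r4.
have E : 4 * K l0 = K (l0 + t%:C) + K (l0 - t%:C) + K (l0 + 'i%C * t%:C) + K (l0 - 'i%C * t%:C)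
   - (s1 + s2 + s3 + s4).
  rewrite /s1 /s2 /s3 /s4 p0.
  have i2 : 'i%C ^+ 2 = -1 :> R[i] by rewrite sqr_i.
  rewrite ![('i%C * _) ^+ 2]exprMn ![(- _) ^+ 2]sqrrN ![('i%C * _) ^+ 2]exprMn i2; ring.
have := congr1 nm E; rewrite nmM nm_nat => {}E.
have := nmB (K (l0 + t%:C) + K (l0 - t%:C) + K (l0 + 'i%C * t%:C) + K (l0 - 'i%C * t%:C)) (s1 + s2 + s3 + s4).
have := nmD (s1 + s2 + s3) s4; have := nmD (s1 + s2) s3; have := nmD s1 s2.
have := nmD (K (l0 + t%:C) + K (l0 - t%:C) + K (l0 + 'i%C * t%:C)) (K (l0 - 'i%C * t%:C)).
have := nmD (K (l0 + t%:C) + K (l0 - t%:C)) (K (l0 + 'i%C * t%:C)).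
have := nmD (K (l0 + t%:C)) (K (l0 - t%:C)).
lra.
Qed.

(** On the circle [|x| = r] one has [|x^2 - r^2| = 2 r |Im x|], so the fourth power of this factor
    compensates the blow-up [(Im x)^-4] of [(H x - H 0)^2] near the real axis. The maximum principle
    then bounds the product [K] by a multiple of [r^7] inside the circle, while at a fixed [l] the
    factor is of size [r^8]; letting [r] grow shows that [H] is constant. *)
Lemma liouville H :
  (forall l, jet 3 H l) ->
  (forall T, 0 < T -> exists C, forall l, 0 < `|Im l| <= T -> nm (H l) <= C / Im l ^+ 2) ->
  (forall e, 0 < e -> exists T, forall l, T <= `|Im l| -> nm (H l) <= e) ->
  forall l, H l = 0.
Proof.
move=> jH strip infty.
(* The bounds in a strip and outside it, merged into one valid off the real axis. *)
have [C C0 HC] : exists2 C, 0 <= C & forall l, Im l != 0 -> nm (H l) * Im l ^+ 2 <= C * (1 + Im l ^+ 2).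
  have [T HT] := infty 1 ltr01.
  have T10 : 0 < `|T| + 1 by rewrite ltr_wpDl.
  have [C HC] := strip _ T10.
  exists (`|C| + 1); first by rewrite addr_ge0.
  move=> l l0; have i2 : 0 < Im l ^+ 2 by rewrite exprn_even_gt0.
  have [lT|/ltW lT] := leP `|Im l| (`|T| + 1).
    have := HC l; rewrite normr_gt0 l0 lT => /(_ isT).
    rewrite ler_pdivlMr// => h; apply: (le_trans h).
    have : 0 <= `|C| * Im l ^+ 2 by rewrite mulr_ge0// ltW.
    by have := ler_norm C; lra.
  have : nm (H l) <= 1 by apply: HT; apply: le_trans lT; have := ler_norm T; lra.
  move=> h; have := ler_wpM2r (ltW i2) h.
  have : 0 <= `|C| * Im l ^+ 2 by rewrite mulr_ge0// ltW.
  by have := normr_ge0 C; lra.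
have const l : H l = H 0.
  have [->//|l0] := eqVneq l 0.
  apply/eqP; rewrite -subr_eq0 -nm_eq0 -[nm _ == 0]sqrf_eq0.
  rewrite eq_le sqr_ge0 andbT.
  pose C' := C + nm (H 0).
  have C'0 : 0 <= C' by rewrite addr_ge0 ?nm_ge0.
  pose n := nm l; have n0 : 0 < n by rewrite nm_gt0.
  suff [A A0 W] : exists2 A, 0 <= A &
      forall r, 1 <= r -> 2 * n <= r -> nm (H l - H 0) ^+ 2 * r <= A.
    apply: (@le0_of_small _ _ (A * (1 + 2 * n)) 1 ltr01) => t /andP[t0 /ltW t1].
    have r1 : 1 <= (1 + 2 * n) / t by rewrite ler_pdivlMr// mul1r; lra.
    have r2 : 2 * n <= (1 + 2 * n) / t by rewrite ler_pdivlMr//; nra.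
    have := W _ r1 r2; rewrite mulrA ler_pdivrMr// => h.
    have : nm (H l - H 0) ^+ 2 <= nm (H l - H 0) ^+ 2 * (1 + 2 * n).
      by rewrite ler_peMr ?sqr_ge0//; lra.
    have : A * t <= A * (1 + 2 * n) * t.
      by rewrite ler_wpM2r ?(ltW t0)// ler_peMr//; lra.
    lra.
  exists (16 * (64 * C' ^+ 2 * n)); first by rewrite !mulr_ge0 ?sqr_ge0// ltW.
  move=> r r1 rn; have r0 : 0 < r by lra.
  (* The square on [H x - H 0] makes [K] tend to 0 at the origin after division by [x], in agreement
     with the value that the convention [0^-1 = 0] assigns there. *)
  pose K x := (x ^+ 2 - (r ^+ 2)%:C) ^+ 4 * (H x - H 0) ^+ 2 * x^-1.
  have K0 : K 0 = 0 by rewrite /K invr0 mulr0.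
  have jK x : x != 0 -> jet 3 K x.
    move=> x0; apply: jetM; last by apply: jetV => //; exact: jet_id.
    by apply: jetM; apply: jetX; apply: jetB; [apply: jetX; exact: jet_id|exact: jet_cst|exact: jH|exact: jet_cst].
  have lipK x : exists C d, [/\ 0 <= C, 0 < d <= 1 &
      forall eta, nm eta < d -> nm (K (x + eta) - K x) <= C * nm eta].
    have [->|x0] := eqVneq x 0; last exact: jet_lipschitz (jK x x0).
    have [C1 [d [C10 /andP[d0 d1] HL]]] := jet_lipschitz (jH 0).
    exists ((1 + r ^+ 2) ^+ 4 * C1 ^+ 2), d; split; [|by rewrite d0|].
      by rewrite mulr_ge0 ?sqr_ge0// exprn_ge0// addr_ge0// sqr_ge0.
    move=> eta ed; rewrite add0r K0 subr0.
    have [->|e0] := eqVneq eta 0; first by rewrite K0 nm0 mulr0.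
    have ne0 : 0 < nm eta by rewrite nm_gt0.
    have := HL eta ed; rewrite add0r => hl.
    rewrite /K nmM nmV nmM !nmX -[leLHS]mulrA -[leRHS]mulrA; apply: ler_pM.
    - by rewrite exprn_ge0 ?nm_ge0.
    - by rewrite mulr_ge0 ?invr_ge0 ?exprn_ge0 ?nm_ge0.
    -
      rewrite lerXn2r ?nnegrE ?nm_ge0 ?addr_ge0 ?sqr_ge0//.
      apply: (le_trans (nmB _ _)); rewrite nmX nmR ger0_norm ?sqr_ge0// lerD2r.
      by rewrite exprn_ile1 ?nm_ge0//; lra.
    - by rewrite ler_pdivrMr// -mulrA -expr2 -exprMn lerXn2r ?nnegrE ?mulr_ge0 ?nm_ge0.
  have bd x : nm x = r -> nm (K x) <= 64 * C' ^+ 2 * r ^+ 7.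
    move=> xr; rewrite /K nmM nmV xr nmM !nmX ler_pdivrMr// .
    have E : nm (x ^+ 2 - (r ^+ 2)%:C) = 2 * r * `|Im x|.
      have : nm (x ^+ 2 - (r ^+ 2)%:C) ^+ 2 = (2 * r * `|Im x|) ^+ 2.
        rewrite sqr_nm -xr sqr_nm !exprMn real_normK ?num_real// sqr_nm expr2 !cE /=; ring.
      by move/eqP; rewrite eqrXn2 ?nm_ge0 ?mulr_ge0// ?(ltW r0)// => /eqP.
    rewrite E.
    have r70 : 0 <= r ^+ 7 by rewrite exprn_ge0 ?(ltW r0).
    have [ix0|ix0] := eqVneq (Im x) 0.
      by rewrite ix0 normr0 mulr0 expr0n mul0r !mulr_ge0 ?sqr_ge0// ltW.
    have ixr : Im x ^+ 2 <= r ^+ 2.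
      by rewrite -xr sqr_nm; have := sqr_ge0 (Re x); lra.
    have h : Im x ^+ 2 * nm (H x - H 0) <= C' * (2 * r ^+ 2).
      apply: (@le_trans _ _ (Im x ^+ 2 * (nm (H x) + nm (H 0)))).
        by rewrite ler_wpM2l ?sqr_ge0// nmB.
      have := HC x ix0; have : C * (1 + Im x ^+ 2) <= C * (2 * r ^+ 2).
        rewrite ler_wpM2l//; have : 1 <= r ^+ 2 by rewrite exprn_ege1.
        by lra.
      have : Im x ^+ 2 * nm (H 0) <= (2 * r ^+ 2) * nm (H 0).
        by rewrite ler_wpM2r ?nm_ge0//; have := sqr_ge0 r; lra.
      rewrite /C'; lra.
    rewrite (_ : (2 * r * `|Im x|) ^+ 4 = 16 * r ^+ 4 * (Im x ^+ 2) ^+ 2); last first.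
      by rewrite -[in RHS](real_normK (num_real (Im x))); ring.
    rewrite -mulrA -exprMn.
    apply: (@le_trans _ _ (16 * r ^+ 4 * (C' * (2 * r ^+ 2)) ^+ 2)).
      have a1 := mulr_ge0 (sqr_ge0 (Im x)) (nm_ge0 (H x - H 0)).
      apply: ler_wpM2l; first by rewrite mulr_ge0// exprn_ge0// ltW.
      by apply: lerXn2r => //; rewrite nnegrE (le_trans a1 h).
    by rewrite le_eqVlt; apply/orP; left; apply/eqP; ring.
  have lr : nm l <= r by rewrite -/n; lra.
  have B0 : 0 <= 64 * C' ^+ 2 * r ^+ 7 by rewrite !mulr_ge0// ltW.
  have := max_principle r0 B0 lipK _ bd lr => W.
  have {W} := W _ => W.
  have {W} : nm (K l) <= 64 * C' ^+ 2 * r ^+ 7.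
    by apply: W => x Kx0; apply: jK; apply: contraNneq Kx0 => ->; rewrite K0.
  rewrite /K nmM nmV -/n nmM !nmX ler_pdivrMr//.
  have low : r ^+ 2 / 2 <= nm (l ^+ 2 - (r ^+ 2)%:C).
    have := nmB (l ^+ 2 - (r ^+ 2)%:C) (l ^+ 2).
    rewrite addrAC subrr add0r nmN nmR nmX ger0_norm ?sqr_ge0// -/n.
    nra.
  have low4 : (r ^+ 2 / 2) ^+ 4 <= nm (l ^+ 2 - (r ^+ 2)%:C) ^+ 4.
    by rewrite lerXn2r ?nnegrE ?nm_ge0// divr_ge0// sqr_ge0.
  move=> h.
  have : (r ^+ 2 / 2) ^+ 4 * nm (H l - H 0) ^+ 2 <= 64 * C' ^+ 2 * r ^+ 7 * n.
    by apply: le_trans h; rewrite ler_wpM2r ?sqr_ge0.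
  have r7 : 0 < r ^+ 7 by rewrite exprn_gt0.
  rewrite (_ : _ * nm (H l - H 0) ^+ 2 = r ^+ 7 * (nm (H l - H 0) ^+ 2 * r / 16)); last by field.
  rewrite (_ : 64 * C' ^+ 2 * r ^+ 7 * n = r ^+ 7 * (64 * C' ^+ 2 * n)); last by ring.
  by rewrite ler_pM2l//; lra.
move=> l; rewrite const; apply/eqP; rewrite -nm_eq0 eq_le nm_ge0 andbT.
apply/ler_addgt0Pr => e e0; rewrite add0r.
have [T HT] := infty _ e0.
by rewrite -(const ('i%C * `|T|%:C)); apply: HT; rewrite !cE /= mul0r mul1r add0r normr_id ler_norm.
Qed.

End Liouville.

(** * Double zeros and half-period symmetry *)

Section QuotientVanishes.
Variable R : realType.
Implicit Types (E Q : R[i] -> R[i]) (l eta : R[i]) (p q : {poly R[i]}) (C : R).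

Local Notation Re := complex.Re.
Local Notation Im := complex.Im.
Local Notation nm := (@ComplexField.Normc.normc R).

(* E^2 / Q is entire since the zeros of Q are double and E vanishes there; it is
   bounded across the real axis and tends to 0 away from it. *)
Lemma quotient_vanishes E Q :
  (forall l, jet 4 E l) -> (forall l, jet 5 Q l) ->
  (forall l, Q l = 0 -> E l = 0 /\ exists p C, [/\
     forall eta, nm eta <= 1 -> nm (Q (l + eta) - p.[eta]) <= C * nm eta ^+ 3,
     p`_0 = 0, p`_1 = 0 & p`_2 != 0]) ->
  (forall T, 0 < T -> exists c M, 0 < c /\ forall l, `|Im l| <= T ->
     c * Im l ^+ 2 <= nm (Q l) /\ nm (E l) <= M) ->
  (forall e, 0 < e -> exists T, forall l, T <= `|Im l| -> nm (E l) ^+ 2 <= e * nm (Q l)) ->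
  forall l, E l = 0.
Proof.
move=> jE jQ zero strip infty.
have /choice [v Hv] : forall l, exists v, Q l = 0 ->
    jet 3 (fun x => if x == l then v else E x ^+ 2 / Q x) l /\
    exists2 d, 0 < d & forall eta, eta != 0 -> nm eta < d -> Q (l + eta) != 0.
  move=> l; have [Ql|Ql] := eqVneq (Q l) 0; last first.
    by exists 0 => Ql0; rewrite Ql0 eqxx in Ql.
  have [El [p [C [Hp p0 p1 p2]]]] := zero l Ql.
  have j2 := jet_div2 (jQ l) Hp p0 p1.
  have [e1 j1] := jet_div1 (jE l) El.
  (* [E / (x - l)] and [Q / (x - l) ^+ 2] extend over [l] with values [e1] and [p_2], the latter
     nonzero; this is the value there of the extended quotient. *)
  exists (e1 ^+ 2 / p`_2) => _.
  set G2 := fun x => _ in j2; set G1 := fun x => _ in j1.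
  have G2l : G2 l != 0 by rewrite /G2 eqxx.
  have [C1 [d [C10 /andP[d0 d1] HL]]] := jet_lipschitz j2.
  pose d' := Num.min d (nm (G2 l) / (C1 + 1)).
  have d'0 : 0 < d' by rewrite lt_min d0 divr_gt0 ?nm_gt0// ltr_wpDl.
  have G2n eta : nm eta < d' -> G2 (l + eta) != 0.
    rewrite lt_min => /andP[ed en]; apply/eqP => G20.
    have := HL _ ed; rewrite G20 sub0r nmN.
    rewrite ltr_pdivlMr ?ltr_wpDl// in en.
    have := nm_ge0 eta; lra.
  split; last first.
    exists d' => // eta e0 /G2n; rewrite /G2; case: ifPn => [/eqP e|_].
      by move: e0; rewrite -[eta](addKr l) e addNr eqxx.
    by apply: contraNneq => ->; rewrite mul0r.
  apply: (jet_eq d'0 _ (jetM (jetX 2 j1) (jetV j2 G2l))) => eta ed.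
  rewrite /G1 /G2; case: ifPn => // en.
  have e0 : eta != 0 by apply: contra_neq en => ->; rewrite addr0.
  have := G2n _ ed; rewrite /G2 (negbTE en) mulf_eq0 negb_or => /andP[Q0 _].
  rewrite [l + eta]addrC addrK in Q0 *; rewrite [eta + l]addrC in Q0 *.
  by field; rewrite Q0 e0.
pose H x := if Q x == 0 then v x else E x ^+ 2 / Q x.
have H0 : forall l, H l = 0.
  apply: liouville.
  - move=> l; have [Ql|Ql] := eqVneq (Q l) 0.
      have [jv [d d0 Hd]] := Hv l Ql.
      apply: (jet_eq d0 _ jv) => eta ed; rewrite /H.
      case: ifPn => [/eqP ->|en]; first by rewrite Ql eqxx.
      have e0 : eta != 0 by apply: contra_neq en => ->; rewrite addr0.
      by rewrite (negbTE (Hd _ e0 ed)).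
    have jEQ : jet 3 (fun x => E x ^+ 2 / Q x) l.
      apply: jetM; first by apply: jetX; exact: jetW (jE l).
      by apply: jetV => //; do 2! apply: jetW; exact: jQ.
    have [C1 [d [C10 /andP[d0 d1] HL]]] := jet_lipschitz (jQ l).
    have d'0 : 0 < Num.min d (nm (Q l) / (C1 + 1)) by rewrite lt_min d0 divr_gt0 ?nm_gt0// ltr_wpDl.
    apply: (jet_eq d'0 _ jEQ) => eta; rewrite lt_min => /andP[ed en].
    rewrite /H; case: ifPn => // /eqP Q0; exfalso.
    have := HL _ ed; rewrite Q0 sub0r nmN.
    rewrite ltr_pdivlMr ?ltr_wpDl// in en.
    have := nm_ge0 eta; lra.
  - move=> T T0; have [c [M [c0 HcM]]] := strip T T0.
    exists (M ^+ 2 / c) => l /andP[l0 lT]; have [h1 h2] := HcM l lT.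
    have i2 : 0 < Im l ^+ 2 by rewrite exprn_even_gt0//= -normr_gt0.
    have Q0 : 0 < nm (Q l) by apply: lt_le_trans h1; rewrite mulr_gt0.
    rewrite /H -nm_eq0 gt_eqF// nmM nmV nmX ler_pdivrMr//.
    have hE : nm (E l) ^+ 2 <= M ^+ 2 by rewrite lerXn2r ?nnegrE ?nm_ge0// (le_trans (nm_ge0 _) h2).
    apply: (le_trans hE).
    have -> : M ^+ 2 / c / Im l ^+ 2 * nm (Q l) = M ^+ 2 * (nm (Q l) / (c * Im l ^+ 2)).
      by rewrite [(c * _)^-1]invfM; move: (Im l ^+ 2)^-1 c^-1 => x y; ring.
    rewrite ler_peMr ?sqr_ge0//; rewrite ler_pdivlMr; [by rewrite mul1r|by rewrite mulr_gt0].
  - move=> e e0; have [T HT] := infty e e0.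
    have [T' HT'] := infty 1 ltr01.
    exists (`|T| + 1) => l lT.
    have TT : T <= `|Im l| by apply: le_trans lT; have := ler_norm T; lra.
    rewrite /H; case: ifPn => [/eqP Q0|Q0].
      have [|c [M [c0 /(_ l (lexx _))[h1 _]]]] := strip `|Im l|.
        by apply: lt_le_trans lT; rewrite ltr_wpDl.
      move: h1; rewrite Q0 nm0; have : 0 < c * Im l ^+ 2.
        rewrite mulr_gt0// exprn_even_gt0//= -normr_gt0; apply: lt_le_trans lT; by rewrite ltr_wpDl.
      by move=> h1 h2; have := lt_le_trans h1 h2; rewrite ltxx.
    by rewrite nmM nmV nmX ler_pdivrMr ?nm_gt0// HT.
move=> l; have [Ql|Ql] := eqVneq (Q l) 0; first by have [] := zero l Ql.
have := H0 l; rewrite /H (negbTE Ql) => /eqP.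
by rewrite mulf_eq0 invr_eq0 (negbTE Ql) orbF sqrf_eq0 => /eqP.
Qed.

End QuotientVanishes.

(** * The monodromy over the full period *)

Section Monodromy.
Variable R : realType.
Implicit Types (z : R) (l eta : R[i]) (p : {poly R[i]}) (C : R).
Notation mu := (@lebesgue_measure R).

Local Notation Re := complex.Re.
Local Notation Im := complex.Im.
Local Notation nm := (@ComplexField.Normc.normc R).

Variables (u : R -> R[i]) (om w : R -> R) (L : R) (f g h k : R[i] -> R -> R[i]).
Hypotheses (D : dominated u om w) (L0 : 0 < L) (F : fund u f g h k).

Let LL0 : 0 < L + L. Proof. exact: addr_gt0. Qed.

Let disc l := f l (L + L) + k l (L + L).

Lemma disc_ujet n : ujet n disc.
Proof.
move=> rho; have [C C0 H] := fund_taylor D LL0 F n rho.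
exists (C + C); first exact: addr_ge0.
move=> l lr; have [pf [pg [ph [pk [[s1 s2 s3 s4] Hp]]]]] := H l lr.
exists (pf + pk); first by rewrite (leq_trans (size_polyD _ _))// geq_max s1 s4.
move=> eta e1; have [h1 _ _ h4] := Hp eta e1; rewrite hornerD /disc.
rewrite (_ : _ - _ = (f (l + eta) (L + L) - pf.[eta]) + (k (l + eta) (L + L) - pk.[eta])); last by ring.
by apply: (le_trans (nmD _ _)); rewrite mulrDl lerD.
Qed.

Lemma disc2_real l : disc l = 2 -> l^*%C = l.
Proof.
move=> d2; have [c c0 H] := fund_trace_ge D LL0 F (normr_ge0 (Im l)).
have := H l (lexx _); rewrite -/(disc l) d2 subrr nm0 => hle.
have : Im l ^+ 2 <= 0 by rewrite -(ler_pM2l c0) mulr0.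
rewrite le_eqVlt ltNge sqr_ge0 orbF sqrf_eq0 => /eqP il.
by apply: complex_eq; rewrite !cE// il oppr0.
Qed.

Lemma fund_entries l z : l^*%C = l -> [/\ h l z = (g l z)^*%C, k l z = (f l z)^*%C &
  nm (f l z) ^+ 2 - nm (g l z) ^+ 2 = 1].
Proof.
move=> lr; have [hz kz] := fund_conj D F l z; rewrite lr in hz kz.
split => //; have := fund_det F l z; rewrite hz kz => /(congr1 (@complex.Re R)).
by rewrite !cE !sqr_nm /=; lra.
Qed.

(** For real [l] the diagonal of the monodromy is [f2] and its conjugate, so trace 2 means
    [f2 = 1 + i y], and the determinant gives [|g2| = |y|]. Vanishing of the derivative yields
    [kp y = - Im (g2 q)], which [|q| < kp] permits for [y = 0] only. *)
Lemma disc2_identity l p C : disc l = 2 ->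
  (forall eta, nm eta <= 1 -> nm (disc (l + eta) - p.[eta]) <= C * nm eta ^+ 3) ->
  p`_1 = 0 ->
  [/\ f l (L + L) = 1, g l (L + L) = 0, h l (L + L) = 0 & k l (L + L) = 1].
Proof.
move=> d2 Hp p1; have lr := disc2_real d2.
have [hz kz dt] := fund_entries (L + L) lr.
have [kp [q [C' [qk H]]]] := fund_diff_real D LL0 F lr.
set f2 := f l (L + L) in hz kz dt H *; set g2 := g l (L + L) in hz kz dt H *.
set h2 := h l (L + L) in hz kz dt H *; set k2 := k l (L + L) in hz kz dt H *.
pose c : R[i] := - 'i%C * (f2 * kp%:C - h2 * q^*%C + (g2 * q - k2 * kp%:C)).
have pc : p`_1 = ((2 : R[i])%:P + c *: 'X)`_1.
  apply: (@taylor_coef_eq _ 2 disc disc l p _ (`|C|) (C' + C') 1) => // [|eta e1|eta /ltW e1].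
  - by rewrite ltr01 lexx.
  - apply: (le_trans (Hp _ (ltW e1))).
    apply: (@le_trans _ _ (`|C| * nm eta ^+ 3)).
      by rewrite ler_wpM2r ?exprn_ge0 ?nm_ge0// ler_norm.
    by rewrite ler_wpM2l// (exprD _ 2 1) ler_piMr ?exprn_ge0 ?nm_ge0// expr1 ltW.
  - have [H1 H2] := H eta e1.
    rewrite (_ : _.[eta] = 2 + c * eta); last by rewrite !hornerE.
    rewrite -d2 /disc -/f2 -/k2.
    rewrite (_ : _ - _ = (f (l + eta) (L + L) - (f2 - 'i%C * eta * (f2 * kp%:C - h2 * q^*%C))) +
      (k (l + eta) (L + L) - (k2 - 'i%C * eta * (g2 * q - k2 * kp%:C)))); last by rewrite /c; ring.
    by apply: (le_trans (nmD _ _)); rewrite mulrDl lerD.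
have c0 : c = 0.
  by move: pc; rewrite p1 coefD coefC coefZ coefX /= add0r mulr1.
have Ref : Re f2 = 1.
  have := congr1 (@complex.Re R) d2; rewrite /disc -/f2 -/k2 kz !cE /=; lra.
have Imf : Im f2 ^+ 2 = nm g2 ^+ 2 by move: dt; rewrite sqr_nm Ref; lra.
have key : kp * Im f2 = - Im (g2 * q).
  have := congr1 (@complex.Re R) c0; rewrite /c hz kz !cE /=; lra.
have If0 : Im f2 = 0.
  apply/eqP; rewrite -normr_eq0 eq_le normr_ge0 andbT leNgt; apply/negP => If.
  have nmg : nm g2 = `|Im f2|.
    by apply/eqP; rewrite -(eqrXn2 (n := 2)) ?nm_ge0// -Imf real_normK// num_real.
  have := nm_Im (g2 * q); rewrite -normrN -key normrM nmM nmg mulrC ler_pM2l//.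
  by move=> hle; have := lt_le_trans qk (le_trans (ler_norm kp) hle); rewrite ltxx.
have g0 : g2 = 0 by apply/eqP; rewrite -nm_eq0 -sqrf_eq0 -Imf If0 expr0n.
have f1 : f2 = 1 by apply: complex_eq.
by split => //; rewrite ?hz ?kz ?g0 ?f1 ?conjc0 ?conjc1.
Qed.

Lemma fund_bound_im l : [/\ nm (f l L) <= expR (om L - om 0) * expR (`|Im l| * L),
  nm (g l L) <= expR (om L - om 0) * expR (`|Im l| * L),
  nm (h l L) <= expR (om L - om 0) * expR (`|Im l| * L) &
  nm (k l L) <= expR (om L - om 0) * expR (`|Im l| * L)].
Proof.
have [Z1 Z2 [f0 g0] [h0 k0]] := F l.
have n1 : nm (f l 0) ^+ 2 + nm (g l 0) ^+ 2 <= 1 by rewrite f0 g0 nm0 nm1; lra.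
have n2 : nm (h l 0) ^+ 2 + nm (k l 0) ^+ 2 <= 1 by rewrite h0 k0 nm0 nm1; lra.
have LL : 0 <= L <= L by rewrite lexx ltW.
have [? ?] := zs_bound D Z1 n1 LL; have [? ?] := zs_bound D Z2 n2 LL.
by split.
Qed.

Lemma disc_large : exists T, forall l, T <= `|Im l| ->
  expR (`|Im l| * L) ^+ 2 <= 2 * nm (disc l - 2).
Proof.
(* With an error of at most [E / 16] in each of the two diagonal entries, and [E >= 16] to absorb
   [E^-1] and the constant 2, more than half of [E] remains. *)
have e80 : 0 < 16^-1 :> R by rewrite invr_gt0.
have [T T0 H] := fund_asym D LL0 F e80.
have [T' T'0 H'] := expRN_small e80.
exists (Num.max T (T' / L)) => l; rewrite ge_max => /andP[lT lT'].
have [a1 _ _ a4] := H l lT.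
have -> : expR (`|Im l| * L) ^+ 2 = expR (`|Im l| * (L + L)) by rewrite expr2 -expRD mulrDr.
set E := expR _ in a1 a4 *.
have E0 : 0 < E by exact: expR_gt0.
have EL : E^-1 <= 16^-1.
  rewrite /E -expRN; apply: H'; rewrite ler_pdivrMr// in lT'.
  by rewrite mulrDr; have := mulr_ge0 (normr_ge0 (Im l)) (ltW L0); lra.
have E8 : 16 <= E by rewrite -lef_pV2 ?posrE.
have wv : E - E^-1 <= nm (wave l (L + L) + wave (- l) (L + L)).
  have n1 := nm_wave l (L + L); have n2 := nm_wave (- l) (L + L).
  rewrite ImN mulNr expRN in n2.
  have h1 := nmB (wave l (L + L) + wave (- l) (L + L)) (wave (- l) (L + L)).
  have h2 := nmB (wave l (L + L) + wave (- l) (L + L)) (wave l (L + L)).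
  rewrite addrK in h1; rewrite [X in nm (X - _)]addrC addrK in h2.
  rewrite n1 n2 in h1 h2.
  have [il0|/ltW il0] := leP 0 (Im l).
    have EE : E = expR (Im l * (L + L)) by rewrite /E ger0_norm.
    by rewrite EE; lra.
  have EE : E = (expR (Im l * (L + L)))^-1 by rewrite /E ler0_norm// mulNr expRN.
  by rewrite EE invrK; lra.
have := nmB (f l (L + L) - wave l (L + L) + (k l (L + L) - wave (- l) (L + L)))
  (disc l - 2).
have -> : f l (L + L) - wave l (L + L) + (k l (L + L) - wave (- l) (L + L)) - (disc l - 2) =
  - (wave l (L + L) + wave (- l) (L + L)) + 2 by rewrite /disc; ring.
have := nmD (f l (L + L) - wave l (L + L)) (k l (L + L) - wave (- l) (L + L)).
have := nmB (- (wave l (L + L) + wave (- l) (L + L)) + 2) 2.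
rewrite addrK nmN nm_nat.
lra.
Qed.

End Monodromy.

Section HalfPeriodSymmetry.
Variable R : realType.
Implicit Types (z : R) (l eta : R[i]) (p : {poly R[i]}) (C : R).
Notation mu := (@lebesgue_measure R).

Local Notation Re := complex.Re.
Local Notation Im := complex.Im.
Local Notation nm := (@ComplexField.Normc.normc R).

Variables (u : R -> R[i]) (om w : R -> R) (L : R) (f g h k : R[i] -> R -> R[i]).
Hypotheses (D : dominated u om w) (L0 : 0 < L) (F : fund u f g h k).

Let disc l := f l (L + L) + k l (L + L).

(* W1 and W2 say that the monodromy factors as Phi(2L) = Phi'(L) Phi(L).  At a double
   zero of disc - 2 it is the identity, so Phi'(L) is the inverse of Phi(L). *)
Lemma double_zeros_symmetry (f' g' h' k' : R[i] -> R -> R[i]) :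
  fund (fun z => u (z + L)) f' g' h' k' ->
  (forall l, f l (L + L) = f' l L * f l L + h' l L * g l L /\
             h l (L + L) = f' l L * h l L + h' l L * k l L) ->
  (forall l, g l (L + L) = g' l L * f l L + k' l L * g l L /\
             k l (L + L) = g' l L * h l L + k' l L * k l L) ->
  (forall l, disc l = 2 -> exists p C, [/\
     forall eta, nm eta <= 1 -> nm (disc (l + eta) - p.[eta]) <= C * nm eta ^+ 3,
     p`_0 = 2, p`_1 = 0 & p`_2 != 0]) ->
  forall l, h l L + h' l L = 0 /\ f l L + k l L - (f' l L + k' l L) = 0.
Proof.
move=> F' W1 W2 double.
have D' := dominated_shift L D.
pose Q l := disc l - 2.
have LL0 : 0 < L + L by exact: addr_gt0.
have jQ l : jet 5 Q l by apply: jetB; [exact: ujet_jet (disc_ujet D L0 F 5)|exact: jet_cst].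
have zero l : Q l = 0 ->
    [/\ f' l L = k l L, h' l L = - h l L & k' l L = f l L] /\ exists p C, [/\
     forall eta, nm eta <= 1 -> nm (Q (l + eta) - p.[eta]) <= C * nm eta ^+ 3,
     p`_0 = 0, p`_1 = 0 & p`_2 != 0].
  move=> /eqP; rewrite subr_eq0 => /eqP d2.
  have [p [C [Hp p0 p1 p2]]] := double l d2.
  split; last first.
    exists (p - 2%:P), C; split.
    - move=> eta e1; rewrite hornerD hornerN hornerC /Q.
      by rewrite (_ : _ - _ = disc (l + eta) - p.[eta]) ?Hp//; ring.
    - by rewrite coefB coefC p0 subrr.
    - by rewrite coefB coefC subr0.
    - by rewrite coefB coefC subr0.
  have [i1 i2 i3 i4] := disc2_identity D L0 F d2 Hp p1.
  have [w1 w3] := W1 l; have [w2 w4] := W2 l.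
  rewrite i1 in w1; rewrite i2 in w2; rewrite i3 in w3; rewrite i4 in w4.
  have dt := fund_det F l L.
  split.
  - transitivity (f' l L * (f l L * k l L - g l L * h l L)); first by rewrite dt mulr1.
    transitivity (k l L * (f' l L * f l L + h' l L * g l L) - g l L * (f' l L * h l L + h' l L * k l L)); first by ring.
    by rewrite -w1 -w3; ring.
  - transitivity (h' l L * (f l L * k l L - g l L * h l L)); first by rewrite dt mulr1.
    transitivity (f l L * (f' l L * h l L + h' l L * k l L) - h l L * (f' l L * f l L + h' l L * g l L)); first by ring.
    by rewrite -w1 -w3; ring.
  - transitivity (k' l L * (f l L * k l L - g l L * h l L)); first by rewrite dt mulr1.
    transitivity (f l L * (g' l L * h l L + k' l L * k l L) - h l L * (g' l L * f l L + k' l L * g l L)); first by ring.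
    by rewrite -w2 -w4; ring.
have jets l : [/\ jet 4 (fun x => f x L) l, jet 4 (fun x => h x L) l & jet 4 (fun x => k x L) l] /\
    [/\ jet 4 (fun x => f' x L) l, jet 4 (fun x => h' x L) l & jet 4 (fun x => k' x L) l].
  have d1 : (0 < 1 :> R) && (1 <= 1 :> R) by rewrite ltr01 lexx.
  have [C C0 H] := fund_taylor D L0 F 4 (nm l).
  have [C' C'0 H'] := fund_taylor D' L0 F' 4 (nm l).
  have [pf [pg [ph [pk [_ Hp]]]]] := H l (lexx _).
  have [pf' [pg' [ph' [pk' [_ Hp']]]]] := H' l (lexx _).
  split; split.
  - by exists pf, C, 1; split=> // eta /ltW /Hp[].
  - by exists ph, C, 1; split=> // eta /ltW /Hp[].
  - by exists pk, C, 1; split=> // eta /ltW /Hp[].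
  - by exists pf', C', 1; split=> // eta /ltW /Hp'[].
  - by exists ph', C', 1; split=> // eta /ltW /Hp'[].
  - by exists pk', C', 1; split=> // eta /ltW /Hp'[].
have bounds T : 0 < T -> exists c M, 0 < c /\ forall l, `|Im l| <= T ->
    c * Im l ^+ 2 <= nm (Q l) /\ nm (h l L + h' l L) <= M /\
    nm (f l L + k l L - (f' l L + k' l L)) <= M.
  move=> /ltW T0; have [c c0 Hc] := fund_trace_ge D LL0 F T0.
  pose M1 := expR (om L - om 0) * expR (T * L).
  pose M2 := expR (om (L + L) - om (0 + L)) * expR (T * L).
  have M10 : 0 <= M1 by rewrite mulr_ge0 ?expR_ge0.
  have M20 : 0 <= M2 by rewrite mulr_ge0 ?expR_ge0.
  exists c, (2 * (M1 + M2)); split => // l lT; split; first exact: Hc.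
  have le1 x : x * expR (`|Im l| * L) <= x * expR (T * L) \/ x < 0.
    have [x0|] := leP 0 x; [left|by right].
    by rewrite ler_wpM2l// ler_expR ler_wpM2r// ltW.
  have [b1 _ b3 b4] := fund_bound_im D L0 F l.
  have [b1' _ b3' b4'] := fund_bound_im D' L0 F' l.
  have e1 : expR (om L - om 0) * expR (`|Im l| * L) <= M1.
    by case: (le1 (expR (om L - om 0))) => //; rewrite ltNge expR_ge0.
  have e2 : expR (om (L + L) - om (0 + L)) * expR (`|Im l| * L) <= M2.
    by case: (le1 (expR (om (L + L) - om (0 + L)))) => //; rewrite ltNge expR_ge0.
  split.
    by apply: (le_trans (nmD _ _)); lra.
  by apply: (le_trans (nmB _ _)); have := nmD (f l L) (k l L); have := nmD (f' l L) (k' l L); lra.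
have infty e : 0 < e -> exists T, forall l, T <= `|Im l| ->
    nm (h l L + h' l L) ^+ 2 <= e * nm (Q l) /\
    nm (f l L + k l L - (f' l L + k' l L)) ^+ 2 <= e * nm (Q l).
  (* From [y <= 4 e1 X] and [X^2 <= 2 |Q|] follows [y^2 <= 32 e1^2 |Q|]; the two bounds on [e1] make
     this at most [e |Q|]. *)
  move=> e0; pose e1 := Num.min 1 (e / 32).
  have e10 : 0 < e1 by rewrite lt_min ltr01 divr_gt0.
  have e11 : e1 <= 1 by rewrite ge_min lexx.
  have e12 : e1 <= e / 32 by rewrite ge_min lexx orbT.
  have [T T0 H] := fund_asym D L0 F e10.
  have [T' T'0 H'] := fund_asym D' L0 F' e10.
  have [T2 H2] := disc_large D L0 F.
  exists (Num.max T (Num.max T' T2)) => l; rewrite !ge_max => /and3P[l1 l2 l3].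
  have [a1 _ a3 a4] := H l l1; have [a1' _ a3' a4'] := H' l l2.
  have := H2 l l3; rewrite -/(Q l).
  set X := expR _ in a1 a3 a4 a1' a3' a4' *.
  have X0 : 0 <= X by exact: expR_ge0.
  move=> hQ.
  have sq (y : R) : 0 <= y -> y <= 4 * (e1 * X) -> y ^+ 2 <= e * nm (Q l).
    move=> y0 yX; apply: (@le_trans _ _ ((4 * (e1 * X)) ^+ 2)).
      by rewrite lerXn2r ?nnegrE ?(le_trans y0 yX).
    have -> : (4 * (e1 * X)) ^+ 2 = 16 * e1 ^+ 2 * X ^+ 2 by ring.
    apply: (@le_trans _ _ (16 * e1 ^+ 2 * (2 * nm (Q l)))).
      by apply: ler_wpM2l => //; apply: mulr_ge0 => //; exact: sqr_ge0.
    rewrite mulrA ler_wpM2r ?nm_ge0//.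
    have : e1 ^+ 2 <= e1 by rewrite expr2 ler_piMr// ltW.
    lra.
  split; apply: sq; rewrite ?nm_ge0//.
    by apply: (le_trans (nmD _ _)); have := mulr_ge0 (ltW e10) X0; lra.
  (* The leading terms of the two traces do not depend on the potential, hence cancel. *)
  rewrite (_ : _ - _ = ((f l L - wave l L) + (k l L - wave (- l) L)) -
      ((f' l L - wave l L) + (k' l L - wave (- l) L))); last by ring.
  apply: (le_trans (nmB _ _)).
  have := nmD (f l L - wave l L) (k l L - wave (- l) L).
  have := nmD (f' l L - wave l L) (k' l L - wave (- l) L).
  lra.
move=> l; split.
- apply: (@quotient_vanishes _ (fun x => h x L + h' x L) Q) => //.
  + by move=> x; have [[_ ? _] [_ ? _]] := jets x; exact: jetD.
  + by move=> x Qx; have [[_ -> _] ?] := zero x Qx; rewrite subrr.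
  + by move=> T /bounds[c [M [c0 H]]]; exists c, M; split=> // x /H[? []].
  + by move=> e /infty[T H]; exists T => x /H[].
- apply: (@quotient_vanishes _ (fun x => f x L + k x L - (f' x L + k' x L)) Q) => //.
  + by move=> x; have [[? _ ?] [? _ ?]] := jets x; apply: jetB; exact: jetD.
  + by move=> x Qx; have [[-> _ ->] ?] := zero x Qx; split => //; ring.
  + by move=> T /bounds[c [M [c0 H]]]; exists c, M; split=> // x /H[? []].
  + by move=> e /infty[T H]; exists T => x /H[].
Qed.

(* Conjugation by diag(1, -1) turns u into - u, hence Phi(2L) = s Phi(L) s Phi(L)
   with s = diag(1, -1), which makes disc - 2 a square. *)
Lemma antiperiodic_double_zeros :
  {ae mu, forall z, u (z + L) = - u z} ->
  forall l p C, disc l = 2 ->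
  (forall eta, nm eta <= 1 -> nm (disc (l + eta) - p.[eta]) <= C * nm eta ^+ 3) ->
  p`_1 = 0 /\ p`_2 != 0.
Proof.
move=> anti.
have Dn : dominated (fun z => - u z) om w.
  by have [po uw] := D; split => // z; rewrite nmN.
have F' := fund_shift L F.
have sym l : [/\ f l (L + L) * k l L - h l (L + L) * g l L = f l L,
   g l (L + L) * k l L - k l (L + L) * g l L = - g l L,
   h l (L + L) * f l L - f l (L + L) * h l L = - h l L &
   k l (L + L) * f l L - g l (L + L) * h l L = k l L].
  have [Z1 Z2 [f0 g0] [h0 k0]] := F l; have [Z1' Z2' [f0' g0'] [h0' k0']] := F' l.
  have Y1 := zs_ae anti Z1'; have Y2 := zs_ae anti Z2'.
  (* The second column with its lower entry negated starts from [(0, -1)]; the factor [- 1] restores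
     the initial value [(0, 1)]. *)
  have Y3 := zs_lin (- 1) 0 (zs_opp Z2) (zs_opp Z2).
  have [] := zs_unique Dn Y1 (zs_opp Z1) _ _ L.
  - by rewrite f0' f0.
  - by rewrite g0' g0 oppr0.
  have [] := zs_unique Dn Y2 Y3 _ _ L.
  - by rewrite h0' h0; ring.
  - by rewrite k0' k0; ring.
  by move=> -> -> -> ->; split => //; ring.
have discE l : disc l - 2 = (f l L - k l L) ^+ 2.
  have [s1 s2 s3 s4] := sym l; have dt := fund_det F l L.
  have fE : f l (L + L) = f l L * f l L - h l L * g l L.
    transitivity (f l (L + L) * (f l L * k l L - g l L * h l L)); first by rewrite dt mulr1.
    transitivity ((f l (L + L) * k l L - h l (L + L) * g l L) * f l L +
       (h l (L + L) * f l L - f l (L + L) * h l L) * g l L); first by ring.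
    by rewrite s1 s3; ring.
  have kE : k l (L + L) = k l L * k l L - g l L * h l L.
    transitivity (k l (L + L) * (f l L * k l L - g l L * h l L)); first by rewrite dt mulr1.
    transitivity ((g l (L + L) * k l L - k l (L + L) * g l L) * h l L +
       (k l (L + L) * f l L - g l (L + L) * h l L) * k l L); first by ring.
    by rewrite s2 s4; ring.
  have gh : h l L * g l L = f l L * k l L - 1 by rewrite -dt; ring.
  rewrite /disc fE kE [g l L * h l L]mulrC gh; ring.
move=> l p C d2 Hp.
have lr : l^*%C = l := disc2_real D L0 F d2.
have [hz kz dt] := fund_entries D F L lr.
have [kp [q [C' [qk H]]]] := fund_diff_real D L0 F lr.
set f2 := f l L in hz kz dt H *; set g2 := g l L in hz kz dt H *.
set h2 := h l L in hz kz dt H *; set k2 := k l L in hz kz dt H *.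
have fk : f2 = k2.
  have := discE l; rewrite d2 subrr => /esym/eqP; rewrite sqrf_eq0 subr_eq0 => /eqP.
  by rewrite /f2 /k2.
pose c : R[i] := - 'i%C * (f2 * kp%:C - h2 * q^*%C - (g2 * q - k2 * kp%:C)).
have C'0 : 0 <= C'.
  have n1 : nm (1 : R[i]) <= 1 by rewrite nm1.
  have [+ _] := H 1 n1; rewrite nm1 expr1n [C' * 1]mulr1.
  exact: (le_trans (nm_ge0 _)).
(* [c] is the linear coefficient of [f - k] at [l]. Here [f2] is real, as it equals [k2], its
   conjugate; so [c = 0] would give [kp f2 = Re (g2 q)], against [|q| < kp] and [|g2| < |f2|]. *)
have c0 : c != 0.
  apply/eqP => c0.
  have Imf : Im f2 = 0 by have := congr1 (@complex.Im R) fk; rewrite kz !cE; lra.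
  have key : kp * Re f2 = Re (g2 * q).
    have := congr1 (@complex.Im R) c0; rewrite /c hz kz !cE /= Imf; lra.
  have nf : nm f2 = `|Re f2|.
    by apply/eqP; rewrite -(eqrXn2 (n := 2)) ?nm_ge0// sqr_nm Imf real_normK ?num_real// expr0n addr0.
  have gf : nm g2 < nm f2.
    by rewrite -ltr_sqr ?nnegrE ?nm_ge0//; lra.
  have := nm_Re (g2 * q); rewrite -key normrM nmM -nf.
  have q0 := nm_ge0 q; have g0 := nm_ge0 g2.
  rewrite gtr0_norm ?(le_lt_trans q0 qk)// leNgt => /negP; apply.
  rewrite mulrC; apply: (@le_lt_trans _ _ (nm q * nm f2)); first by rewrite ler_wpM2l// ltW.
  by rewrite ltr_pM2r// (le_lt_trans g0).
have [M M0 HM] : exists2 M, 0 <= M & forall eta, nm eta <= 1 ->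
    nm (disc (l + eta) - (2%:P + c ^+ 2 *: 'X^2).[eta]) <= M * nm eta ^+ 3.
  exists ((C' + C') * (nm c + (C' + C') + nm c)); first by rewrite !(addr_ge0, mulr_ge0) ?nm_ge0.
  move=> eta e1; have [H1 H2] := H eta e1.
  have n0 := nm_ge0 eta.
  pose d := f (l + eta) L - k (l + eta) L.
  have hd : nm (d - c * eta) <= (C' + C') * nm eta ^+ 2.
    rewrite (_ : _ - _ = (f (l + eta) L - (f2 - 'i%C * eta * (f2 * kp%:C - h2 * q^*%C))) -
      (k (l + eta) L - (k2 - 'i%C * eta * (g2 * q - k2 * kp%:C)))); last first.
      have aux (x y b i s t z h' g' q' : R[i]) : (x - y) - (- i * (b * s - h' * t - (g' * q' - b * s))) * z = (x - (b - i * z * (b * s - h' * t))) - (y - (b - i * z * (g' * q' - b * s))) by ring.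
      by rewrite /d /c fk; exact: aux.
    by apply: (le_trans (nmB _ _)); rewrite mulrDl lerD.
  have hd2 : nm (d + c * eta) <= (nm c + (C' + C') + nm c) * nm eta.
    rewrite (_ : d + c * eta = (d - c * eta) + (c * eta + c * eta)); last by ring.
    apply: (le_trans (nmD _ _)); have := nmD (c * eta) (c * eta); rewrite nmM.
    have : (C' + C') * nm eta ^+ 2 <= (C' + C') * nm eta.
      by rewrite ler_wpM2l ?addr_ge0// expr2 ler_piMr.
    lra.
  rewrite (_ : _.[eta] = 2 + c ^+ 2 * eta ^+ 2); last by rewrite !hornerE.
  rewrite (_ : _ - _ = (d - c * eta) * (d + c * eta)); last first.
    have dE : disc (l + eta) - 2 = d ^+ 2 by rewrite discE.
    have aux (x y z e : R[i]) : x - 2 = y ^+ 2 -> x - (2 + z ^+ 2 * e ^+ 2) = (y - z * e) * (y + z * e).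
      by move=> xy; rewrite opprD addrA xy; ring.
    exact: aux.
  rewrite nmM; have := ler_pM (nm_ge0 _) (nm_ge0 _) hd hd2 => /le_trans; apply.
  by rewrite le_eqVlt; apply/orP; left; apply/eqP; ring.
have pE j : (j < 3)%N -> p`_j = (2%:P + c ^+ 2 *: 'X^2 : {poly R[i]})`_j.
  have d1 : (0 < 1 :> R) && (1 <= 1 :> R) by rewrite ltr01 lexx.
  by apply: (taylor_coef_eq d1 (fun eta _ => erefl (disc (l + eta)))) => eta /ltW; [exact: Hp|exact: HM].
rewrite !pE// !coefD !coefC !coefZ !coefXn /= !mulr0 !addr0 mulr1 add0r; split => //.
by rewrite expf_neq0.
Qed.

End HalfPeriodSymmetry.

(** * Transfer matrices from an arbitrary base point *)

Section AllBasePoints.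
Variable R : realType.
Implicit Types (z s : R) (l eta : R[i]) (p : {poly R[i]}) (C : R).
Notation mu := (@lebesgue_measure R).

Local Notation Re := complex.Re.
Local Notation Im := complex.Im.
Local Notation nm := (@ComplexField.Normc.normc R).

Lemma cprim_cst_ae (c : R[i]) (a' : R -> R[i]) :
  cprim (fun=> c) a' -> {ae mu, forall z, a' z = 0}.
Proof.
move=> [[_ dr] [_ di]]; apply: aeW (aeI dr di) => z [hr hi].
apply: complex_eq.
  by have [_ <-] := hr; rewrite derive_cst.
by have [_ <-] := hi; rewrite derive_cst.
Qed.

Variables (u : R -> R[i]) (om w : R -> R) (L : R) (f g h k : R[i] -> R -> R[i]).
Hypotheses (D : dominated u om w) (L0 : 0 < L) (F : fund u f g h k).
Hypothesis uper : forall z, u (z + (L + L)) = u z.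

Let disc l := f l (L + L) + k l (L + L).

(** Floquet's relation [Phi(z + 2 L) = Phi(z) Phi(2 L)]: by periodicity both sides solve the same
    system, and they agree at 0. *)
Lemma monodromy l z :
  [/\ f l (z + (L + L)) = f l z * f l (L + L) + h l z * g l (L + L),
      g l (z + (L + L)) = g l z * f l (L + L) + k l z * g l (L + L),
      h l (z + (L + L)) = f l z * h l (L + L) + h l z * k l (L + L) &
      k l (z + (L + L)) = g l z * h l (L + L) + k l z * k l (L + L)].
Proof.
have [Z1 Z2 [f0 g0] [h0 k0]] := F l.
have up : (fun z => u (z + (L + L))) = u by apply/funext.
have := zs_shift (L + L) Z1; rewrite up => S1.
have := zs_shift (L + L) Z2; rewrite up => S2.
have [] := zs_unique D S1 (zs_lin (f l (L + L)) (g l (L + L)) Z1 Z2) _ _ z.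
- by rewrite add0r f0 h0; ring.
- by rewrite add0r g0 k0; ring.
have [] := zs_unique D S2 (zs_lin (h l (L + L)) (k l (L + L)) Z1 Z2) _ _ z.
- by rewrite add0r f0 h0; ring.
- by rewrite add0r g0 k0; ring.
by move=> -> -> -> ->; split; ring.
Qed.

Hypothesis double : forall l, disc l = 2 -> exists p C, [/\
  forall eta, nm eta <= 1 -> nm (disc (l + eta) - p.[eta]) <= C * nm eta ^+ 3,
  p`_0 = 2, p`_1 = 0 & p`_2 != 0].

(* The transfer matrix from [s] to [s + L], columns as in [fund]. *)
Let A11 l s := f l (s + L) * k l s - h l (s + L) * g l s.
Let A21 l s := g l (s + L) * k l s - k l (s + L) * g l s.
Let A12 l s := h l (s + L) * f l s - f l (s + L) * h l s.
Let A22 l s := k l (s + L) * f l s - g l (s + L) * h l s.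

(* For A, B the transfer matrices over two consecutive half-periods, A - B^-1 is
   lower triangular with trace 0, and det (A - B^-1) = 2 - disc. *)
Lemma transfer_symmetry l s :
  [/\ A12 l s + A12 l (s + L) = 0,
      A11 l s + A22 l s = A11 l (s + L) + A22 l (s + L) &
      (A11 l s - A22 l (s + L)) ^+ 2 = disc l - 2].
Proof.
pose fs x z : R[i] := f x (z + s) * k x s - h x (z + s) * g x s.
pose gs x z : R[i] := g x (z + s) * k x s - k x (z + s) * g x s.
pose hs x z : R[i] := h x (z + s) * f x s - f x (z + s) * h x s.
pose ks x z : R[i] := k x (z + s) * f x s - g x (z + s) * h x s.
have Fs : fund (fun z => u (z + s)) fs gs hs ks := fund_shift s F.
have Fss := fund_shift L Fs.
have Ds := dominated_shift s D.
have dt x := fund_det F x s.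
have dts x := fund_det Fs x L.
(* The monodromy from [s] is conjugate to the one from 0, so the hypothesis on double zeros passes
   to every base point. *)
have discs x : fs x (L + L) + ks x (L + L) = disc x.
  have [m1 m2 m3 m4] := monodromy x s.
  rewrite /fs /ks [L + L + s]addrC m1 m2 m3 m4.
  transitivity ((f x s * k x s - g x s * h x s) * disc x); last by rewrite dt mul1r.
  by rewrite /disc; ring.
have [] := double_zeros_symmetry Ds L0 Fs Fss _ _ _ l.
- move=> x; cbv beta; split.
    transitivity (fs x (L + L) * (fs x L * ks x L - gs x L * hs x L)); first by rewrite dts mulr1.
    by ring.
  transitivity (hs x (L + L) * (fs x L * ks x L - gs x L * hs x L)); first by rewrite dts mulr1.
  by ring.
- move=> x; cbv beta; split.
    transitivity (gs x (L + L) * (fs x L * ks x L - gs x L * hs x L)); first by rewrite dts mulr1.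
    by ring.
  transitivity (ks x (L + L) * (fs x L * ks x L - gs x L * hs x L)); first by rewrite dts mulr1.
  by ring.
- by move=> x; rewrite discs => /double[p [C [H p0 p1 p2]]]; exists p, C; split => // eta /H; rewrite discs.
have discl := discs l; have dtsl := dts l; have dtl := dt l.
have a11 : fs l L = A11 l s by rewrite /fs /A11 [L + s]addrC.
have a21 : gs l L = A21 l s by rewrite /gs /A21 [L + s]addrC.
have a12 : hs l L = A12 l s by rewrite /hs /A12 [L + s]addrC.
have a22 : ks l L = A22 l s by rewrite /ks /A22 [L + s]addrC.
have sLL : L + L + s = s + L + L by ring.
have b11 : fs l (L + L) * ks l L - hs l (L + L) * gs l L = A11 l (s + L).
  rewrite /fs /gs /hs /ks /A11 sLL [L + s]addrC -[RHS]mulr1 -dtl; ring.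
have b12 : hs l (L + L) * fs l L - fs l (L + L) * hs l L = A12 l (s + L).
  rewrite /fs /gs /hs /ks /A12 sLL [L + s]addrC -[RHS]mulr1 -dtl; ring.
have b21 : gs l (L + L) * ks l L - ks l (L + L) * gs l L = A21 l (s + L).
  rewrite /fs /gs /hs /ks /A21 sLL [L + s]addrC -[RHS]mulr1 -dtl; ring.
have b22 : ks l (L + L) * fs l L - gs l (L + L) * hs l L = A22 l (s + L).
  rewrite /fs /gs /hs /ks /A22 sLL [L + s]addrC -[RHS]mulr1 -dtl; ring.
cbv beta; rewrite b11 b12 b22 a11 a12 a22 => e1 /eqP; rewrite subr_eq0 => /eqP e2; split => //.
rewrite a11 a21 a12 a22 in dtsl.
have dtb : A11 l (s + L) * A22 l (s + L) - A21 l (s + L) * A12 l (s + L) = 1.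
  rewrite -[RHS](fund_det Fss l L) b11 b12 b21 b22; ring.
have dE : disc l = A11 l (s + L) * A11 l s + A12 l (s + L) * A21 l s +
    (A21 l (s + L) * A12 l s + A22 l (s + L) * A22 l s).
  rewrite -discl -b11 -b12 -b21 -b22 -a11 -a21 -a12 -a22.
  transitivity ((fs l (L + L) + ks l (L + L)) * (fs l L * ks l L - gs l L * hs l L)).
    by rewrite (dts l) mulr1.
  by ring.
have e1' : A12 l (s + L) = - A12 l s by apply/eqP; rewrite -subr_eq0 opprK addrC e1.
have e2' : A22 l s = A11 l (s + L) + A22 l (s + L) - A11 l s by rewrite -e2; ring.
move: dtsl dtb dE; rewrite e1' e2' => d1 d2 ->.
(* The two determinants, both equal to 1, are subtracted from the trace as polynomials; what remains
   is the square. *)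
transitivity (A11 l (s + L) * A11 l s + - A12 l s * A21 l s +
    (A21 l (s + L) * A12 l s + A22 l (s + L) * (A11 l (s + L) + A22 l (s + L) - A11 l s)) -
    (A11 l s * (A11 l (s + L) + A22 l (s + L) - A11 l s) - A21 l s * A12 l s) -
    (A11 l (s + L) * A22 l (s + L) - A21 l (s + L) * - A12 l s)); first by ring.
by rewrite d1 d2; ring.
Qed.

Lemma double_zeros_antiperiodic : {ae mu, forall z, u (z + L) = - u z}.
Proof.
pose l : R[i] := 'i%C.
have d2 : disc l - 2 != 0.
  apply/eqP => /eqP; rewrite subr_eq0 => /eqP /(disc2_real D L0 F)/(congr1 (@complex.Im R)).
  by rewrite /l /=; lra.
have [[pf pg] [ph pk] _ _] := F l.
have pA : cprim (A12 l) (fun s => - 2 * 'i%C * l * A12 l s + u (s + L) * A22 l s - u s * A11 l s).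
  apply: eq_cprim (cprimB (cprimM (cprim_shift L ph) pf) (cprimM (cprim_shift L pf) ph)) => // s.
  by rewrite /A12 /A22 /A11; ring.
have pE := cprimD pA (cprim_shift L pA).
(* In the derivative of [A12 l s + A12 l (s + L)] the terms in [l] cancel because the sum vanishes,
   and equality of the traces gives the terms in [u s] and [u (s + L)] the same factor. *)
have : cprim (fun=> 0) (fun s => (u (s + L) + u s) * (A22 l (s + L) - A11 l s)).
  apply: eq_cprim pE => s; have [e1 e2 _] := transfer_symmetry l s; first exact: e1.
  have e3 : A22 l s = A11 l (s + L) + A22 l (s + L) - A11 l s by rewrite -e2; ring.
  have e4 : A12 l (s + L) = - A12 l s by apply/eqP; rewrite -subr_eq0 opprK addrC e1.
  by rewrite -[s + L + L]addrA uper e3 e4; ring.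
move/cprim_cst_ae; apply: aeW => s /eqP; rewrite mulf_eq0 => /orP[|].
  by rewrite addr_eq0 => /eqP.
have [_ _ e5] := transfer_symmetry l s.
by rewrite subr_eq0 => /eqP e6; move: d2; rewrite -e5 e6 subrr expr0n eqxx.
Qed.

End AllBasePoints.

(** * Two-by-two matrices and the exponential of a rotation *)

Section TwoByTwoMatrices.
Variable R : realType.
Implicit Types (a b c d x y : R[i]).

Lemma mx2_mul a b c d a' b' c' d' :
  mx2 a b c d *m mx2 a' b' c' d' =
  mx2 (a * a' + b * c') (a * b' + b * d') (c * a' + d * c') (c * b' + d * d').
Proof.
apply/matrixP => i j; rewrite !mxE !big_ord_recl big_ord0 !mxE /= addr0.
by case: i => [[|[|]]] //= ?; case: j => [[|[|]]] //= ?.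
Qed.

Lemma mx2_add a b c d a' b' c' d' :
  mx2 a b c d + mx2 a' b' c' d' = mx2 (a + a') (b + b') (c + c') (d + d').
Proof.
apply/matrixP => i j; rewrite !mxE.
by case: i => [[|[|]]] //= ?; case: j => [[|[|]]] //= ?.
Qed.

Lemma mx2_opp a b c d : - mx2 a b c d = mx2 (- a) (- b) (- c) (- d).
Proof.
apply/matrixP => i j; rewrite !mxE.
by case: i => [[|[|]]] //= ?; case: j => [[|[|]]] //= ?.
Qed.

Lemma mx2_scale x a b c d : x *: mx2 a b c d = mx2 (x * a) (x * b) (x * c) (x * d).
Proof.
apply/matrixP => i j; rewrite !mxE.
by case: i => [[|[|]]] //= ?; case: j => [[|[|]]] //= ?.
Qed.

Lemma mx2_one : 1%:M = mx2 1 0 0 1 :> 'M[R[i]]_2.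
Proof.
apply/matrixP => i j; rewrite !mxE.
by case: i => [[|[|]]] //= ?; case: j => [[|[|]]] //= ?.
Qed.

Lemma mx2_entries (A : 'M[R[i]]_2) : A = mx2 (A ord0 ord0) (A ord0 ord_max) (A ord_max ord0) (A ord_max ord_max).
Proof.
by apply/matrixP => i j; rewrite !mxE; case: i => [[|[|]]] //= ?; case: j => [[|[|]]] //= ?;
  congr (A _ _); exact: val_inj.
Qed.

Lemma mx2_inj a b c d a' b' c' d' : mx2 a b c d = mx2 a' b' c' d' ->
  [/\ a = a', b = b', c = c' & d = d'].
Proof.
move=> /matrixP e; split.
- by have := e ord0 ord0; rewrite !mxE.
- by have := e ord0 ord_max; rewrite !mxE.
- by have := e ord_max ord0; rewrite !mxE.
- by have := e ord_max ord_max; rewrite !mxE.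
Qed.

Lemma mx2_tr a b c d : \tr (mx2 a b c d) = a + d.
Proof. by rewrite /mxtrace !big_ord_recl big_ord0 !mxE /= addr0. Qed.

Definition mx2E := (mx2_mul, mx2_add, mx2_opp, mx2_scale, mx2_one).

End TwoByTwoMatrices.

Section RotationExponential.
Variable R : realType.
Implicit Types (x y : R).

Local Notation Re := complex.Re.
Local Notation Im := complex.Im.
Local Notation nm := (@ComplexField.Normc.normc R).

Lemma cvg_complex (s : nat -> R[i]) (c : R[i]) :
  (fun n => Re (s n)) @ \oo --> Re c -> (fun n => Im (s n)) @ \oo --> Im c ->
  (s : nat -> R[i]^o) @ \oo --> (c : R[i]^o).
Proof.
move=> /cvgrPdist_lt hr /cvgrPdist_lt hi; apply/cvgrPdist_lt => e.
case: e => e e'; rewrite ltcE /= => /andP[/eqP -> e0].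
have e2 : 0 < e / 2 by rewrite divr_gt0.
near=> n.
have h1 : `|Re c - Re (s n)| < e / 2 by near: n; exact: hr.
have h2 : `|Im c - Im (s n)| < e / 2 by near: n; exact: hi.
rewrite nm_norm ltcR; apply: (le_lt_trans (nm_le_ReIm _)).
by rewrite !cE; lra.
Unshelve. all: by end_near. Qed.

Lemma expi_coeff x n : (n`!%:R)^-1 * ('i%C * x%:C) ^+ n = cos_coeff x n +i* sin_coeff x n :> R[i].
Proof.
have fE : (n`!%:R : R[i])^-1 = (n`!%:R^-1)%:C.
  by rewrite fmorphV rmorph_nat.
rewrite fE exprMn -[x%:C ^+ n]rmorphXn /= /cos_coeff /sin_coeff.
have iE : ('i%C : R[i]) ^+ n = ((~~ odd n)%:R * (-1) ^+ n./2) +i* ((odd n)%:R * (-1) ^+ n.-1./2).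
  rewrite -[in LHS](odd_double_half n) exprD -mul2n exprM sqr_i.
  have -> : (-1) ^+ n./2 = ((-1) ^+ n./2)%:C :> R[i] by rewrite rmorphXn /= rmorphN1.
  case: (boolP (odd n)) => on.
    have -> : n.-1./2 = n./2.
      by rewrite -{1}(odd_double_half n) on add1n /= doubleK.
    rewrite expr1; apply: complex_eq; rewrite !cE /=; ring.
  by rewrite expr0 mul1r; apply: complex_eq; rewrite /=; ring.
by rewrite iE; apply: complex_eq; rewrite !cE /= -?exprnP; ring.
Qed.

Lemma cvg_expi x : (series (fun n => (n`!%:R)^-1 * ('i%C * x%:C) ^+ n) : nat -> R[i]^o) @ \oo --> (cis x : R[i]^o).
Proof.
have sE n : series (fun n => (n`!%:R)^-1 * ('i%C * x%:C) ^+ n : R[i]) n =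
    series (cos_coeff x) n +i* series (sin_coeff x) n.
  rewrite /series /=; elim: n => [|n IH]; first by rewrite !big_geq.
  by rewrite !big_nat_recr//= IH expi_coeff.
apply: cvg_complex => /=.
  under eq_fun do rewrite sE /=.
  by rewrite unlock; exact: (@is_cvg_series_cos_coeff R x).
under eq_fun do rewrite sE /=.
by rewrite unlock; exact: (@is_cvg_series_sin_coeff R x).
Qed.

(** [E] and [1 - E] are complementary projections with product 0, so powers, and with them the
    exponential series, act on the two coefficients separately. *)
Lemma expmx_idem (E : 'M[R[i]]_2) x y : E * E = E ->
  expmx (('i%C * x%:C) *: E + ('i%C * y%:C) *: (1 - E)) = cis x *: E + cis y *: (1 - E).
Proof.
move=> EE; set a := 'i%C * x%:C; set b := 'i%C * y%:C.
have EF : E * (1 - E) = 0 by rewrite mulrBr mulr1 EE subrr.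
have FE : (1 - E) * E = 0 by rewrite mulrBl mul1r EE subrr.
have FF : (1 - E) * (1 - E) = 1 - E by rewrite mulrBr mulr1 FE subr0.
have pow n : (a *: E + b *: (1 - E)) ^+ n = a ^+ n *: E + b ^+ n *: (1 - E).
  elim: n => [|n IH]; first by rewrite !expr0 !scale1r addrC subrK.
  rewrite exprS IH mulrDl !mulrDr -!scalerAl -!scalerAr EE EF FE FF.
  by rewrite !scaler0 addr0 add0r !scalerA -!exprS.
have sE : series (fun n => (n`!%:R)^-1 *: (a *: E + b *: (1 - E)) ^+ n) =
    (fun n => series (fun n => (n`!%:R)^-1 * a ^+ n) n *: E + series (fun n => (n`!%:R)^-1 * b ^+ n) n *: (1 - E)).
  apply/funext => n; rewrite /series /= !scaler_suml -big_split /=.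
  by apply: eq_bigr => i _; rewrite pow scalerDr !scalerA.
rewrite /expmx sE; apply: cvg_lim; first exact: norm_hausdorff.
by apply: cvgD; apply: cvgZr_tmp; exact: cvg_expi.
Qed.

End RotationExponential.

(** * Gauge transformation of the Dirac system *)

Section Gauge.
Variable R : realType.
Implicit Types (z t : R) (l : R[i]).
Notation mu := (@lebesgue_measure R).

Local Notation Re := complex.Re.
Local Notation Im := complex.Im.
Local Notation nm := (@ComplexField.Normc.normc R).

Lemma oint_unique (G g : R -> R) c z : loc_integrable g -> rprim G g -> oint c z g = G z - G c.
Proof.
move=> ig pG; have := rprim_const (rprimB (rprim_oint c ig) pG) (aeE _) z c.
rewrite oint_xx sub0r => /(_ (fun=> subrr _)) e.
by apply/eqP; rewrite -subr_eq0 opprB addrCA [oint _ _ _ - _]e subrr.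
Qed.

Lemma mxint_rotation (a b : R -> R) c z : loc_integrable a -> loc_integrable b ->
  mxint c z (fun t => mx2 (a t)%:C ('i%C * (b t)%:C) (- ('i%C * (b t)%:C)) (a t)%:C) =
  mx2 (oint c z a)%:C ('i%C * (oint c z b)%:C) (- ('i%C * (oint c z b)%:C)) (oint c z a)%:C.
Proof.
move=> ia ib; rewrite [LHS]mx2_entries !mxE /=.
have o0 : oint c z (fun=> 0) = 0.
  by rewrite (oint_unique c z (@loc_integrable_cst _ 0) (rprim_cst 0)) subrr.
have oN : oint c z (fun t => - b t) = - oint c z b.
  have ibN : loc_integrable (fun t => - b t).
    by apply: eq_loc_integrable (loc_integrableZ (- 1) ib) => t; rewrite mulN1r.
  by rewrite (oint_unique c z ibN (rprimN (rprim_oint c ib))) oint_xx oppr0 subr0.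
transitivity (mx2 (oint c z a +i* oint c z (fun=> 0)) (oint c z (fun=> 0) +i* oint c z b)
  (oint c z (fun=> 0) +i* oint c z (fun t => - b t)) (oint c z a +i* oint c z (fun=> 0))).
  by congr mx2; congr (_ +i* _); congr oint; apply/funext => t; rewrite ?mxE /= ?cE /=; ring.
by rewrite o0 oN; congr mx2; apply: complex_eq; rewrite ?cE /=; ring.
Qed.

Lemma expmx_rotation (a b : R) :
  expmx (Jmx *m mx2 a%:C ('i%C * b%:C) (- ('i%C * b%:C)) a%:C) =
  cis (- b) *: mx2 (cos a)%:C (sin a)%:C (- (sin a)%:C) (cos a)%:C.
Proof.
(* The spectral projection of [Jmx] for the eigenvalue [i]. The factor next to [Jmx] is [a + i b J],
   so the exponent is [a J - i b], with eigenvalues [i (a - b)] and [i (- a - b)]. *)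
pose E : 'M[R[i]]_2 := mx2 (2^-1)%:C (0 -i* 2^-1) (0 +i* 2^-1) (2^-1)%:C.
have EE : E * E = E.
  by rewrite -[E * E]/(E *m E) /E mx2E; congr mx2; apply: complex_eq; rewrite !cE /=; field.
have F : 1 - E = mx2 (2^-1)%:C (0 +i* 2^-1) (0 -i* 2^-1) (2^-1)%:C.
  by rewrite -[1]/(1%:M) /E !mx2E; congr mx2; apply: complex_eq; rewrite /=; field.
have -> : Jmx *m mx2 a%:C ('i%C * b%:C) (- ('i%C * b%:C)) a%:C =
    ('i%C * (a - b)%:C) *: E + ('i%C * (- a - b)%:C) *: (1 - E).
  by rewrite F /E /Jmx !mx2E; congr mx2; apply: complex_eq; rewrite !cE /=; field.
by rewrite (expmx_idem _ _ EE) F /E !mx2E; congr mx2; apply: complex_eq; rewrite !cE /= ?cosD ?sinD ?cosN ?sinN; field.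
Qed.

Variables (q1 q2 : R -> R) (q : R -> R[i]) (Y : R -> R[i] -> 'M[R[i]]_2).
Hypothesis Qperiodic : forall z : R, Qmx q1 q2 q (z + pi) = Qmx q1 q2 q z.
Hypothesis Qintegrable : mx_integrable `[0, pi[ (Qmx q1 q2 q).

Let p z := (q1 z + q2 z) / 2.
Let m z := Im (q z).
Let pb := pi^-1 * oint 0 pi p.
Let mb := pi^-1 * oint 0 pi m.

Lemma coef_periodic z : [/\ q1 (z + pi) = q1 z, q2 (z + pi) = q2 z & q (z + pi) = q z].
Proof.
have [e1 e2 _ e4] := mx2_inj (Qperiodic z).
by split => //; [exact: (congr1 (@complex.Re R) e1)|exact: (congr1 (@complex.Re R) e4)].
Qed.

Lemma coef_loc_integrable : [/\ loc_integrable q1, loc_integrable q2,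
  loc_integrable (fun z => Re (q z)) & loc_integrable m].
Proof.
have LI g : (forall x, g (x + pi) = g x) -> mu.-integrable `[0, pi[ (EFin \o g) -> loc_integrable g.
  by apply: loc_integrable_periodic; exact: pi_gt0.
have H i j := Qintegrable i j.
split; apply: LI => [x|].
- by have [] := coef_periodic x.
- have [+ _] := H ord0 ord0; congr (_.-integrable _ _).
  by apply/funext => t; rewrite !mxE.
- by have [] := coef_periodic x.
- have [+ _] := H ord_max ord_max; congr (_.-integrable _ _).
  by apply/funext => t; rewrite !mxE.
- by have [_ _ ->] := coef_periodic x.
- have [+ _] := H ord0 ord_max; congr (_.-integrable _ _).
  by apply/funext => t; rewrite !mxE.
- by rewrite /m; have [_ _ ->] := coef_periodic x.
- have [_ +] := H ord0 ord_max; congr (_.-integrable _ _).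
  by apply/funext => t; rewrite !mxE.
Qed.

Let ip : loc_integrable p.
Proof.
have [i1 i2 _ _] := coef_loc_integrable.
by apply: eq_loc_integrable (loc_integrableZ 2^-1 (loc_integrableD i1 i2)) => t; rewrite /p mulrC.
Qed.

Let im : loc_integrable m. Proof. by have [] := coef_loc_integrable. Qed.

Let ipb : loc_integrable (fun t => p t - pb).
Proof. exact: (loc_integrableD ip (@loc_integrable_cst _ (- pb))). Qed.

Let imb : loc_integrable (fun t => m t - mb).
Proof. exact: (loc_integrableD im (@loc_integrable_cst _ (- mb))). Qed.

(** [P] and [N] are the centred phases that occur in [Rmx]. The gauge below uses [M], not centred,
    in place of [N]: it removes [Im q] altogether, which produces the unimodular factor in front of
    the trace, while the mean of [p] survives as a shift of [l]. *)
Let P z := oint 0 z (fun t => p t - pb).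
Let N z := oint 0 z (fun t => m t - mb).
Let M z := oint 0 z m.

Let pP : rprim P (fun t => p t - pb). Proof. exact: rprim_oint. Qed.
Let pM : rprim M m. Proof. exact: rprim_oint. Qed.

Lemma phase_pi : P pi = 0.
Proof.
have pp : rprim (fun z => oint 0 z p - pb * z) (fun t => p t - pb).
  by apply: eq_rprim (rprimB (rprim_oint 0 ip) (rprimZ pb (rprim_id R))) => // t; rewrite mulr1.
rewrite /P (oint_unique 0 pi ipb pp) oint_xx mulr0 !subr0 /pb mulrAC mulVf ?mul1r ?subrr//.
by rewrite gt_eqF// pi_gt0.
Qed.

Lemma phase_periodic z : P (z + pi) = P z.
Proof.
have e : {ae mu, forall x, p (x + pi) - pb - (p x - pb) = 0}.
  by apply: aeE => x; rewrite /p; have [-> -> _] := coef_periodic x; rewrite subrr.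
have := rprim_const (rprimB (rprim_shift pi pP) pP) e z 0.
by rewrite add0r phase_pi /P oint_xx subrr => /eqP; rewrite subr_eq0 => /eqP.
Qed.

(* With P the integral of p - pb and M that of m, this is the potential seen by
   exp (i (M - P)) (y0 - i y1) / 2 and exp (i (M + P)) (y0 + i y1) / 2. *)
Definition gauged z : R[i] := cis (- P z) ^+ 2 * (Re (q z) +i* ((q1 z - q2 z) / 2)).

Lemma gauged_periodic z : gauged (z + pi) = gauged z.
Proof. by rewrite /gauged phase_periodic; have [-> -> ->] := coef_periodic z. Qed.

Lemma gauged_dominated : exists om w, dominated gauged om w.
Proof.
pose w z := `|Re (q z)| + `|(q1 z - q2 z) / 2|.
have iw : loc_integrable w.
  have [i1 i2 i3 _] := coef_loc_integrable.
  apply: loc_integrableD; apply: loc_integrable_norm => //.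
  apply: eq_loc_integrable (loc_integrableD (loc_integrableZ 2^-1 i1) (loc_integrableZ (- 2^-1) i2)) => t.
  by field.
exists (fun z => oint 0 z w), w; split; first exact: rprim_oint.
move=> z; rewrite /gauged nmM nmX nm_cis expr1n mul1r; exact: nm_le_ReIm.
Qed.

Lemma Q2mxE z : Q2mx q1 q2 q z = mx2 (p z)%:C ('i%C * (m z)%:C) (- ('i%C * (m z)%:C)) (p z)%:C.
Proof.
by rewrite /Q2mx /sigma0 /sigma2 !mx2E -/(p z) -/(m z); congr mx2; ring.
Qed.

Lemma Q2tildeE z : Q2tilde q1 q2 q z = mx2 pb%:C ('i%C * mb%:C) (- ('i%C * mb%:C)) pb%:C.
Proof.
rewrite /Q2tilde (funext Q2mxE) (mxint_rotation 0 pi ip im) mx2_scale.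
by congr mx2; apply: complex_eq; rewrite !cE /= /pb /mb; ring.
Qed.

Lemma RmxE z : Rmx q1 q2 q z = cis (- N z) *: mx2 (cos (P z))%:C (sin (P z))%:C (- (sin (P z))%:C) (cos (P z))%:C.
Proof.
rewrite /Rmx -expmx_rotation; congr (expmx (_ *m _)).
rewrite -(mxint_rotation 0 z ipb imb); congr mxint; apply/funext => t.
by rewrite Q2mxE Q2tildeE !mx2E; congr mx2; apply: complex_eq; rewrite !cE /=; ring.
Qed.

(** The scalar phase of [Rmx] cancels in the conjugation. Conjugating by the rotation through [P]
    multiplies by [exp(- 2 i P)] the complex number that encodes the trace-free symmetric matrix
    [Q_1]. *)
Lemma Q1tildeE z : Q1tilde q1 q2 q z =
  mx2 (Im (gauged z))%:C (Re (gauged z))%:C (Re (gauged z))%:C (- (Im (gauged z))%:C).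
Proof.
pose S := cis (N z) *: mx2 (cos (P z))%:C (- (sin (P z))%:C) (sin (P z))%:C (cos (P z))%:C.
have cc : cis (N z) * cis (- N z) = 1 by rewrite -cisD subrr cis0.
have cs : (cos (P z))%:C * (cos (P z))%:C + (sin (P z))%:C * (sin (P z))%:C = 1 :> R[i].
  by apply: complex_eq; rewrite !cE /= -?(cos2Dsin2 (P z)); ring.
have RS : Rmx q1 q2 q z *m S = 1%:M.
  rewrite RmxE /S -scalemxAl -scalemxAr scalerA [cis (- _) * _]mulrC cc scale1r mx2_mul mx2_one.
  by congr mx2; rewrite -?cs; ring.
have Ru := mulmx1_unit RS.
have -> : Q1tilde q1 q2 q z = S *m Q1mx q1 q2 q z *m Rmx q1 q2 q z.
  rewrite /Q1tilde; congr (_ *m _ *m _).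
  by rewrite -[LHS]mulmx1 -RS mulKmx//; case: Ru.
rewrite RmxE /S -!scalemxAl -scalemxAr scalerA cc scale1r /Q1mx /sigma1 /sigma3 !mx2E.
by congr mx2; apply: complex_eq; rewrite /gauged /= ?expr2 ?cosN ?sinN ?cE /=; ring.
Qed.

Lemma gauged_antiperiodic (L : R) : L + L = pi ->
  ae_antiperiodic L (Q1mx q1 q2 q) -> ae_periodic L (Q2mx q1 q2 q) ->
  {ae mu, forall z, gauged (z + L) = - gauged z}.
Proof.
move=> LL a1 a2.
have e : {ae mu, forall x, p (x + L) - pb - (p x - pb) = 0}.
  apply: aeW a2 => x; rewrite !Q2mxE => /mx2_inj[+ _ _ _] => /(congr1 (@complex.Re R))/= ->.
  by rewrite subrr.
have Pc z := rprim_const (rprimB (rprim_shift L pP) pP) e z 0.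
(* The increment of [P] over [L] is constant, and two of them make the increment over a period,
   which is 0 since [p - pb] has mean 0. *)
have PL : P (0 + L) - P 0 = 0.
  have P0 : P 0 = 0 by rewrite /P oint_xx.
  by have := Pc L; rewrite LL phase_pi P0 [0 + L]add0r; lra.
apply: aeW a1 => z; rewrite /Q1mx /sigma1 /sigma3 !mx2E => /mx2_inj[e1 e2 _ _].
have := Pc z; rewrite PL => /eqP; rewrite subr_eq0 => /eqP Pz.
rewrite /gauged Pz -mulrN; congr (_ * _); apply: complex_eq.
  by have := congr1 (@complex.Re R) e2; rewrite !cE /=; lra.
by have := congr1 (@complex.Re R) e1; rewrite !cE /=; lra.
Qed.

Lemma solution_entries l (Z : R -> 'M[R[i]]_2) (j : 'I_2) : is_solution (Qmx q1 q2 q) l Z ->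
  cprim (fun z => Z z ord0 j)
    (fun z => (q z)^*%C * Z z ord0 j + (q2 z)%:C * Z z ord_max j - l * Z z ord_max j) /\
  cprim (fun z => Z z ord_max j)
    (fun z => l * Z z ord0 j - (q1 z)%:C * Z z ord0 j - q z * Z z ord_max j).
Proof.
move=> [ac ode].
have prim i : cprim (fun z => Z z i j) (fun z => mx_derive Z z i j).
  have [acr aci] := ac i j.
  split; split => //; apply: aeW ode => z [+ _] => /(_ i j)[dr di];
    by rewrite mxE /= derive1E; exact/derivableP.
have l0 : lift ord0 ord0 = ord_max :> 'I_2 by exact: val_inj.
split; apply: cprim_ae (prim _) _; apply: aeW ode => z [_ /matrixP e].
  have := e ord_max j; rewrite !mxE !big_ord_recl !big_ord0 l0 !mxE /= => e1.
  by apply: oppr_inj; rewrite -[RHS]addr0 -(subrr (l * Z z ord_max j)) -{1}e1; ring.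
have := e ord0 j; rewrite !mxE !big_ord_recl !big_ord0 l0 !mxE /= => e1.
by rewrite -e1; ring.
Qed.

(** The combinations [y0 - i y1] and [y0 + i y1] are coordinates in the eigenbasis of [J]; the
    phases are integrating factors for [Im q] and for the centred part of [p], and their ratio
    enters the potential as [exp(- 2 i P)]. *)
Lemma gauge_zs l (y0 y1 : R -> R[i]) :
  cprim y0 (fun z => (q z)^*%C * y0 z + (q2 z)%:C * y1 z - l * y1 z) ->
  cprim y1 (fun z => l * y0 z - (q1 z)%:C * y0 z - q z * y1 z) ->
  zs gauged (l - pb%:C) (fun z => cis (M z - P z) * ((2^-1)%:C * (y0 z - 'i%C * y1 z)))
    (fun z => cis (M z + P z) * ((2^-1)%:C * (y0 z + 'i%C * y1 z))).
Proof.
move=> p0 p1.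
have conjM (a b : R[i]) : (a * b)^*%C = a^*%C * b^*%C.
  by apply: complex_eq; rewrite !cE; ring.
pose r z := (q1 z - q2 z) / 2.
have q1E z : q1 z = p z + r z by rewrite /p /r; field.
have q2E z : q2 z = p z - r z by rewrite /p /r; field.
have c1 z : cis (- P z) ^+ 2 * cis (M z + P z) = cis (M z - P z).
  by rewrite expr2 -!cisD; congr cis; ring.
have c2 z : (cis (- P z) ^+ 2)^*%C * cis (M z - P z) = cis (M z + P z).
  have cN x : (cis x)^*%C = cis (- x) by rewrite /cis cosN sinN.
  by rewrite expr2 conjM !cN opprK -!cisD; congr cis; ring.
split.
  apply: eq_cprim (cprimM (cprim_cis (rprimB pM pP))
    (cprimZ (2^-1)%:C (cprimB p0 (cprimZ 'i%C p1)))) => // z.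
  set X := cis (M z - P z); set u0 : R[i] := (Re (q z) +i* r z).
  transitivity (X * (- 'i%C * (l - pb%:C) * ((2^-1)%:C * (y0 z - 'i%C * y1 z)) +
     u0 * ((2^-1)%:C * (y0 z + 'i%C * y1 z)))); last first.
    by rewrite mulrDr /gauged -/u0 /X -c1; ring.
  rewrite [_ * X]mulrC -!mulrA -mulrDr; congr (_ * _).
  clear p0 p1; rewrite /u0 q1E q2E /m; move: (p z) (r z) (y0 z) (y1 z) (q z) l => a b [c c'] [d d'] [x x'] [v v'].
by apply/eqP; rewrite eq_complex /=; apply/andP; split; apply/eqP; ring.
apply: eq_cprim (cprimM (cprim_cis (rprimD pM pP))
  (cprimZ (2^-1)%:C (cprimD p0 (cprimZ 'i%C p1)))) => // z.
set X := cis (M z + P z); set u0 : R[i] := (Re (q z) +i* r z).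
transitivity (X * (u0^*%C * ((2^-1)%:C * (y0 z - 'i%C * y1 z)) +
   'i%C * (l - pb%:C) * ((2^-1)%:C * (y0 z + 'i%C * y1 z)))); last first.
  by rewrite mulrDr /gauged -/u0 /X -c2 conjM; ring.
rewrite [_ * X]mulrC -!mulrA -mulrDr; congr (_ * _).
clear p0 p1; rewrite /u0 q1E q2E /m; move: (p z) (r z) (y0 z) (y1 z) (q z) l => a b [c c'] [d d'] [x x'] [v v'].
by apply/eqP; rewrite eq_complex /=; apply/andP; split; apply/eqP; ring.
Qed.

Hypothesis Yfundamental : is_fundamental (Qmx q1 q2 q) Y.

Lemma gauged_fund : exists f g h k, fund gauged f g h k /\
  forall l, discriminant Y l = cis (- M pi) * (f (l - pb%:C) pi + k (l - pb%:C) pi).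
Proof.
(* Entry [i] of [Y] applied to the vector [(1, c)]. For [c = i] and [c = - i] these are the
   eigenvectors of [J], which the gauge at 0 maps to the standard basis. *)
pose y (i : 'I_2) (c : R[i]) l z := Y z (l + pb%:C) i ord0 + c * Y z (l + pb%:C) i ord_max.
pose al c l z := cis (M z - P z) * ((2^-1)%:C * (y ord0 c l z - 'i%C * y ord_max c l z)).
pose be c l z := cis (M z + P z) * ((2^-1)%:C * (y ord0 c l z + 'i%C * y ord_max c l z)).
have Z c l : zs gauged l (al c l) (be c l).
  have [S _] := Yfundamental (l + pb%:C).
  have [s1 s2] := solution_entries ord0 S; have [t1 t2] := solution_entries ord_max S.
  rewrite -[l in zs _ l](addrK pb%:C); apply: gauge_zs.
    by apply: eq_cprim (cprimD s1 (cprimZ c t1)) => // z; rewrite /y; ring.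
  by apply: eq_cprim (cprimD s2 (cprimZ c t2)) => // z; rewrite /y; ring.
have P0 : P 0 = 0 by rewrite /P oint_xx.
have M0 : M 0 = 0 by rewrite /M oint_xx.
exists (al 'i%C), (be 'i%C), (al (- 'i%C)), (be (- 'i%C)); split.
  move=> l; have [_ Y0] := Yfundamental (l + pb%:C).
  split; [exact: Z|exact: Z| |]; split;
    rewrite /al /be /y P0 M0 Y0 ?subr0 ?addr0 cis0 mul1r !mxE /=;
    by apply: complex_eq; rewrite !cE /=; field.
(* As [P] vanishes at [pi], the gauge there is the gauge at 0 times a scalar, so traces differ by
   that scalar. *)
move=> l; rewrite /al /be /y phase_pi subr0 addr0 subrK /discriminant.
rewrite [Y pi l]mx2_entries mx2_tr -mulrDr mulrA -cisD addNr cis0 mul1r.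
by rewrite !mxE /=; apply: complex_eq; rewrite !cE /=; field.
Qed.

End Gauge.

(** * From expansions of the trace to zeros of the discriminant *)

Section DiscriminantZeros.
Variable R : realType.
Implicit Types (l eta : R[i]) (P : {poly R[i]}) (C : R).

Local Notation nm := (@ComplexField.Normc.normc R).

(** The derivatives of [g] are read off its own expansion [p]; [P] is [p] with the affine map
    undone, so orders of vanishing transfer. *)
Lemma affine_jet (D g : R[i] -> R[i]) (a b : R[i]) : a != 0 -> ujet 3 D ->
  (forall l, g l = a * D (l + b) - 2 * a) -> forall l, exists P C, [/\
  forall eta, nm eta <= 1 -> nm (D (l + b + eta) - P.[eta]) <= C * nm eta ^+ 3,
  derive1n 0 (g : R[i] -> R[i]^o) l = a * (P`_0 - 2),
  derive1n 1 (g : R[i] -> R[i]^o) l = a * P`_1 &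
  derive1n 2 (g : R[i] -> R[i]^o) l = 2 * (a * P`_2)].
Proof.
move=> a0 jD gE l.
have jg : ujet 3 g.
  by rewrite (_ : g = fun l => a * D (l + b) + - (2 * a)); [exact: ujet_affine|apply/funext => x; rewrite gE].
have [p [C [_ H d0 d1 d2]]] := ujet3_derive jg l.
exists (a^-1 *: p + 2%:P), (nm a^-1 * C); rewrite d0 d1 d2 !coefD !coefZ !coefC /= !addr0 addrK.
rewrite !mulVKf //; split => // eta e1.
rewrite hornerD hornerZ hornerC.
rewrite (_ : _ - _ = a^-1 * (g (l + eta) - p.[eta])).
  by rewrite nmM -mulrA ler_wpM2l ?nm_ge0// H.
by rewrite gE [l + eta + b]addrAC; field.
Qed.

End DiscriminantZeros.

Theorem theorem5p2 (R : realType) (q1 q2 : R -> R) (q : R -> R[i])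
    (Y : R -> R[i] -> 'M[R[i]]_2)
    (Qperiodic : forall z : R, Qmx q1 q2 q (z + pi) = Qmx q1 q2 q z)
    (Qintegrable : mx_integrable `[0, pi[ (Qmx q1 q2 q))
    (Yfundamental : is_fundamental (Qmx q1 q2 q) Y) :
  let f := fun l : R[i] =>
    discriminant Y l
    - 2 * cexp (- 'i%C * (oint 0 pi (fun t => complex.Im (q t)))%:C) in
  (ae_antiperiodic (pi / 2) (Q1mx q1 q2 q) /\
   ae_periodic (pi / 2) (Q2mx q1 q2 q) ->
   only_double_zeros f)
  /\
  (only_double_zeros f ->
   ae_antiperiodic (pi / 2) (Q1tilde q1 q2 q) /\
   ae_periodic (pi / 2) (Q2tilde q1 q2 q)).
Proof.
move=> f0.
have LL : pi / 2 + pi / 2 = pi :> R by rewrite -splitr.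
have L0 : 0 < pi / 2 :> R by rewrite divr_gt0 ?pi_gt0.
have [om [w D]] := gauged_dominated Qperiodic Qintegrable.
have [f [g [h [k [F dE]]]]] := gauged_fund Qperiodic Qintegrable Yfundamental.
set b := (X in forall l, _ = _ * (f (l - X) _ + _)) in dE.
set c := cis _ in dE.
pose disc l := f l (pi / 2 + pi / 2) + k l (pi / 2 + pi / 2).
have c0 : c != 0 by rewrite -nm_gt0 nm_cis.
(* The exponential subtracted in [f0] is the unimodular factor [c] itself, so [f0] is [c] times
   [disc - 2] with shifted argument. *)
have f0E l : f0 l = c * disc (l + - b) - 2 * c.
  rewrite /f0 dE /disc LL; congr (_ - 2 * _).
  rewrite /c /cexp /cis; apply: complex_eq;
    by rewrite !cE /= !(mul0r, mulr0, mulN1r, oppr0, subr0, add0r, addr0, mul1r, expR0).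
have jets := affine_jet c0 (disc_ujet D L0 F 3) f0E.
split.
  move=> [a1 a2] l l0.
  have [P [C [H d0 d1 d2]]] := jets l.
  have /eqP := l0; rewrite f0E -[2 * c]mulrC -mulrBr mulf_eq0 (negPf c0) subr_eq0 /= => /eqP dl.
  have [P1 P2] := antiperiodic_double_zeros D L0 F (gauged_antiperiodic Qperiodic Qintegrable LL a1 a2) dl H.
  split; first by case=> [|[|]]// _; rewrite ?d1 ?P1 ?mulr0.
  by rewrite d2; apply/eqP; rewrite !mulf_neq0// pnatr_eq0.
move=> double.
have per z : gauged q1 q2 q (z + (pi / 2 + pi / 2)) = gauged q1 q2 q z.
  by rewrite LL gauged_periodic.
have anti : {ae (@lebesgue_measure R), forall z, gauged q1 q2 q (z + pi / 2) = - gauged q1 q2 q z}.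
  apply: (double_zeros_antiperiodic D L0 F per) => l; rewrite -/(disc l) => dl.
  have [P [C [H d0 d1 d2]]] := jets (l + b).
  have l0 : f0 (l + b) = 0 by rewrite f0E addrK dl; ring.
  have [Z1 Z2] := double _ l0.
  rewrite addrK in H; exists P, C; split => //.
  - have := Z1 0%N isT; rewrite d0 => /eqP; rewrite mulf_eq0 (negPf c0) subr_eq0 => /eqP ->; ring.
  - by have := Z1 1%N isT; rewrite d1 => /eqP; rewrite mulf_eq0 (negPf c0) => /eqP.
  - by move/eqP: Z2; rewrite d2 !mulf_eq0 (negPf c0) pnatr_eq0.
split.
  apply: aeW anti => z e; rewrite !(Q1tildeE Qperiodic Qintegrable) e mx2_opp.
  by congr mx2; apply: complex_eq; rewrite !cE /= ?oppr0.
by apply: aeE => z; rewrite !(Q2tildeE Qperiodic Qintegrable).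
Qed.
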